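(* Let $K$ be a number field, let $p_1<p_2<p_3<\cdots$ be a sequence of positive primes, and let $d_1,d_2,d_3,\ldots$ be a sequence of positive integers. For each $i$ let $p_i^{1/d_i}$ be any (complex, algebraic) $d_i$-th root of $p_i$. Then the field $K(p_1^{1/d_1},p_2^{1/d_2},p_3^{1/d_3},\ldots)$ has the Northcott property if and only if $|p_i^{1/d_i}|\longrightarrow \infty$ as $i$ tends to infinity, where $|\cdot|$ denotes the complex modulus.
   Context: All fields lie in a fixed algebraic closure $\overline{\mathbb{Q}}\subset\mathbb{C}$ of $\mathbb{Q}$. $H(\cdot)$ denotes the non-logarithmic absolute Weil height on $\overline{\mathbb{Q}}$: for $\alpha$ in a number field $F$, $H(\alpha)=\prod_v \max\{1,|\alpha|_v\}^{[F_v:\mathbb{Q}_v]/[F:\mathbb{Q}]}$, the product over all places $v$ of $F$, with $|\cdot|_v$ extending the usual absolute values of $\mathbb{Q}$. A subset $\mathcal{A}\subseteq\overline{\mathbb{Q}}$ has the Northcott property (property $(N)$) if for each positive real $X$ there are only finitely many $\alpha\in\mathcal{A}$ with $H(\alpha)\le X$. *)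

(* Defs.v *)
From mathcomp Require Import all_boot all_order all_algebra all_field.
From mathcomp Require Import all_classical all_reals all_analysis.
Import Order.TTheory GRing.Theory Num.Theory numFieldNormedType.Exports.

Set Implicit Arguments.
Unset Strict Implicit.
Unset Printing Implicit Defensive.

Local Open Scope classical_set_scope.
Local Open Scope ring_scope.

Definition padic_norm (R : realType) (p : nat) (q : rat) : R :=
  if q == 0 then 0
  else p%:R ^ ((logn p `|denq q|)%:Z - (logn p `|numq q|)%:Z).

Definition absolute_value (R : realType) (F : fieldType) (v : F -> R) : Prop :=
  [/\ forall x, 0 <= v x,
      forall x, v x = 0 <-> x = 0,
      {morph v : x y / x * y}
    & forall x y, v (x + y) <= v x + v y].

(* Every place of the number field F contains exactly one absolute value that *)
(* restricts to |.| or to some |.|_p on Q, so places are identified with      *)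
(* these normalized representatives.                                          *)
Definition places (R : realType) (F : fieldExtType rat) : set (F -> R) :=
  [set v | absolute_value v /\
     ((forall q : rat, v q%:A = ratr `|q|) \/
      (exists2 p, prime p & forall q : rat, v q%:A = padic_norm R p q))].

Definition cauchy_for (R : realType) (F : fieldType) (v : F -> R)
    (x : nat -> F) : Prop :=
  forall e : R, 0 < e ->
    exists N, forall m n, (N <= m)%N -> (N <= n)%N -> v (x m - x n) < e.

Definition null_for (R : realType) (F : fieldType) (v : F -> R)
    (x : nat -> F) : Prop :=
  v (x k) @[k --> \oo] --> (0 : R).

(* The completion F_v is the ring of v-Cauchy sequences of F modulo the       *)
(* v-null ones, and Q_v is the subfield of the classes of v-Cauchy sequences  *)
(* of rationals. [completion_basis v b] says that the classes of the b i form *)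
(* a basis of F_v over Q_v.                                                   *)
Definition completion_basis (R : realType) (F : fieldExtType rat) (v : F -> R)
    (n : nat) (b : 'I_n -> nat -> F) : Prop :=
  let Qv_coords (c : 'I_n -> nat -> rat) :=
    forall i, cauchy_for v (fun k => (c i k)%:A) in
  [/\ forall i, cauchy_for v (b i),
      forall x, cauchy_for v x -> exists2 c, Qv_coords c &
        null_for v (fun k => x k - \sum_i c i k *: b i k)
    & forall c, Qv_coords c -> null_for v (fun k => \sum_i c i k *: b i k) ->
        forall i, null_for v (fun k => (c i k)%:A)].

(* [F_v : Q_v]; the default value 0 is never reached when v is a place.       *)
Definition local_degree (R : realType) (F : fieldExtType rat) (v : F -> R)
    : nat :=
  xget 0%N [set n | exists b : 'I_n -> nat -> F, completion_basis v b].

(* All but finitely many factors are 1, so this finitely supported product is *)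
(* the full product over the places.                                          *)
Definition field_height (R : realType) (F : fieldExtType rat) (a : F) : R :=
  \big[*%R/1]_(v \in @places R F)
    (Num.max 1 (v a)) `^ ((local_degree v)%:R / (\dim {:F})%:R).

(* The absolute height does not depend on the number field containing alpha;  *)
(* it is computed here in Q(alpha), as provided by [num_field_exists].        *)
Definition weil_height (R : realType) (alpha : algC) : R :=
  let: existT F (existT _ (exist2 s _ _)) := num_field_exists [:: alpha] in
  @field_height R F s`_0.

Definition northcott (R : realType) (A : set algC) : Prop :=
  forall X : R, 0 < X ->
    finite_set [set alpha | A alpha /\ weil_height R alpha <= X].

Definition subfield_generated (S : set algC) : set algC :=
  smallest [set E : set algC | divring_closed (mem E)] S.

(* Main.v *)
(* Let [|r_i| -> oo]. For large [i] the prime [p_i] is unramified in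
   [L_i = K(r_0, ..., r_(i-1))]: it exceeds all [p_j] and [d_j] with [j < i].
   If [y] lies in [L_(i+1)] but not in [L_i], it has a conjugate [y'] over [L_i]
   different from [y], and writing [y] in powers of [r_i] gives
   [|y - y'|_v <= p_i^(-1/d_i) max(1, |y|_v) max(1, |y'|_v)] at every place [v]
   above [p_i]. The product formula for [y - y'] then yields
   [|r_i| <= 2 H(y)^2], so that elements of bounded height all lie in one of the
   number fields [L_i], where Northcott's theorem applies. Conversely
   [H(r_i) <= max(1, |r_i|)], and the [r_i] are distinct.

   The local degree [F_v : Q_v] is computed as the largest size of a family of
   elements of [F] that is uniformly independent over the rationals with respect
   to [v]; weak approximation bounds the sum of the local degrees, and a fixed
   linear relation between embeddings bounds each of them from below by the
   number of embeddings inducing [v]. *)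
From HB Require Import structures.
Require Import Defs.
From mathcomp Require Import all_boot all_order all_algebra all_field all_fingroup.
From mathcomp Require Import all_classical all_reals all_analysis.
From mathcomp Require Import zify ring lra.
Import Order.TTheory GRing.Theory Num.Theory numFieldNormedType.Exports.

Set Implicit Arguments.
Unset Strict Implicit.
Unset Printing Implicit Defensive.

Local Open Scope classical_set_scope.
Local Open Scope ring_scope.

(** * Absolute values *)

(** Heights are defined through completions of the varying fields Q(alpha), whereas the estimates
    compare conjugates inside one normal field N. The bridge is one absolute value w_b on all of
    algC for each place b of Q: products over the Galois group of N then replace products over the
    places above b. These Galois products must be bounded above by a power of the height, whence the
    lower bound on local degrees by numbers of embeddings; the upper bound on their sum gives the
    finiteness of the places above b and the estimate of H(r_i). That p_i exceeds d_j follows from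
    the growth hypothesis: once |r_j| > 2, one has d_j < 2^d_j < p_j. In the bound 2 H(y)^2 the 2 is
    the triangle inequality at infinity, and the square appears because y and y' have the same
    conjugates. The estimate of |y - y'|_v rests on the terms a_k r_i^k having valuations in
    distinct classes k/d_i modulo 1: no cancellation hides a large term of y, and the term k = 0
    drops out of y - y'. *)

Section AbsoluteValue.
Variables (R : realType) (F : fieldType) (v : F -> R).
Hypothesis av : absolute_value v.

Lemma av_ge0 x : 0 <= v x. Proof. by case: av. Qed.

Lemma av0 : v 0 = 0. Proof. by case: av => _ + _ _; move=> /(_ 0) [_ ->]. Qed.

Lemma avM : {morph v : x y / x * y}. Proof. by case: av. Qed.

Lemma avD x y : v (x + y) <= v x + v y. Proof. by case: av. Qed.

Lemma av_eq0 x : (v x == 0) = (x == 0).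
Proof. by case: av => _ h _ _; apply/eqP/eqP => /h. Qed.

Lemma av_gt0 x : (0 < v x) = (x != 0).
Proof. by rewrite lt_def av_ge0 andbT av_eq0. Qed.

Lemma av1 : v 1 = 1.
Proof.
have n0 : v 1 != 0 by rewrite av_eq0 oner_eq0.
by apply: (mulfI n0); rewrite -avM !mulr1.
Qed.

Lemma avX x n : v (x ^+ n) = v x ^+ n.
Proof. by elim: n => [|n IH]; rewrite ?expr0 ?av1 // !exprS avM IH. Qed.

Lemma avN x : v (- x) = v x.
Proof.
suff e : v (-1) = 1 by rewrite -mulN1r avM e mul1r.
apply/eqP; rewrite -(@pexpr_eq1 _ _ 2) ?av_ge0 //.
by rewrite -avX sqrrN expr1n av1.
Qed.

Lemma avB x y : v (x - y) <= v x + v y.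
Proof. by rewrite -(avN y) avD. Qed.

Lemma av_distC x y : v (x - y) = v (y - x).
Proof. by rewrite -avN opprB. Qed.

Lemma avV x : v x^-1 = (v x)^-1.
Proof.
have [->|x0] := eqVneq x 0; first by rewrite invr0 av0 invr0.
have vx0 : v x != 0 by rewrite av_eq0.
by apply: (mulfI vx0); rewrite -avM !divff // av1.
Qed.

Lemma av_sum (I : Type) (s : seq I) (P : pred I) (f : I -> F) :
  v (\sum_(i <- s | P i) f i) <= \sum_(i <- s | P i) v (f i).
Proof.
apply: (big_ind2 (fun x y => v x <= y)) => //; first by rewrite av0.
by move=> x1 x2 y1 y2 h1 h2; rewrite (le_trans (avD _ _)) // lerD.
Qed.

Lemma av_prod (I : Type) (s : seq I) (P : pred I) (f : I -> F) :
  v (\prod_(i <- s | P i) f i) = \prod_(i <- s | P i) v (f i).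
Proof. by apply: (big_morph _ avM av1). Qed.

Lemma av_sub_le x y : v x - v y <= v (x - y).
Proof. by rewrite lerBlDr (le_trans _ (avD _ _)) // subrK. Qed.

Lemma av_comp (E : fieldType) (f : {rmorphism E -> F}) :
  absolute_value (v \o f).
Proof.
split=> [x|x|x y|x y] /=; first exact: av_ge0.
- split=> [/eqP|->]; last by rewrite rmorph0 av0.
  by rewrite av_eq0 fmorph_eq0 => /eqP.
- by rewrite rmorphM avM.
- by rewrite rmorphD avD.
Qed.

End AbsoluteValue.

(** * The local degree *)

Lemma linear_dependence (K : fieldType) (I : finType) n (A : I -> 'I_n -> K) :
  (n < #|I|)%N ->
  exists2 u : I -> K, exists i, u i != 0 & forall j, \sum_i u i * A i j = 0.
Proof.
move=> ltn; pose M := \matrix_(i < #|I|, j < n) A (enum_val i) j.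
have : kermx M != 0.
  by rewrite -mxrank_eq0 mxrank_ker subn_eq0 -ltnNge (leq_ltn_trans (rank_leq_col _)).
case/rowV0Pn => w /sub_kermxP wM /rV0Pn [i wi].
exists (fun x => w 0 (enum_rank x)); first by exists (enum_val i); rewrite enum_valK.
move=> j; have /matrixP/(_ 0 j) := wM; rewrite !mxE; apply: etrans.
rewrite (reindex_onto (@enum_val I I) enum_rank) /=; last first.
  by move=> *; rewrite enum_rankK.
by apply: eq_big => [k|k _]; rewrite ?mxE enum_valK ?eqxx.
Qed.

Lemma sum_option (V : nmodType) (I : finType) (f : option I -> V) :
  \sum_i f i = f None + \sum_i f (Some i).
Proof.
rewrite (bigD1 None) //=; congr (_ + _).
rewrite (reindex_omap (@Some I) id) /=; last by case.
by apply: eq_bigl => i; rewrite eqxx.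
Qed.

Section LocalDegree.
Variables (R : realType) (F : fieldExtType rat) (v : F -> R).
Hypothesis av : absolute_value v.

Lemma avZ (c : rat) x : v (c *: x) = v c%:A * v x.
Proof. by rewrite -(avM av) mulr_algl. Qed.

(** The bound passes to v-adic limits of the coefficients, so it expresses independence over Q_v
    although only rational coefficients occur; plain independence over Q would be weaker. *)
Definition v_indep (I : finType) (g : I -> F) := exists2 e : R, 0 < e &
  forall (c : I -> rat) i, e * v (c i)%:A <= v (\sum_j c j *: g j).

(** Density of the rational span stands for spanning F_v over Q_v. *)
Definition v_dense (I : finType) (g : I -> F) := forall x (e : R), 0 < e ->
  exists c : I -> rat, v (x - \sum_j c j *: g j) < e.

Lemma indep_card (I : finType) (g : I -> F) :
    (forall c : I -> rat, \sum_i c i *: g i = 0 -> forall i, c i = 0) ->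
  (#|I| <= \dim {:F})%N.
Proof.
move=> ind; rewrite leqNgt; apply/negP => ltI.
have [u [i ui0] h] := linear_dependence (fun i j => coord (vbasis {:F}) j (g i)) ltI.
case/eqP: ui0; apply: ind.
under eq_bigr => k _ do rewrite (coord_vbasis (memvf (g k))) scaler_sumr.
rewrite exchange_big big1 // => j _; rewrite -[RHS](scale0r (vbasis {:F})`_j) -(h j) scaler_suml.
by apply: eq_bigr => k _; rewrite scalerA.
Qed.

Lemma indep_comb (I : finType) (g : I -> F) (c : I -> rat) :
  v_indep g -> \sum_i c i *: g i = 0 -> forall i, c i = 0.
Proof.
move=> [e e0 h] s0 i; move: (h c i); rewrite s0 av0 // pmulr_rle0 // => cle.
have /eqP: v (c i)%:A == 0 by rewrite eq_le cle av_ge0.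
move/eqP; rewrite av_eq0 // scaler_eq0 oner_eq0 orbF; exact: eqP.
Qed.

Lemma v_indep_card (I : finType) (g : I -> F) :
  v_indep g -> (#|I| <= \dim {:F})%N.
Proof. by move=> h; apply: (@indep_card _ g) => c; apply: indep_comb. Qed.

Lemma v_indep_ord (I : finType) (g : I -> F) :
  v_indep g -> v_indep (fun k : 'I_#|I| => g (enum_val k)).
Proof.
move=> [e e0 h]; exists e => // c i.
have := h (fun x => c (enum_rank x)) (enum_val i); rewrite enum_valK.
rewrite (reindex_onto (@enum_val I I) enum_rank) //=; last first.
  by move=> *; rewrite enum_rankK.
rewrite (eq_bigl xpredT); last by move=> j; rewrite enum_valK eqxx.
by under eq_bigr => j _ do rewrite enum_valK.
Qed.

Lemma exists_max_indep : exists m, exists2 g : 'I_m -> F, v_indep g &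
  forall m' (g' : 'I_m' -> F), v_indep g' -> (m' <= m)%N.
Proof.
pose P m := `[< exists g : 'I_m -> F, v_indep g >].
have P0 : exists m, P m.
  by exists 0%N; apply/asboolP; exists (fun=> 0); exists 1 => // c [].
have Pb m : P m -> (m <= \dim {:F})%N.
  by case/asboolP => g /v_indep_card; rewrite card_ord.
have [m /asboolP [g ig] mM] := ex_maxnP P0 Pb.
by exists m, g => // m' g' ig'; apply: mM; apply/asboolP; exists g'.
Qed.

(* Independence of [g] prevents the coefficient of [x] from being negligible
   in a combination that is tiny compared to its coefficients, so one may
   divide by it. *)
Lemma small_dependence (I : finType) (D : pred I) (g : I -> F) (d e : R)
    (x : F) (c0 : rat) (c : I -> rat) :
    0 < d -> 0 < e -> e <= d / 2 ->
    (forall c' : I -> rat, (forall i, ~~ D i -> c' i = 0) ->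
       forall i, d * v (c' i)%:A <= v (\sum_j c' j *: g j)) ->
    (forall i, ~~ D i -> c i = 0) ->
    v (c0 *: x + \sum_j c j *: g j) < e * v c0%:A \/
    (exists i, v (c0 *: x + \sum_j c j *: g j) < e * v (c i)%:A) ->
  exists2 c' : I -> rat, forall i, ~~ D i -> c' i = 0 &
    v (x - \sum_j c' j *: g j) < e * Num.max 1 (2 * v x / d).
Proof.
set B := Num.max 1 _; set u := \sum_j _ => d0 e0 ed ig cD ho.
have igu i : d * v (c i)%:A <= v u by apply: ig.
have cN0 : c0 != 0.
  apply/eqP => cz; rewrite cz scale0r add0r in ho.
  case: ho => [|[i]]; first by rewrite scale0r av0 // mulr0 ltNge av_ge0.
  move/lt_le_trans/(_ (ler_wpM2r (av_ge0 av _) ed)).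
  move/(le_lt_trans (igu i)); rewrite ltNge ler_wpM2r ?av_ge0 //.
  by move: d0; lra.
have vN0 : 0 < v c0%:A by rewrite av_gt0 // scaler_eq0 oner_eq0 orbF.
(* If the combination is bounded through a coefficient c i, independence gives d |c i| <= e |c i| +
   |c0| |x|, and e <= d / 2 turns this into |c i| <= (2 |x| / d) |c0|. *)
have vo : v (c0 *: x + u) < e * B * v c0%:A.
  rewrite -mulrA; case: ho => [ho|[i ho]]; apply: (lt_le_trans ho).
    by rewrite ler_wpM2l ?(ltW e0) // ler_peMl ?av_ge0 // le_max lexx.
  rewrite ler_wpM2l ?(ltW e0) //.
  have h1 : d * v (c i)%:A <= e * v (c i)%:A + v c0%:A * v x.
    apply: (le_trans (igu i)); rewrite -avZ -lerBlDr; apply/ltW.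
    apply: le_lt_trans ho; rewrite [leRHS](_ : _ = v (u - - (c0 *: x))).
      by rewrite -(avN av (_ *: x)) av_sub_le.
    by rewrite opprK addrC.
  have h2 : (d / 2) * v (c i)%:A <= v c0%:A * v x.
    have h3 := ler_wpM2r (av_ge0 av (c i)%:A) ed.
    by rewrite -[X in X * _](addrK (d / 2)) -splitr mulrBl lerBlDl (le_trans h1) // lerD2r.
  rewrite -ler_pdivrMr // le_max; apply/orP; right.
  rewrite ler_pdivrMr // mulrAC ler_pdivlMr // mulrC.
  move: h2; rewrite -(ler_pM2l (ltr0n _ 2)).
  by rewrite mulrA (mulrCA 2) divff ?pnatr_eq0 // mulr1 (mulrC (v c0%:A)) mulrA.
exists (fun i => - (c0^-1 * c i)).
  by move=> i /cD ->; rewrite mulr0 oppr0.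
have -> : x - \sum_j (- (c0^-1 * c j)) *: g j = c0^-1 *: (c0 *: x + u).
  rewrite scalerDr scalerA mulVf // scale1r; congr (_ + _).
  rewrite -sumrN scaler_sumr; apply: eq_bigr => j _.
  by rewrite scaleNr opprK scalerA.
by rewrite avZ -in_algE fmorphV avV // /= mulrC ltr_pdivrMr.
Qed.

(** By maximality, adjoining x destroys uniform independence for every constant; [small_dependence]
    solves the resulting near-relation for x. *)
Lemma max_indep_dense (I : finType) (g : I -> F) : v_indep g ->
  (forall m' (g' : 'I_m' -> F), v_indep g' -> (m' <= #|I|)%N) -> v_dense g.
Proof.
move=> [d d0 ig] gM x e e0.
pose g' (o : option I) := if o is Some i then g i else x.
have nig' : ~ v_indep g' by move/v_indep_ord/gM; rewrite card_option ltnn.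
set B := Num.max 1 (2 * v x / d).
have B0 : 0 < B by rewrite lt_max ltr01.
(* [small_dependence] requires d / 2; e / B makes its error bound at most e. *)
pose e' := Num.min (d / 2) (e / B).
have e'0 : 0 < e' by rewrite lt_min !divr_gt0.
have [c [k ho]] : exists c : option I -> rat, exists k,
    v (\sum_j c j *: g' j) < e' * v (c k)%:A.
  apply: contrapT => hn; apply: nig'; exists e' => // c i.
  by rewrite leNgt; apply/negP => h; apply: hn; exists c, i.
rewrite sum_option /= in ho.
have e'd : e' <= d / 2 by rewrite ge_min lexx.
have e'e : e' * B <= e by rewrite -ler_pdivlMr // ge_min lexx orbT.
have [||c' _ h] := @small_dependence I predT g d e' x (c None)
  (fun i => c (Some i)) d0 e'0 e'd (fun c' _ => ig c').
- by [].
- by case: k ho => [i|] ho; [right; exists i | left].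
by exists c'; apply: lt_le_trans e'e.
Qed.

End LocalDegree.

Lemma uniform_bound (I : finType) (P : I -> nat -> Prop) :
    (forall i, exists N, forall n, (N <= n)%N -> P i n) ->
  exists N, forall n, (N <= n)%N -> forall i, P i n.
Proof.
move=> /choice [N hN]; exists (\max_i N i)%N => n nN i.
by apply: hN; apply: leq_trans nN; apply: leq_bigmax.
Qed.

(** * Bases of the completion compared with families in F *)

Section CompletionBasis.
Variables (R : realType) (F : fieldExtType rat) (v : F -> R).
Hypothesis av : absolute_value v.

Lemma null_forP (x : nat -> F) : null_for v x <->
  forall e : R, 0 < e -> exists N, forall k, (N <= k)%N -> v (x k) < e.
Proof.
split=> [/cvgr0Pnorm_lt h e /h [N _ hN]|h].
  by exists N => k /hN; rewrite /= ger0_norm // av_ge0.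
apply/cvgr0Pnorm_lt => e /h [N hN]; exists N => // k /= /hN.
by rewrite ger0_norm // av_ge0.
Qed.

Lemma cauchy_for_cst (a : F) : cauchy_for v (fun=> a).
Proof. by move=> e e0; exists 0%N => m n _ _; rewrite subrr av0. Qed.

Lemma inv_small (e : R) : 0 < e ->
  exists N, forall k, (N <= k)%N -> k.+1%:R^-1 < e.
Proof.
move=> e0; exists (Num.truncn e^-1) => k hk.
rewrite -[e]invrK ltf_pV2 ?posrE ?invr_gt0 ?ltr0n //.
by apply: lt_le_trans (truncnS_gt _) _; rewrite ler_nat.
Qed.

(** Density supplies the coefficients; independence transfers the Cauchy property and convergence to
    0 from combinations to their coefficients. *)
Lemma completion_basis_cst m (g : 'I_m -> F) :
  v_indep v g -> v_dense v g -> completion_basis v (fun i _ => g i).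
Proof.
move=> [d d0 ig] dg; split=> [i|x cx|c cc /null_forP nc i].
- exact: cauchy_for_cst.
- have /choice [c hc] : forall k, exists c : 'I_m -> rat,
      v (x k - \sum_j c j *: g j) < k.+1%:R^-1.
    by move=> k; apply: dg; rewrite invr_gt0 ltr0n.
  exists (fun i k => c k i).
    move=> i e e0; have e'0 : 0 < e * d / 3 by rewrite !divr_gt0 ?mulr_gt0.
    have [N1 hN1] := cx _ e'0; have [N2 hN2] := inv_small e'0.
    exists (maxn N1 N2) => k l; rewrite !geq_max => /andP [k1 k2] /andP [l1 l2].
    rewrite -(ltr_pM2l d0) -scalerBl.
    apply: (le_lt_trans (ig (fun i => c k i - c l i) i)).
    under eq_bigr => j _ do rewrite scalerBl.
    rewrite sumrB.
    set a := \sum_i _; set b := \sum_i _.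
    have -> : a - b = - (x k - a) + (x l - b) + (x k - x l) by ring.
    have := hN1 k l k1 l1; have := lt_trans (hc k) (hN2 k k2).
    have := lt_trans (hc l) (hN2 l l2); rewrite -/a -/b.
    have := avD av (- (x k - a) + (x l - b)) (x k - x l).
    have := avD av (- (x k - a)) (x l - b); rewrite avN //.
    by lra.
  apply/null_forP => e e0; have [N hN] := inv_small e0.
  by exists N => k /hN; apply: lt_trans.
- apply/null_forP => e e0; have [|N hN] := nc (d * e); first exact: mulr_gt0.
  exists N => k /hN h; rewrite -(ltr_pM2l d0).
  exact: le_lt_trans (ig (fun i => c i k) i) h.
Qed.

(** Expanding every g i in b at one late index t leaves small errors. If k < m, a rational
    dependence between the coordinate vectors cancels the main terms, and a nontrivial combination
    of g becomes too small. *)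
Lemma completion_basis_ge m (g : 'I_m -> F) k (b : 'I_k -> nat -> F) :
  v_indep v g -> completion_basis v b -> (m <= k)%N.
Proof.
move=> [d d0 ig] [_ sp _]; rewrite leqNgt; apply/negP => ltkm.
have /choice [A hA] : forall i, exists A : 'I_k -> nat -> rat,
    null_for v (fun t => g i - \sum_j A j t *: b j t).
  by move=> i; have [A _ h] := sp (fun=> g i) (cauchy_for_cst _); exists A.
(* Summing m estimates against V, the divisor m.+1 leaves the total strictly below d * V. *)
have e0 : 0 < d / m.+1%:R by rewrite divr_gt0.
have [t ht] : exists t, forall i, v (g i - \sum_j A i j t *: b j t) < d / m.+1%:R.
  have [i|N hN] := @uniform_bound _ (fun i t => v (g i - \sum_j A i j t *: b j t) < d / m.+1%:R).
    by have /null_forP/(_ _ e0) := hA i.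
  by exists N => i; apply: hN.
have [|u [i0 ui0] hu] := linear_dependence (fun i j => A i j t) (I := 'I_m).
  by rewrite card_ord.
have s : \sum_i u i *: g i = \sum_i u i *: (g i - \sum_j A i j t *: b j t).
  rewrite -[LHS]subr0; under [RHS]eq_bigr => i _ do rewrite scalerBr scaler_sumr.
  rewrite sumrB; congr (_ - _); rewrite exchange_big big1 // => j _.
  under eq_bigr => i _ do rewrite scalerA.
  by rewrite -scaler_suml hu scale0r.
set V := \sum_i v (u i)%:A.
have V0 : 0 < V.
  apply: lt_le_trans (_ : v (u i0)%:A <= _).
    by rewrite av_gt0 // scaler_eq0 oner_eq0 orbF.
  by rewrite /V (bigD1 i0) //= lerDl sumr_ge0 // => i _; rewrite av_ge0.
have le1 i : d * v (u i)%:A <= d / m.+1%:R * V.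
  apply: (le_trans (ig u i)); rewrite s; apply: (le_trans (av_sum av _ _ _)).
  rewrite mulr_sumr; apply: ler_sum => j _; rewrite avZ // mulrC.
  by rewrite ler_wpM2r ?av_ge0 // ltW.
have : d * V <= d / m.+1%:R * V *+ m.
  rewrite {1}/V mulr_sumr -[X in _ *+ X]card_ord -sumr_const; exact: ler_sum.
rewrite -mulrA -mulrnAr ler_pM2l // -mulrnAl -[leLHS]mul1r ler_pM2r //.
by rewrite -mulr_natl ler_pdivlMr ?ltr0n // mul1r ler_nat ltnn.
Qed.

Lemma completion_basis_indep k (b : 'I_k -> nat -> F) : completion_basis v b ->
  exists t, v_indep v (fun i => b i t).
Proof.
move=> [cb _ ib].
suff /(_ (enum 'I_k)) [d d0 [T hT]] : forall s : seq 'I_k,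
    exists2 d : R, 0 < d & exists T, forall t, (T <= t)%N ->
    forall c : 'I_k -> rat, (forall i, i \notin s -> c i = 0) ->
    forall i, d * v (c i)%:A <= v (\sum_j c j *: b j t).
  by exists T; exists d => // c; apply: hT => // i; rewrite mem_enum.
elim=> [|j s [d d0 [T hT]]].
  exists 1 => //; exists 0%N => t _ c c0 i.
  by rewrite c0 // scale0r av0 // mulr0 av_ge0.
have [js|js] := boolP (j \in s).
  exists d => //; exists T => t tT c hc; apply: hT => // i iNs; apply: hc.
  by rewrite in_cons negb_or iNs andbT; apply: contraNneq iNs => ->.
apply: contrapT => H.
have unif e : 0 < e -> exists N, forall m n, (N <= m)%N -> (N <= n)%N ->
    forall i, v (b i m - b i n) < e.
  move=> e0; have /choice [N hN] := fun i => cb i e e0.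
  exists (\max_i N i)%N => m n hm hn i; apply: hN.
    by apply: leq_trans hm; apply: leq_bigmax.
  by apply: leq_trans hn; apply: leq_bigmax.
have [N1 hN1] := unif 1 ltr01.
pose B1 := v (b j N1) + 1.
have bB1 t : (N1 <= t)%N -> v (b j t) <= B1.
  move=> ht; rewrite -(subrK (b j N1) (b j t)) addrC.
  by apply: (le_trans (avD av _ _)); rewrite lerD2l ltW // hN1.
have B10 : 0 < B1 by rewrite ltr_pwDr // av_ge0.
pose B := Num.max 1 (2 * B1 / d).
have B0 : 0 < B by rewrite lt_max ltr01.
(* A failure at a time beyond l, T and N1 is solved for b j by [small_dependence]; e is chosen so
   that the error stays below 1 / (l + 1). *)
have step l : exists tc : nat * ('I_k -> rat), [/\ (l <= tc.1)%N, (T <= tc.1)%N,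
    (N1 <= tc.1)%N, forall i, i \notin s -> tc.2 i = 0 &
    v (b j tc.1 - \sum_i tc.2 i *: b i tc.1) < l.+1%:R^-1].
  pose e := Num.min (d / 2) (l.+1%:R^-1 / B).
  have e0 : 0 < e by rewrite lt_min !divr_gt0 ?invr_gt0.
  have ed : e <= d / 2 by rewrite ge_min lexx.
  have eB : e * B <= l.+1%:R^-1 by rewrite -ler_pdivlMr // ge_min lexx orbT.
  apply: contrapT => hn; apply: H; exists e => //.
  exists (maxn l (maxn T N1)) => t; rewrite !geq_max => /and3P [lt Tt Nt] c hc i.
  rewrite leNgt; apply/negP => lt1; apply: hn.
  pose c1 i := if i == j then 0 else c i.
  have sE : \sum_i c i *: b i t = c j *: b j t + \sum_i c1 i *: b i t.
    rewrite (bigD1 j) //= [in RHS](bigD1 j) //= /c1 eqxx scale0r add0r.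
    by congr (_ + _); apply: eq_bigr => q /negPf ->.
  have c1s q : ~~ (q \in s) -> c1 q = 0.
    move=> qs; rewrite /c1; case: eqP => // /eqP qj; apply: hc.
    by rewrite in_cons negb_or qj.
  have [|c' c's hc'] := @small_dependence R F v av _ (mem s) (b ^~ t) d e (b j t) (c j) c1
     d0 e0 ed (fun c' h => hT t Tt c' h) c1s.
    rewrite -sE; have [ij|ij] := eqVneq i j; first by left; rewrite -ij.
    by right; exists i; rewrite /c1 (negPf ij).
  exists (t, c'); split => //=; apply: (lt_le_trans hc').
  apply: le_trans eB; rewrite ler_wpM2l ?(ltW e0) //.
  rewrite ge_max !le_max lexx /=; apply/orP; right.
  by rewrite ler_pM2r ?invr_gt0 // ler_pM2l // bB1.
have {step} [tc htc] := choice step.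
pose tt l := (tc l).1; pose C l := (tc l).2.
have htt l : (l <= tt l)%N by case: (htc l).
have httT l : (T <= tt l)%N by case: (htc l).
have httN l : (N1 <= tt l)%N by case: (htc l).
have hC l i : i \notin s -> C l i = 0 by case: (htc l) => _ _ _ + _; apply.
have hs l : v (b j (tt l) - \sum_i C l i *: b i (tt l)) < l.+1%:R^-1.
  by case: (htc l).
pose Cb := (B1 + 1) / d.
have Cb0 : 0 < Cb by rewrite divr_gt0 // addr_gt0.
have CbP l i : v (C l i)%:A <= Cb.
  rewrite /Cb ler_pdivlMr // mulrC; apply: (le_trans (hT _ (httT l) _ (hC l) i)).
  have := avB av (b j (tt l)) (b j (tt l) - \sum_i C l i *: b i (tt l)).
  rewrite opprB addrC subrK => /le_trans; apply; rewrite lerD ?bB1 //.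
  by apply: ltW; apply: (lt_le_trans (hs l)); rewrite invf_le1 ?ler1n.
(* The l-th relation holds at time [tt l], whereas [null_for] evaluates b at time l. Bounded
   coefficients make the change of time cheap. *)
have comb l m n (e : R) : (forall i, v (b i m - b i n) < e) ->
    v (\sum_i C l i *: b i m - \sum_i C l i *: b i n) <= Cb * e *+ k.
  move=> he; rewrite -sumrB; apply: (le_trans (av_sum av _ _ _)).
  rewrite -[X in _ *+ X]card_ord -sumr_const; apply: ler_sum => i _.
  by rewrite -scalerBr avZ // ler_pM ?av_ge0 ?CbP // ltW.
have small e : 0 < e -> exists2 e' : R, 0 < e' & e' <= e /\ Cb * e' *+ k <= e.
  move=> e0; have Ck : 0 < Cb * k.+1%:R by rewrite mulr_gt0.
  pose e' := Num.min e (e / (Cb * k.+1%:R)).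
  have e'0 : 0 < e' by rewrite lt_min e0 divr_gt0.
  exists e' => //; split; first by rewrite ge_min lexx.
  apply: (@le_trans _ _ (e' * (Cb * k.+1%:R))).
    rewrite -mulr_natr mulrAC [leRHS]mulrC ler_pM2r // ler_pM2l //.
    by rewrite ler_nat.
  by rewrite -ler_pdivlMr // ge_min lexx orbT.
(* The limiting relation, with coefficient constantly 1 at j, is what the last clause of
   [completion_basis] excludes. *)
pose c i l := if i == j then 1 else - C l i.
have cE l t : \sum_i c i l *: b i t = b j t - \sum_i C l i *: b i t.
  rewrite (bigD1 j) //= [in RHS](bigD1 j) //= /c eqxx scale1r hC // scale0r add0r.
  by congr (_ + _); rewrite -sumrN; apply: eq_bigr => i /negPf ->; rewrite scaleNr.
(* The difference of two coefficient families is supported in s, so the induction bound controls it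
   by the corresponding combination. *)
have cc i : cauchy_for v (fun l => (c i l)%:A).
  rewrite /c; have [_|ij] := eqVneq i j; first exact: cauchy_for_cst.
  move=> e e0; have e1 : 0 < d * e / 4 by rewrite divr_gt0 ?mulr_gt0.
  have [e2 e20 [e2e e2C]] := small _ e1.
  have [N2 hN2] := unif _ e20; have [N3 hN3] := inv_small e1.
  exists (maxn N2 N3) => l l'; rewrite !geq_max => /andP [k1 k2] /andP [l1 l2].
  rewrite -scalerBl -opprD scaleNr avN // -(ltr_pM2l d0).
  have hD q : q \notin s -> C l q - C l' q = 0 by move=> qs; rewrite !hC ?subr0.
  apply: (le_lt_trans (hT _ (httT l) _ hD i)).
  under eq_bigr => q _ do rewrite scalerBl.
  rewrite sumrB.
  set X := \sum_i _; set Y := \sum_i _.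
  pose Z := \sum_i C l' i *: b i (tt l').
  have tl := leq_trans k1 (htt l); have tl' := leq_trans l1 (htt l').
  have -> : X - Y = - (b j (tt l) - X) + (b j (tt l') - Z) + (b j (tt l) - b j (tt l'))
              + (Z - Y) by ring.
  have A1 := lt_trans (hs l) (hN3 _ k2); have A2 := lt_trans (hs l') (hN3 _ l2).
  have A3 := lt_le_trans (hN2 _ _ tl tl' j) e2e.
  have A4 := le_trans (comb l' _ _ _ (hN2 _ _ tl' tl)) e2C.
  rewrite -/X -/Y -/Z in A1 A2 A4.
  apply: (le_lt_trans (avD av _ _)).
  have := avD av (- (b j (tt l) - X) + (b j (tt l') - Z)) (b j (tt l) - b j (tt l')).
  have := avD av (- (b j (tt l) - X)) (b j (tt l') - Z); rewrite avN //.
  by move: A1 A2 A3 A4; lra.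
have : null_for v (fun l => (c j l)%:A).
  apply: ib => //; apply/null_forP => e e0.
  have e1 : 0 < e / 4 by rewrite divr_gt0.
  have [e2 e20 [e2e e2C]] := small _ e1.
  have [N2 hN2] := unif _ e20; have [N3 hN3] := inv_small e1.
  exists (maxn N2 N3) => l; rewrite !geq_max => /andP [k1 k2].
  rewrite cE; set Y := \sum_i _.
  pose X := \sum_i C l i *: b i (tt l).
  have tl := leq_trans k1 (htt l).
  have -> : b j l - Y = (b j (tt l) - X) + (b j l - b j (tt l)) + (X - Y) by ring.
  have A1 := lt_trans (hs l) (hN3 _ k2).
  have A3 := lt_le_trans (hN2 _ _ k1 tl j) e2e.
  have A4 := le_trans (comb l _ _ _ (hN2 _ _ tl k1)) e2C.
  rewrite -/X -/Y in A1 A4.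
  apply: (le_lt_trans (avD av _ _)).
  have := avD av (b j (tt l) - X) (b j l - b j (tt l)).
  by move: A1 A3 A4; lra.
move/null_forP/(_ _ ltr01) => [N /(_ N (leqnn N))].
by rewrite /c eqxx scale1r av1 // ltxx.
Qed.

(** The two comparisons hold for every completion basis, so whichever size [xget] picks is m. *)
Lemma local_degreeE m (g : 'I_m -> F) : v_indep v g ->
    (forall m' (g' : 'I_m' -> F), v_indep v g' -> (m' <= m)%N) ->
  local_degree v = m.
Proof.
move=> ig gM.
have [|b hb] := @xgetPex _ 0%N [set n | exists b : 'I_n -> nat -> F, completion_basis v b].
  exists m, (fun i _ => g i); apply: completion_basis_cst => //.
  by apply: max_indep_dense => // m' g' /gM; rewrite card_ord.
apply/eqP; rewrite eqn_leq (completion_basis_ge ig hb) andbT.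
by have [t /gM] := completion_basis_indep hb.
Qed.

Lemma local_degreeP : exists2 g : 'I_(local_degree v) -> F, v_indep v g & v_dense v g.
Proof.
have [m [g ig gM]] := exists_max_indep av.
rewrite (local_degreeE ig gM); exists g => //.
by apply: max_indep_dense => // m' g' /gM; rewrite card_ord.
Qed.

End CompletionBasis.

(** * Weak approximation *)

Lemma near_seq (T : eqType) (s : seq T) (P : T -> nat -> Prop) :
    (forall x, x \in s -> \forall n \near \oo, P x n) ->
  \forall n \near \oo, forall x, x \in s -> P x n.
Proof.
elim: s => [|a s IH] h; first by near=> n.
have ha := h a (mem_head _ _).
have hs : \forall n \near \oo, forall x, x \in s -> P x n.
  by apply: IH => x xs; apply: h; rewrite in_cons xs orbT.
near=> n => x; rewrite in_cons => /orP [/eqP ->|]; first by near: n.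
by move: x; near: n.
Unshelve. all: by end_near.
Qed.

Lemma pos_lower_bound (R : realFieldType) (T : eqType) (s : seq T) (f : T -> R) :
  (forall x, x \in s -> 0 < f x) ->
  exists2 d, 0 < d & forall x, x \in s -> d <= f x.
Proof.
elim: s => [|a s IH] h; first by exists 1.
have [x xs|d d0 hd] := IH; first by apply: h; rewrite in_cons xs orbT.
exists (Num.min d (f a)); first by rewrite lt_min d0 h // mem_head.
move=> x; rewrite in_cons => /orP [/eqP ->|/hd]; rewrite ge_min ?lexx ?orbT //.
by move=> ->.
Qed.

Lemma seq_upper_bound (R : realFieldType) (T : eqType) (s : seq T) (f : T -> R) :
  exists2 d, 0 < d & forall x, x \in s -> f x <= d.
Proof.
elim: s => [|a s [d d0 hd]]; first by exists 1.
exists (Num.max d (f a)); first by rewrite lt_max d0.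
move=> x; rewrite in_cons => /orP [/eqP ->|/hd]; rewrite le_max ?lexx ?orbT //.
by move=> ->.
Qed.

Section Powers.
Variable R : realType.

Lemma near_expr_lt (a e : R) : 0 <= a < 1 -> 0 < e -> \forall n \near \oo, a ^+ n < e.
Proof.
move=> /andP [a0 a1] e0.
have /cvgr0Pnorm_lt/(_ _ e0) : a ^+ n @[n --> \oo] --> 0.
  by apply: cvg_expr; rewrite ger0_norm.
apply: filterS => n; exact: le_lt_trans (ler_norm _).
Qed.

Lemma near_expr_gt (a e : R) : 1 < a -> \forall n \near \oo, e < a ^+ n.
Proof.
move=> a1; have a0 : 0 < a by apply: lt_trans a1.
have e0 : 0 < Num.max 1 e by rewrite lt_max ltr01.
have h : 0 <= a^-1 < 1 by rewrite invr_ge0 (ltW a0) invf_lt1.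
have ei : 0 < (Num.max 1 e)^-1 by rewrite invr_gt0.
near=> n; apply: (@le_lt_trans _ _ (Num.max 1 e)); first by rewrite le_max lexx orbT.
rewrite -ltf_pV2 ?posrE ?exprn_gt0 // -exprVn.
by near: n; apply: near_expr_lt.
Unshelve. all: by end_near.
Qed.

Lemma ln_exprz (t : R) (k : int) : 0 < t -> ln (t ^ k) = k%:~R * ln t.
Proof.
move=> t0; case: k => n; first by rewrite -exprnP lnXn // mulr_natl.
by rewrite NegzE -exprnN lnV ?posrE ?exprn_gt0 // lnXn // rmorphN /= mulNr mulr_natl.
Qed.

End Powers.

Section WeakApproximation.
Variables (R : realType) (F : fieldExtType rat) (u : rat -> R) (c0 : rat).
Hypothesis u_c0 : 1 < u c0.

(** All absolute values compared below share their restriction u to Q; powers of the rational c0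
    thus serve as a common scale. *)
Definition av_over (v : F -> R) :=
  absolute_value v /\ forall q : rat, v q%:A = u q.

Lemma avXz (K : fieldType) (v : K -> R) (x : K) (k : int) : absolute_value v -> v (x ^ k) = v x ^ k.
Proof.
move=> av; case: k => n; first by rewrite -!exprnP avX.
by rewrite NegzE -!exprnN avV // avX.
Qed.

(** A high power of x pulls v and w apart by more than the factor u c0. A power of c0, of the same
    size for both, can then be divided out so that 1 falls between them. *)
Lemma separate_pair v w : av_over v -> av_over w -> v <> w ->
  exists x, 1 < v x /\ w x < 1.
Proof.
move=> [av hv] [aw hw] vw.
have [x xlt] : exists x, w x < v x.
  have [x /eqP] : exists x, v x <> w x.
    by apply: contrapT => hn; apply: vw; apply/funext => x; apply: contrapT => h; apply: hn; exists x.
  rewrite neq_lt => /orP [h|]; last by exists x.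
  exists x^-1; rewrite (avV av) (avV aw) ltf_pV2 // posrE.
    by rewrite (le_lt_trans (av_ge0 av x)).
  rewrite av_gt0 //; apply: contraTneq h => ->; by rewrite !av0 // ltxx.
have wx0 : 0 < w x.
  rewrite av_gt0 //; apply: contraTneq xlt => ->; by rewrite !av0 // ltxx.
have vx0 : 0 < v x by apply: lt_trans xlt.
have L0 : 0 < ln (u c0) by rewrite ln_gt0.
have uc0 : 0 < u c0 by apply: lt_trans u_c0.
have D0 : 0 < ln (v x) - ln (w x) by rewrite subr_gt0 ltr_ln.
(* m makes the ratio of v x ^ m to w x ^ m exceed u c0; k is then the least exponent with w x ^ m <
   u c0 ^ k. *)
pose m := (Num.truncn (ln (u c0) / (ln (v x) - ln (w x)))).+1.
have hm : ln (u c0) < (ln (v x) - ln (w x)) *+ m.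
  by rewrite -mulr_natl -ltr_pdivrMr // truncnS_gt.
pose k := Num.floor (ln (w x) *+ m / ln (u c0)) + 1.
have hk1 : ln (w x) *+ m < k%:~R * ln (u c0).
  by rewrite -ltr_pdivrMr // floorD1_gt.
have hk2 : k%:~R * ln (u c0) <= ln (w x) *+ m + ln (u c0).
  rewrite /k rmorphD /= mulrDl mul1r lerD2r -ler_pdivlMr //; exact: floor_le.
have h3 : k%:~R * ln (u c0) < ln (v x) *+ m.
  by move: hm; rewrite mulrnBl => hm; move: hk2 hm; lra.
exists (x ^+ m * (c0%:A) ^ (- k)).
rewrite (avM av) (avM aw) (avX av) (avX aw) (avXz _ _ av) (avXz _ _ aw) hv hw -!invr_expz; split.
  rewrite ltr_pdivlMr ?exprz_gt0 // mul1r -ltr_ln ?posrE ?exprz_gt0 ?exprn_gt0 //.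
  by rewrite ln_exprz // lnXn.
rewrite ltr_pdivrMr ?exprz_gt0 // mul1r -ltr_ln ?posrE ?exprz_gt0 ?exprn_gt0 //.
by rewrite ln_exprz // lnXn.
Qed.

(** These quotients approximate idempotents of the product of the completions: they tend to 1 where
    |x| > 1, and to 0 where |x| < 1 by [near_frac0]. *)
Lemma near_frac1 (v : F -> R) x (e : R) : absolute_value v -> 1 < v x -> 0 < e ->
  \forall n \near \oo, v (x ^+ n / (1 + x ^+ n) - 1) < e.
Proof.
move=> av vx e0; near=> n.
have h : 1 + e^-1 < v (x ^+ n) by rewrite avX //; near: n; apply: near_expr_gt.
have ei : 0 < e^-1 by rewrite invr_gt0.
have h1 : e^-1 < v (1 + x ^+ n).
  have := av_sub_le av (x ^+ n) (- 1); rewrite opprK addrC (avN av) (av1 av) addrC.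
  by move: h; rewrite (addrC (x ^+ n)); lra.
have n0 : 1 + x ^+ n != 0 by rewrite -(av_gt0 av) (lt_trans ei).
rewrite (_ : _ - 1 = - (1 + x ^+ n)^-1); last by field.
by rewrite avN // avV // invf_plt ?posrE // (lt_trans ei).
Unshelve. all: by end_near.
Qed.

Lemma near_frac0 (v : F -> R) x (e : R) : absolute_value v -> v x < 1 -> 0 < e ->
  \forall n \near \oo, v (x ^+ n / (1 + x ^+ n)) < e.
Proof.
move=> av vx e0; have v01 : 0 <= v x < 1 by rewrite av_ge0.
have h12 : 0 < 1 / 2 :> R by lra.
near=> n.
have h1 : v (x ^+ n) < 1 / 2.
  by rewrite avX //; near: n; apply: near_expr_lt.
have h2 : v (x ^+ n) < e / 2.
  by rewrite avX //; near: n; apply: near_expr_lt => //; rewrite divr_gt0.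
have h3 : 1 / 2 < v (1 + x ^+ n).
  have := av_sub_le av 1 (- x ^+ n); rewrite opprK (avN av) (av1 av).
  by move: h1; lra.
rewrite avM // avV // ltr_pdivrMr; last by apply: lt_trans h3; lra.
apply: (lt_trans h2); rewrite ltr_pM2l // -[2^-1]mul1r.
Unshelve. all: by end_near.
Qed.

(** Induction of Artin and Whaples: x settles all of s, and y separates v from the new w. If w x >
    1, the factor x ^ n / (1 + x ^ n) hardly changes y at v and w but makes it small on s. If w x =
    1, the factor x ^ n keeps w y, does not lower v y, and is small on s. *)
Lemma separate v (s : seq (F -> R)) : av_over v ->
    (forall w, w \in s -> av_over w /\ v <> w) ->
  exists x, 1 < v x /\ forall w, w \in s -> w x < 1.
Proof.
move=> ov; elim: s => [|w s IH] hs.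
  by exists c0%:A; case: ov => _ ->; split.
have [w' w's|x [vx sx]] := IH; first by apply: hs; rewrite in_cons w's orbT.
have [ow vw] := hs w (mem_head _ _).
have [y [vy wy]] := separate_pair ov ow vw.
have [av _] := ov; have [aw _] := ow.
have avs w' : w' \in s -> absolute_value w'.
  by move=> w's; have [|[]] := hs w'; rewrite // in_cons w's orbT.
have [wx|wx|wx] := ltgtP (w x) 1.
- by exists x; split=> // w'; rewrite in_cons => /orP [/eqP ->|/sx].
(* e is the margin that 1 < v y and w y < 1 leave for a factor within e of 1. *)
- have [e [e0 [e1 e2]]] : exists e, 0 < e /\ 1 < (1 - e) * v y /\ (1 + e) * w y < 1.
    pose e := Num.min ((1 - (v y)^-1) / 2) ((1 - w y) / 2).
    have vyi : (v y)^-1 < 1 by rewrite invf_lt1 // (lt_trans ltr01).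
    have e0 : 0 < e by rewrite lt_min; apply/andP; split; lra.
    have l1 : e <= (1 - (v y)^-1) / 2 by rewrite ge_min lexx.
    have l2 : e <= (1 - w y) / 2 by rewrite ge_min lexx orbT.
    exists e; split=> //; split.
      rewrite -ltr_pdivrMr; last by apply: lt_trans vy.
      by rewrite mul1r; lra.
    have w0 := av_ge0 aw y.
    have : (1 + e) * w y <= (1 + (1 - w y) / 2) * w y by rewrite ler_wpM2r ?lerD2l.
    move/le_lt_trans; apply.
    have : 0 < (1 - w y) * (2 - w y) by rewrite mulr_gt0 //; lra.
    by nra.
  have [B B0 hB] := seq_upper_bound s (fun w' => w' y).
  pose f n := x ^+ n / (1 + x ^+ n).
  have n1 : \forall n \near \oo, v (f n - 1) < e by apply: near_frac1.
  have n2 : \forall n \near \oo, w (f n - 1) < e by apply: near_frac1.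
  have n3 : \forall n \near \oo, forall w', w' \in s -> w' (f n) < 1 / B.
    apply: near_seq => w' w's; apply: near_frac0; [exact: avs|exact: sx|].
    by rewrite divr_gt0.
  near \oo => n; exists (f n * y); split.
    rewrite avM //; apply: (lt_le_trans e1); rewrite ler_wpM2r ?av_ge0 //.
    have : v (f n - 1) < e by near: n.
    have := av_sub_le av 1 (1 - f n); rewrite av1 // subKr av_distC //; lra.
  move=> w'; rewrite in_cons => /orP [/eqP ->|w's].
    rewrite avM //; apply: le_lt_trans e2; rewrite ler_wpM2r ?av_ge0 //.
    have : w (f n - 1) < e by near: n.
    have := avD aw (f n - 1) 1; rewrite subrK av1 //; lra.
  have aw' := avs _ w's.
  rewrite avM //; apply: (@le_lt_trans _ _ (w' (f n) * B)).
    by rewrite ler_wpM2l ?av_ge0 // hB.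
  rewrite -ltr_pdivlMr //; move: w' w's {aw'}; by near: n.
- have [B B0 hB] := seq_upper_bound s (fun w' => w' y).
  have n3 : \forall n \near \oo, forall w', w' \in s -> w' x ^+ n < 1 / B.
    apply: near_seq => w' w's; apply: near_expr_lt; last by rewrite divr_gt0.
    by rewrite sx // av_ge0 //; apply: avs.
  near \oo => n; exists (x ^+ n * y); split.
    rewrite avM // avX //; apply: (lt_le_trans vy).
    by rewrite ler_peMl ?av_ge0 // exprn_ege1 // ltW.
  move=> w'; rewrite in_cons => /orP [/eqP ->|w's].
    by rewrite avM // avX // wx expr1n mul1r.
  have aw' := avs _ w's.
  rewrite avM // avX //; apply: (@le_lt_trans _ _ (w' x ^+ n * B)).
    by rewrite ler_wpM2l ?exprn_ge0 ?av_ge0 // hB.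
  rewrite -ltr_pdivlMr //; move: w' w's {aw'}; by near: n.
Unshelve. all: by end_near.
Qed.

Lemma approx_idempotent v (s : seq (F -> R)) (e : R) : av_over v ->
    (forall w, w \in s -> av_over w /\ v <> w) -> 0 < e ->
  exists z, v (z - 1) < e /\ forall w, w \in s -> w z < e.
Proof.
move=> ov hs e0; have [x [vx sx]] := separate ov hs; have [av _] := ov.
have n1 : \forall n \near \oo, v (x ^+ n / (1 + x ^+ n) - 1) < e by apply: near_frac1.
have n2 : \forall n \near \oo, forall w, w \in s -> w (x ^+ n / (1 + x ^+ n)) < e.
  apply: near_seq => w ws; have [[aw _] _] := hs _ ws.
  by apply: near_frac0 => //; apply: sx.
by near \oo => n; exists (x ^+ n / (1 + x ^+ n)); split; near: n.
Unshelve. all: by end_near.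
Qed.

(** Independent families for the different v, each multiplied by an approximate idempotent of its
    own v, together form a family independent over Q. *)
Lemma sum_local_degree (s : seq (F -> R)) : uniq s ->
  (forall v, v \in s -> av_over v) ->
  (\sum_(v <- s) local_degree v <= \dim {:F})%N.
Proof.
move=> us hs.
have avs v : v \in s -> absolute_value v by move=> /hs [].
(* Families are stored as functions on [nat], since their index type depends on v. *)
have /choice [G hG] : forall v : F -> R, exists g : nat -> F,
    absolute_value v -> v_indep v (fun i : 'I_(local_degree v) => g i).
  move=> v; have [av|nav] := pselect (absolute_value v); last by exists (fun=> 0).
  have [g ig _] := local_degreeP av.
  exists (fun i => oapp g 0 (insub i)) => _.
  by under eq_fun => i do rewrite valK /=.
have /choice [D hD] : forall v : F -> R, exists d : R, 0 < d /\ (absolute_value v ->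
    forall (c : 'I_(local_degree v) -> rat) i,
      d * v (c i)%:A <= v (\sum_j c j *: G v j)).
  move=> v; have [av|nav] := pselect (absolute_value v); last by exists 1.
  by have [d d0 h] := hG v av; exists d.
have [d d0 hd] := @pos_lower_bound R _ s D (fun v _ => (hD v).1).
pose T (i : 'I_(size s)) := 'I_(local_degree (tnth (in_tuple s) i)).
pose I : finType := {i : 'I_(size s) & T i}.
pose V (x : I) := tnth (in_tuple s) (tag x).
pose g (x : I) : F := G (V x) (tagged x).
have Vs x : V x \in s by apply: mem_tnth.
have [B B0 hB] := seq_upper_bound (allpairs pair s (enum I)) (fun vx : (F -> R) * I => vx.1 (g vx.2)).
have {}hB v x : v \in s -> v (g x) <= B.
  by move=> vs; apply: (hB (v, x)); apply/allpairsP; exists (v, x); rewrite mem_enum.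
have cI : #|{: I}| = (\sum_(v <- s) local_degree v)%N.
  rewrite card_tagged sumnE big_map big_enum /= [RHS]big_tnth.
  by apply: eq_bigr => i _; rewrite card_ord.
rewrite -cI.
(* With this e, summing the estimates [le1] over I contradicts C > 0. *)
pose e := d / (B * #|{: I}|.+1%:R).
have e0 : 0 < e by rewrite divr_gt0 // mulr_gt0.
have /choice [z hz] : forall v : F -> R, exists z, v \in s ->
    v (z - 1) < e /\ forall w, w \in s -> w != v -> w z < e.
  move=> v; have [vs|_] := boolP (v \in s); last by exists 0.
  have [w|z [z1 z2]] := @approx_idempotent v (rem v s) e (hs v vs) _ e0.
    rewrite (rem_filter _ us) mem_filter /= => /andP [wv ws]; split; first exact: hs.
    by apply/eqP; rewrite eq_sym.
  exists z => _; split=> // w ws wv; apply: z2.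
  by rewrite (rem_filter _ us) mem_filter /= wv.
apply: (@indep_card F I (fun x => z (V x) * g x)) => c c_eq.
pose C := \sum_x u (c x).
have vc v q : v \in s -> v q%:A = u q by case/hs.
have u0 x : 0 <= u (c x) by rewrite -(vc (V x)) // av_ge0 //; apply: avs.
have le1 x : d * u (c x) <= e * B * C.
  case: x => i k; pose v := tnth (in_tuple s) i.
  have vs : v \in s by apply: mem_tnth.
  have av := avs v vs.
  pose cv (j : T i) := c (Tagged T j).
  have := (hD v).2 av cv k; rewrite vc // => h.
  apply: (@le_trans _ _ (D v * u (c (Tagged T k)))); first by rewrite ler_wpM2r ?hd.
  apply: (le_trans h).
  (* Subtracting the assumed relation leaves the factors 1 - z for the terms belonging to v and - z
     for the others, all small at v. *)
  have -> : \sum_j cv j *: G v j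
     = \sum_(x : I) c x *: (((tag x == i)%:R - z (V x)) * g x).
    under [RHS]eq_bigr => x _ do rewrite mulrBl scalerBr.
    rewrite sumrB c_eq subr0.
    pose H i' (j : T i') := c (Tagged T j) *: ((i' == i)%:R * G (tnth (in_tuple s) i') j).
    transitivity (\sum_i' \sum_j H i' j); last first.
      by rewrite (sig_big_dep xpredT (fun _ => xpredT) H); apply: eq_bigr => -[].
    rewrite (bigD1 i) //= [X in _ + X]big1 ?addr0; last first.
      by move=> i' /negPf i'i; apply: big1 => j _; rewrite /H i'i mul0r scaler0.
    by apply: eq_bigr => j _; rewrite /H eqxx mul1r.
  apply: (le_trans (av_sum av _ _ _)); rewrite mulr_sumr; apply: ler_sum => x _.
  rewrite avZ // vc // mulrC ler_wpM2r // avM // ler_pM ?av_ge0 ?hB //.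
  have [xi|xi] := eqVneq (tag x) i.
    have vV : v = V x by rewrite /v /V xi.
    by rewrite av_distC // ltW // vV; apply: (hz _ (Vs x)).1.
  rewrite sub0r avN // ltW //; apply: (hz _ (Vs x)).2 => //.
  by rewrite /v /V !(tnth_nth (fun=> 0)) nth_uniq // eq_sym.
have C0 : 0 <= C by rewrite sumr_ge0.
have CZ : C = 0.
  apply/eqP; rewrite eq_le C0 andbT leNgt; apply/negP => Cp.
  have : d * C <= e * B * C *+ #|{: I}|.
    by rewrite {1}/C mulr_sumr -sumr_const; apply: ler_sum.
  rewrite -mulrnAl ler_pM2r // -mulr_natr /e.
  rewrite [leRHS](_ : _ = d * (#|{: I}|%:R / #|{: I}|.+1%:R)).
    by rewrite -[leLHS]mulr1 ler_pM2l // ler_pdivlMr // mul1r ler_nat ltnn.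
  have : #|I|.+1%:R != 0 :> R by rewrite pnatr_eq0.
  by move: (#|I|.+1%:R) => n n0; field; rewrite n0 gt_eqF.
move=> x; have : u (c x) = 0.
  by move/eqP: CZ; rewrite psumr_eq0 // => /allP/(_ x); rewrite mem_index_enum => /(_ isT)/eqP.
rewrite -(vc (V x)) // => /eqP; rewrite av_eq0; last exact: avs.
by rewrite scaler_eq0 oner_eq0 orbF => /eqP.
Qed.

End WeakApproximation.

(** * Places and heights *)

Section BaseNorm.
Variable R : realType.

(* The places of [rat]: [None] is the archimedean one. *)
Definition base_norm (b : option nat) (q : rat) : R :=
  if b is Some p then padic_norm R p q else ratr `|q|.

Definition valid_base (b : option nat) := if b is Some p then prime p else true.

Lemma padic_norm_den p (q : rat) : prime p -> coprime p `|denq q| ->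
  padic_norm R p q <= 1.
Proof.
move=> pp cp; rewrite /padic_norm; case: eqP => // _.
rewrite logn_coprime // sub0r -exprnN invf_le1 ?exprn_gt0 ?ltr0n ?prime_gt0 //.
by rewrite exprn_ege1 // ler1n prime_gt0.
Qed.

Lemma padic_norm_nat p (n : nat) : prime p -> padic_norm R p n%:R <= 1.
Proof.
move=> pp; apply: padic_norm_den => //.
by rewrite -[n%:R]/(n%:Z%:~R) denq_int coprimen1.
Qed.

Lemma padic_norm_p p : prime p -> padic_norm R p p%:R = p%:R^-1.
Proof.
move=> pp; rewrite /padic_norm -[p%:R]/(p%:Z%:~R) denq_int numq_int /=.
by rewrite intr_eq0 eqz_nat gtn_eqF ?prime_gt0 // logn1 logn_prime // eqxx sub0r exprN1.
Qed.

(** Supplies the scale c0 of weak approximation: 2 at the infinite place, 1/p at p. *)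
Lemma base_norm_gt1 b : valid_base b -> exists c, 1 < base_norm b c.
Proof.
case: b => [p /= pp|_]; last by exists 2; rewrite /= ger0_norm // ratr_nat ltr1n.
have p0 : p%:~R != 0 :> rat by rewrite intr_eq0 eqz_nat gtn_eqF ?prime_gt0.
exists (p%:Z%:~R^-1); rewrite /= /padic_norm invr_eq0 (negPf p0).
have dE : denq (p%:Z%:~R^-1) = p.
  by rewrite denqVz // eqz_nat gtn_eqF ?prime_gt0.
have nE : numq (p%:Z%:~R^-1) = 1.
  by apply: (@intr_inj rat); rewrite numqE dE mulVf.
rewrite dE nE /= logn1 logn_prime // eqxx subr0 expr1z.
by rewrite ltr1n prime_gt1.
Qed.

End BaseNorm.

Section Ultrametric.
Variables (R : realType) (F : fieldType) (v : F -> R).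
Hypothesis av : absolute_value v.

Definition ultrametric := forall x y, v (x + y) <= Num.max (v x) (v y).

(* Expand [(x + y) ^ n]: the ratio [v (x + y) / max (v x) (v y)] has its
   n-th power bounded by [n + 1]. *)
Lemma nat_le1_ultrametric : (forall n, v n%:R <= 1) -> ultrametric.
Proof.
move=> vn x y; set t := Num.max _ _; rewrite leNgt; apply/negP => tlt.
have t0 : 0 <= t by rewrite le_max av_ge0.
have bnd n : v (x + y) ^+ n <= n.+1%:R * t ^+ n.
  rewrite -avX // exprDn; apply: (le_trans (av_sum av _ _ _)).
  rewrite mulr_natl -[X in _ *+ X]card_ord -sumr_const; apply: ler_sum => i _.
  rewrite -mulr_natr !(avM av) !(avX av) -[leRHS]mulr1.
  rewrite ler_pM ?mulr_ge0 ?exprn_ge0 ?(av_ge0 av) //.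
  have lein : (i <= n)%N by rewrite -ltnS.
  rewrite -[X in t ^+ X](subnK lein) exprD.
  by rewrite ler_pM ?exprn_ge0 ?(av_ge0 av) // lerXn2r ?nnegrE ?(av_ge0 av) // le_max lexx ?orbT.
have t1 : 0 < t.
  rewrite lt_def t0 andbT; apply/eqP => tz; have := bnd 1%N.
  by rewrite !expr1 tz mulr0 leNgt -tz tlt.
have a1 : 1 < v (x + y) / t by rewrite ltr_pdivlMr // mul1r.
(* At the exponent k * k the ratio exceeds 4 ^ k = 2 ^ k * 2 ^ k >= (k + 1) ^ 2, which is more than
   k * k + 1. *)
have [k k0 hk] : exists2 k, (0 < k)%N & 4 < (v (x + y) / t) ^+ k.
  have [N _ hN] := near_expr_gt 4 a1.
  by exists N.+1 => //; apply: hN => /=.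
have := bnd (k * k)%N; rewrite -ler_pdivrMr ?exprn_gt0 // -expr_div_n exprM.
apply/negP; rewrite -ltNge.
have /lt_trans : (k * k).+1%:R < 4 ^+ k :> R.
  rewrite -natrX ltr_nat -[4%N]/(2 * 2)%N expnMn.
  have h := ltn_expl k (isT : 1 < 2)%N.
  by apply: leq_trans (leq_mul h h); lia.
by apply; rewrite ltrXn2r -?lt0n // ?ltW // ltr0n.
Qed.
End Ultrametric.

Lemma ultrametric_sum (R : realType) (F : fieldType) (v : F -> R) (I : Type)
    (s : seq I) (P : pred I) (f : I -> F) (B : R) :
    absolute_value v -> ultrametric v -> 0 <= B -> (forall i, P i -> v (f i) <= B) ->
  v (\sum_(i <- s | P i) f i) <= B.
Proof.
move=> av uv B0 h; apply: (big_ind (fun x => v x <= B)) => //; first by rewrite av0.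
by move=> x y hx hy; apply: (le_trans (uv x y)); rewrite ge_max hx hy.
Qed.

Section FieldHeight.
Variables (R : realType) (F : fieldExtType rat).
Implicit Types (v : F -> R) (a : F).

Local Notation over b := (@av_over R F (base_norm R b)).

Lemma placesP v : @places R F v <-> exists2 b, valid_base b & over b v.
Proof.
split=> [[av [h|[p pp h]]]|[[p pp|_] [av h]]].
- by exists None.
- by exists (Some p).
- by split=> //; right; exists p.
- by split=> //; left.
Qed.

Lemma local_degree_max v m (g : 'I_m -> F) :
  absolute_value v -> v_indep v g -> (m <= local_degree v)%N.
Proof.
move=> av ig; have [m' [g' ig' gM]] := exists_max_indep av.
by rewrite (local_degreeE av ig' gM); apply: gM ig.
Qed.

Lemma local_degree_gt0 v : absolute_value v -> (0 < local_degree v)%N.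
Proof.
move=> av; apply: (@local_degree_max v 1 (fun=> 1)) => //.
exists 1 => // c i; rewrite mul1r big_ord1 avZ // av1 // mulr1.
by rewrite (ord1 i).
Qed.

(** Every local degree is positive, so [sum_local_degree] leaves room for at most [\dim {:F}]
    places. *)
Lemma over_finite b : valid_base b -> finite_set [set v | over b v].
Proof.
move=> vb; apply: contrapT => /(infinite_set_fset (\dim {:F}).+1) [B BA].
have [c hc] := base_norm_gt1 R vb.
apply/negP; rewrite -leqNgt.
apply: leq_trans (sum_local_degree hc (finmap.fset_uniq B) BA).
rewrite -sum1_size big_seq [leqRHS]big_seq; apply: leq_sum => v vB.
by apply: local_degree_gt0; case: (BA v vB).
Qed.

Lemma over_nonarch_ultra p v : prime p -> over (Some p) v -> ultrametric v.
Proof.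
move=> pp [av h]; apply: nat_le1_ultrametric => // n.
by rewrite -scaler_nat; have := h n%:R; rewrite /= => ->; apply: padic_norm_nat.
Qed.

Lemma rat_poly_root a : exists2 q : {poly rat}, q \is monic &
  root (map_poly (in_alg F) q) a.
Proof.
have /polyOver1P [q qE] := minPolyOver 1%AS a.
exists q; last by rewrite -qE root_minPoly.
by have := monic_minPoly 1%AS a; rewrite qE map_monic.
Qed.

(** If v a > 1, the leading power of a would exceed every other term of the p-integral monic
    equation. *)
Lemma over_nonarch_le1 p v a (q : {poly rat}) : prime p -> over (Some p) v ->
    q \is monic -> root (map_poly (in_alg F) q) a ->
    (forall i, coprime p `|denq q`_i|) -> v a <= 1.
Proof.
move=> pp ov qm qa cq; have [av hv] := ov.
have uv := over_nonarch_ultra pp ov.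
rewrite leNgt; apply/negP => va.
have [n nE] : exists n, size q = n.+1.
  by exists (size q).-1; rewrite prednK // lt0n size_poly_eq0 monic_neq0.
have aE : a ^+ n = - \sum_(i < n) q`_i *: a ^+ i.
  apply/eqP; rewrite -addr_eq0 addrC; move/eqP: qa.
  rewrite horner_coef size_map_poly nE big_ord_recr /= => e; apply/eqP.
  rewrite -[RHS]e coef_map /= -[n]/(n.+1.-1) -nE -lead_coefE (monicP qm) scale1r mul1r.
  by congr (_ + _); apply: eq_bigr => i _; rewrite coef_map /= mulr_algl.
have := congr1 v aE; rewrite avX // avN //.
case: n {aE} nE => [|n] nE.
  by rewrite big_ord0 av0 // expr0 => /eqP; rewrite oner_eq0.
move=> vE; have : v a ^+ n.+1 <= v a ^+ n.
  rewrite vE; apply: ultrametric_sum => // [|i _]; first by rewrite exprn_ge0 ?av_ge0.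
  rewrite avZ // avX // -[leRHS]mul1r ler_pM ?exprn_ge0 ?av_ge0 //.
    by rewrite hv; apply: padic_norm_den.
  by rewrite ler_weXn2l ?(ltW va) // -ltnS.
by rewrite exprS ger_pMl ?exprn_gt0 ?(lt_trans ltr01) // leNgt va.
Qed.

Lemma finite_places_gt1 a : finite_set [set v | @places R F v /\ 1 < v a].
Proof.
have [q qm qa] := rat_poly_root a.
(* At the primes not dividing N the polynomial q is p-integral, hence v a <= 1. *)
pose N := (\prod_(i < size q) `|denq q`_i|)%N.
have N0 : (0 < N)%N by rewrite prodn_gt0 // => i; rewrite absz_gt0 denq_neq0.
pose B := None :: [seq Some p | p <- primes N].
have BP b : b \in B -> valid_base b.
  rewrite in_cons => /orP [/eqP -> //|/mapP [p]].
  by rewrite mem_primes => /andP [pp _] ->.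
apply: (@sub_finite_set _ _ (\bigcup_(b in [set` B]) [set v | over b v])); last first.
  by apply: bigcup_finite => // b /BP; apply: over_finite.
move=> v [/placesP [b vb ov] va]; exists b => //=.
case: b vb ov => [p|] //= pp ov; rewrite in_cons /= mem_map; last by move=> ? ? [].
rewrite mem_primes pp N0 /=; apply: contraLR va => pN; rewrite -leNgt.
apply: (over_nonarch_le1 pp ov qm qa) => i.
have [li|li] := ltnP i (size q); last by rewrite nth_default // coprimen1.
rewrite prime_coprime //; apply: contra pN => /dvdn_trans; apply.
by rewrite /N (bigD1 (Ordinal li)) //= dvdn_mulr.
Qed.

Definition local_height v a : R :=
  (Num.max 1 (v a)) `^ ((local_degree v)%:R / (\dim {:F})%:R).

Lemma local_height_ge1 v a : 1 <= local_height v a.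
Proof.
by rewrite -(powRr0 (Num.max 1 (v a))) ler_powR ?le_max ?lexx.
Qed.

Lemma local_height_eq1 v a : v a <= 1 -> local_height v a = 1.
Proof. by move=> h; rewrite /local_height max_l // powR1. Qed.

Lemma field_heightE a : exists2 r : seq (F -> R), uniq r &
  (forall v, v \in r <-> places v /\ 1 < v a) /\
  field_height R a = \prod_(v <- r) local_height v a.
Proof.
have fin := finite_places_gt1 a.
exists (finmap.enum_fset (fset_set [set v | @places R F v /\ 1 < v a])).
  exact: finmap.fset_uniq.
split.
  move=> v; rewrite in_fset_set //; split=> [/set_mem //|h]; exact: mem_set.
rewrite -fsbig_finite // /field_height; apply/esym; apply: fsbig_widen.
  by move=> v [].
move=> v [pv] /= /not_andP [//|/negP]; rewrite -leNgt; exact: local_height_eq1.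
Qed.

Lemma field_height_ge a (s : seq (F -> R)) : uniq s ->
  (forall v, v \in s -> places v) ->
  \prod_(v <- s) local_height v a <= field_height R a.
Proof.
move=> us sp; have [r ur [rP ->]] := field_heightE a.
rewrite (bigID (mem r)) /= [X in _ * X]big1_seq ?mulr1; last first.
  move=> v /andP [vr vs]; apply: local_height_eq1; rewrite leNgt.
  by apply: contra vr => va; apply/rP; split=> //; apply: sp.
rewrite [leRHS](bigID (mem s)) /= -[X in X <= _]mulr1.
have e : \prod_(v <- s | v \in r) local_height v a = \prod_(v <- r | v \in s) local_height v a.
  rewrite -big_filter -[RHS]big_filter; apply: perm_big; apply: uniq_perm.
  - exact: filter_uniq.
  - exact: filter_uniq.
  - by move=> v; rewrite !mem_filter andbC.
rewrite e ler_wpM2l //.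
  by apply: prodr_ge0 => v _; rewrite powR_ge0.
apply: (big_ind (fun x => 1 <= x)) => // [x y|v _]; first exact: mulr_ege1.
exact: local_height_ge1.
Qed.

(** Only infinite places contribute, and their exponents add up to at most 1 by
    [sum_local_degree]. *)
Lemma field_height_le a (rho : R) : 1 <= rho ->
    (forall v, over None v -> v a <= rho) ->
    (forall p v, prime p -> over (Some p) v -> v a <= 1) ->
  field_height R a <= rho.
Proof.
move=> rho1 harch hnon; have [r ur [rP ->]] := field_heightE a.
have rover v : v \in r -> over None v.
  case/rP => /placesP [[p|] // pp ov] va.
  by have := hnon _ _ pp ov; rewrite leNgt va.
have n0 : 0 < (\dim {:F})%:R :> R by rewrite ltr0n adim_gt0.
have rho0 : 0 < rho by apply: lt_le_trans rho1.
apply: (@le_trans _ _ (\prod_(v <- r) rho `^ ((local_degree v)%:R / (\dim {:F})%:R))).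
  rewrite big_seq [leRHS]big_seq; apply: ler_prod => v vr; rewrite powR_ge0 /=.
  rewrite ge0_ler_powR ?divr_ge0 ?nnegrE ?le_max ?ler01 ?(ltW rho0) //.
  by rewrite ge_max rho1 harch //; apply: rover.
have -> : \prod_(v <- r) rho `^ ((local_degree v)%:R / (\dim {:F})%:R) =
    rho `^ ((\sum_(v <- r) local_degree v)%:R / (\dim {:F})%:R).
  rewrite natr_sum mulr_suml.
  elim: r {ur rP rover} => [|v r IH]; first by rewrite !big_nil powRr0.
  by rewrite !big_cons IH powRD // (gt_eqF rho0) implybT.
rewrite -[leRHS](powRr1 (ltW rho0)) ler_powR // ler_pdivrMr // mul1r ler_nat.
have [c hc] := base_norm_gt1 R (isT : valid_base None).
exact: (sum_local_degree hc ur rover).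
Qed.

End FieldHeight.

Lemma weil_heightE (R : realType) (alpha : algC) :
  exists (F : fieldExtType rat) (FC : {rmorphism F -> algC}) (a : F),
    [/\ FC a = alpha, <<1; a>>%VS = fullv & weil_height R alpha = field_height R a].
Proof.
rewrite /weil_height; case: num_field_exists => F [FC [s sE sgen]].
case: s sE sgen => [|a [|b s]] //= [aE] sgen.
by exists F, FC, a; split=> //; rewrite -sgen adjoin_seq1.
Qed.

(** * Absolute values on the algebraic numbers *)

Section ArchimedeanNorm.
Variable R : realType.

(** The modulus of z is an element of algC, not of R; the rationals, which map to both, carry it
    over as a Dedekind cut. *)
Definition arch_cut (z : algC) : set R :=
  [set ratr q | q in [set q : rat | (ratr q : algC) <= `|z|]].

Definition arch_norm (z : algC) : R := sup (arch_cut z).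

Lemma arch_approx (z : algC) n : exists q : rat, [/\ 0 <= q,
  (ratr q : algC) <= `|z| & `|z| <= ratr (q + n.+1%:R^-1) :> algC].
Proof.
have z0 : 0 <= `|z| * n.+1%:R :> algC by rewrite mulr_ge0.
have n0 : 0 < n.+1%:R :> algC by rewrite ltr0n.
exists ((Num.truncn (`|z| * n.+1%:R))%:R / n.+1%:R); split.
- by rewrite divr_ge0.
- by rewrite fmorph_div /= !ratr_nat ler_pdivrMr // truncn_le.
- rewrite -[X in _ + X]mul1r -mulrDl fmorph_div /= !ratr_nat rmorphD /= ratr_nat.
  by rewrite rmorph1 natr1 ler_pdivlMr // ltW // real_truncnS_gt // ger0_real.
Qed.

Lemma arch_cut_sup (z : algC) : has_sup (arch_cut z).
Proof.
split; first by exists (ratr 0), 0 => //=; rewrite rmorph0.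
have [q [_ _ h]] := arch_approx z 0.
by exists (ratr (q + 1%:R^-1)) => _ [q' /= h' <-]; rewrite ler_rat -(ler_rat algC) (le_trans h').
Qed.

Lemma arch_norm_ge (z : algC) (q : rat) :
  ratr q <= `|z| -> ratr q <= arch_norm z.
Proof. by move=> h; apply: ub_le_sup; [case: (arch_cut_sup z)|exists q]. Qed.

Lemma arch_norm_le (z : algC) (q : rat) :
  `|z| <= ratr q -> arch_norm z <= ratr q.
Proof.
move=> h; apply: ge_sup; first by case: (arch_cut_sup z).
by move=> _ [q' /= h' <-]; rewrite ler_rat -(ler_rat algC) (le_trans h').
Qed.

Lemma arch_norm_rat (q : rat) : arch_norm (ratr q) = ratr `|q|.
Proof.
have e : `|ratr q : algC| = ratr `|q| by rewrite ratr_norm.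
by apply/eqP; rewrite eq_le arch_norm_le ?arch_norm_ge ?e.
Qed.

Lemma arch_norm_ge0 z : 0 <= arch_norm z.
Proof. by rewrite -(rmorph0 (ratr : rat -> R)) arch_norm_ge // rmorph0. Qed.

Lemma arch_approxR (z : algC) n : exists q : rat, [/\ 0 <= q,
  (ratr q : algC) <= `|z|, `|z| <= ratr (q + n.+1%:R^-1) :> algC,
  ratr q <= arch_norm z & arch_norm z <= ratr q + n.+1%:R^-1].
Proof.
have [q [q0 q1 q2]] := arch_approx z n; exists q; split=> //.
  exact: arch_norm_ge.
by have := arch_norm_le q2; rewrite rmorphD fmorphV /= ratr_nat.
Qed.

Lemma arch_norm_av : absolute_value arch_norm.
Proof.
(* Multiplicativity and the triangle inequality are checked up to c / (n + 1), on rational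
   approximations of that precision. *)
have le_eps (x y c : R) : (forall n, x <= y + c * n.+1%:R^-1) -> x <= y.
  move=> h; rewrite leNgt; apply/negP => xy.
  have [c0|c0] := leP c 0.
    have := h 0%N; rewrite invr1 mulr1 leNgt; apply/negP; rewrite negbK.
    by move: xy c0; lra.
  have d0 : 0 < (x - y) / c by rewrite divr_gt0 // subr_gt0.
  have [N hN] := inv_small d0.
  have := hN N (leqnn N); rewrite ltr_pdivlMr // => h1.
  by have := h N; rewrite leNgt; apply/negP; rewrite negbK mulrC -ltrBrDl.
split; first exact: arch_norm_ge0.
- move=> z; split=> [|->]; last first.
    by rewrite -(rmorph0 (ratr : rat -> algC)) arch_norm_rat normr0 rmorph0.
  move=> h; apply/eqP; rewrite -normr_le0 real_leNgt ?normr_real ?real0 //.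
  apply/negP => z0.
  pose n := Num.truncn (`|z|^-1).
  have : (ratr n.+1%:R^-1 : algC) <= `|z|.
    rewrite fmorphV /= ratr_nat -[leRHS]invrK lef_pV2 ?posrE ?ltr0n ?invr_gt0 //.
    by rewrite ltW // real_truncnS_gt // ger0_real // invr_ge0 ltW.
  move/arch_norm_ge; rewrite h fmorphV /= ratr_nat leNgt invr_gt0 ltr0n //.
- move=> z w; apply/eqP; rewrite eq_le; apply/andP; split.
    (* Raising both factors by a <= 1 raises the product q * t by a * (q + t + a), whence this
       constant. *)
    apply: (@le_eps _ _ (arch_norm z + arch_norm w + 1)) => n.
    have [q [q0 q1 q2 q3 q4]] := arch_approxR z n.
    have [t [t0 t1 t2 t3 t4]] := arch_approxR w n.
    have : `|z * w| <= ratr ((q + n.+1%:R^-1) * (t + n.+1%:R^-1)).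
      by rewrite normrM rmorphM ler_pM.
    move/arch_norm_le => /le_trans; apply.
    rewrite rmorphM !rmorphD !fmorphV /= !ratr_nat.
    set a := n.+1%:R^-1 in q4 t4 *.
    have a1 : a <= 1 by rewrite invf_le1 ?ler1n ?ltr0n.
    have a0 : 0 <= a by rewrite invr_ge0.
    have q0' : 0 <= ratr q :> R by rewrite ler0q.
    have t0' : 0 <= ratr t :> R by rewrite ler0q.
    by nra.
  apply: (@le_eps _ _ (arch_norm z + arch_norm w + 1)) => n.
  have [q [q0 q1 q2 q3 q4]] := arch_approxR z n.
  have [t [t0 t1 t2 t3 t4]] := arch_approxR w n.
  have : ratr (q * t) <= `|z * w| by rewrite normrM rmorphM /= ler_pM ?ler0q.
  move/arch_norm_ge; rewrite rmorphM /= => h.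
  set a := n.+1%:R^-1 in q4 t4 *.
  have a1 : a <= 1 by rewrite invf_le1 ?ler1n ?ltr0n.
  have a0 : 0 <= a by rewrite invr_ge0.
  have q0' : 0 <= ratr q :> R by rewrite ler0q.
  have t0' : 0 <= ratr t :> R by rewrite ler0q.
  by nra.
- move=> z w; apply: (@le_eps _ _ 2) => n.
  have [q [q0 q1 q2 q3 q4]] := arch_approxR z n.
  have [t [t0 t1 t2 t3 t4]] := arch_approxR w n.
  have : `|z + w| <= ratr ((q + n.+1%:R^-1) + (t + n.+1%:R^-1)).
    by rewrite rmorphD (le_trans (ler_normD _ _)) // lerD.
  move/arch_norm_le => /le_trans; apply.
  rewrite !rmorphD !fmorphV /= !ratr_nat.
  by move: q3 t3; move: (n.+1%:R^-1) => a; lra.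
Qed.

End ArchimedeanNorm.

(** * Extension of the p-adic absolute value to algC by a valuation ring *)

Section PadicValuationRing.
Variable p : nat.
Hypothesis p_prime : prime p.

Definition subring_set (V : set algC) :=
  [/\ V 1, forall x y, V x -> V y -> V (x - y) & forall x y, V x -> V y -> V (x * y)].

Lemma subring_set0 V : subring_set V -> V 0.
Proof. by case=> V1 VB _; rewrite -(subrr 1); apply: VB. Qed.

Lemma subring_setN V x : subring_set V -> V x -> V (- x).
Proof. by move=> sV Vx; rewrite -sub0r; case: (sV) => _ + _; apply=> //; apply: subring_set0. Qed.

Lemma subring_setD V x y : subring_set V -> V x -> V y -> V (x + y).
Proof.
by move=> sV Vx Vy; rewrite -[y]opprK; case: (sV) => _ + _; apply=> //; apply: subring_setN.
Qed.

Lemma subring_setX V x n : subring_set V -> V x -> V (x ^+ n).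
Proof. by case=> V1 _ VM Vx; elim: n => [|n IH]; rewrite ?expr0 // exprS; apply: VM. Qed.

Lemma subring_set_nat V n : subring_set V -> V n%:R.
Proof.
move=> sV; elim: n => [|n IH]; first exact: subring_set0.
by rewrite mulrS; apply: subring_setD => //; case: sV.
Qed.

Lemma subring_set_int V (n : int) : subring_set V -> V n%:~R.
Proof.
move=> sV; case: n => n; first exact: subring_set_nat.
by rewrite NegzE rmorphN /=; apply: subring_setN => //; apply: subring_set_nat.
Qed.

Lemma subring_set_sum V (I : Type) (s : seq I) (P : pred I) (f : I -> algC) :
  subring_set V -> (forall i, P i -> V (f i)) -> V (\sum_(i <- s | P i) f i).
Proof.
move=> sV h; apply: (big_ind V) => //; first exact: subring_set0.
by move=> x y Vx Vy; apply: subring_setD.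
Qed.

Definition adjoin_set (V : set algC) (x : algC) : set algC :=
  [set f.[x] | f in [set f : {poly algC} | forall i, V f`_i]].

Lemma adjoin_set_subring V x : subring_set V -> subring_set (adjoin_set V x).
Proof.
move=> sV; have [V1 VB VM] := sV; split.
- exists 1; last by rewrite hornerC.
  by move=> i; rewrite coef1; case: eqP => // _; apply: subring_set0.
- move=> _ _ [f /= hf <-] [g /= hg <-]; exists (f - g); last by rewrite hornerD hornerN.
  by move=> i; rewrite coefB; apply: VB.
- move=> _ _ [f /= hf <-] [g /= hg <-]; exists (f * g); last by rewrite hornerM.
  by move=> i; rewrite coefM; apply: subring_set_sum => // j _; apply: VM.
Qed.

Lemma sub_adjoin_set V x : subring_set V -> V `<=` adjoin_set V x.
Proof.
move=> sV y Vy; exists y%:P; last by rewrite hornerC.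
by move=> i /=; rewrite coefC; case: eqP => // _; apply: subring_set0.
Qed.

Lemma mem_adjoin_set V x : subring_set V -> adjoin_set V x x.
Proof.
move=> sV; exists 'X; last by rewrite hornerX.
by move=> i /=; rewrite coefX; case: eqP => // _; [case: sV|apply: subring_set0].
Qed.

(** Maximality among the subrings avoiding 1/p will make V a valuation ring in which p is not
    invertible. *)
Lemma exists_max_subring : exists V, [/\ subring_set V, ~ V p%:R^-1 &
  forall B, subring_set B -> V `<=` B -> ~ B p%:R^-1 -> B = V].
Proof.
pose P (A : set algC) := A = set0 \/ (subring_set A /\ ~ A p%:R^-1).
have [|A [PA Amax]] := @Zorn_bigcup _ P.
  move=> C CP tC; have [nC|[A0 CA0 [x0 A0x]]] : (\bigcup_(X in C) X = set0) \/
      (exists2 A, C A & exists x, A x).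
    have [h|h] := pselect (exists2 A, C A & exists x, A x); first by right.
    by left; apply/seteqP; split=> // x [A CA Ax]; apply: h; exists A => //; exists x.
  by left.
  have sub A x : C A -> A x -> subring_set A /\ ~ A p%:R^-1.
    by move=> CA Ax; case: (CP _ CA) => // A0e; rewrite A0e in Ax.
  have two x y : (\bigcup_(X in C) X) x -> (\bigcup_(X in C) X) y ->
      exists A, [/\ C A, A x & A y].
    move=> [A CA Ax] [B CB By]; case: (tC A B CA CB) => h.
      by exists B; split=> //; apply: h.
    by exists A; split=> //; apply: h.
  right; split; last by move=> [A CA Ap]; have [_] := sub _ _ CA Ap; apply.
  split.
  - by exists A0 => //; have [[]] := sub _ _ CA0 A0x.
  - move=> x y /two /[apply] -[A [CA Ax Ay]]; exists A => //.
    by have [[_ + _] _] := sub _ _ CA Ax; apply.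
  - move=> x y /two /[apply] -[A [CA Ax Ay]]; exists A => //.
    by have [[_ _ +] _] := sub _ _ CA Ax; apply.
have sZ : subring_set (range (fun n : int => n%:~R : algC)).
  split; first by exists 1.
    by move=> _ _ [m _ <-] [n _ <-]; exists (m - n) => //; rewrite rmorphB.
  by move=> _ _ [m _ <-] [n _ <-]; exists (m * n) => //; rewrite rmorphM.
have nZ : ~ range (fun n : int => n%:~R : algC) p%:R^-1.
  move=> [n _ /(congr1 (fun x => x * p%:R))]; rewrite mulVf; last first.
    by rewrite pnatr_eq0 gtn_eqF ?prime_gt0.
  rewrite -[p%:R]/(p%:Z%:~R) -rmorphM -[1]/(1%:~R) => /intr_inj h.
  move/(congr1 absz): h => /eqP; rewrite abszM muln_eq1 => /andP [_ /eqP p1].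
  by move: p_prime; rewrite -[p]absz_nat p1.
exists A; case: PA => [A0|[sA nA]].
  exfalso; apply: (Amax (range (fun n : int => n%:~R : algC))); last by right.
  by rewrite A0; split=> // /(_ 1); apply; exists 1.
split=> // B sB AB nB; apply: contrapT => BA; apply: (Amax B); last by right.
by split=> // BA'; apply: BA; apply/seteqP.
Qed.

Variable V : set algC.
Hypothesis sV : subring_set V.
Hypothesis nV : ~ V p%:R^-1.
Hypothesis maxV : forall B, subring_set B -> V `<=` B -> ~ B p%:R^-1 -> B = V.

Let V1 : V 1. Proof. by case: sV. Qed.
Let VM x y : V x -> V y -> V (x * y). Proof. by case: sV => _ _; apply. Qed.
Let VB x y : V x -> V y -> V (x - y). Proof. by case: sV => _ + _; apply. Qed.
Let VD x y : V x -> V y -> V (x + y). Proof. exact: subring_setD. Qed.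
Let VX x n : V x -> V (x ^+ n). Proof. exact: subring_setX. Qed.
Let Vn n : V n%:R. Proof. exact: subring_set_nat. Qed.
Let p0 : p%:R != 0 :> algC. Proof. by rewrite pnatr_eq0 gtn_eqF ?prime_gt0. Qed.

Lemma vring_adjoin x : ~ V x ->
  exists2 f : {poly algC}, forall i, V f`_i & f.[x] = p%:R^-1.
Proof.
move=> nVx; have [[f Vf fx]|h] := pselect (adjoin_set V x p%:R^-1); first by exists f.
case: nVx; rewrite -(maxV (adjoin_set_subring x sV) _ h); last exact: sub_adjoin_set.
exact: mem_adjoin_set.
Qed.

(** p lies in the Jacobson radical of V. Otherwise 1/p is a polynomial in 1/u for u = 1 - p b, and
    multiplying by a power of u, again congruent to 1 modulo p, brings 1/p into V. *)
Lemma vring_inv1 b : V b -> V (1 - p%:R * b)^-1.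
Proof.
move=> Vb; apply: contrapT => /vring_adjoin [f Vf fx].
set u := 1 - p%:R * b in fx *.
have Vu : V u by apply: VB => //; apply: VM.
have u0 : u != 0.
  apply/eqP => /subr0_eq h; apply: nV.
  by rewrite (_ : _^-1 = b) //; apply: (mulfI p0); rewrite mulfV.
have uE n : exists2 c, V c & u ^+ n = 1 - p%:R * c.
  elim: n => [|n [c Vc IH]]; first by exists 0; [apply: subring_set0|rewrite mulr0 subr0].
  exists (b + c - p%:R * (b * c)); last by rewrite exprS IH /u; ring.
  by apply: VB; [apply: VD|apply: VM => //; apply: VM].
have [c Vc cE] := uE (size f).
have : V (u ^+ size f * f.[u^-1]).
  rewrite horner_coef mulr_sumr; apply: subring_set_sum => // i _.
  rewrite mulrCA; apply: VM => //.
  by rewrite exprVn -expfB // ; apply: VX.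
rewrite fx cE => h; apply: nV.
have -> : p%:R^-1 = (1 - p%:R * c) / p%:R + c by field.
exact: VD.
Qed.

(* Chevalley's argument: the relations [f(x) = 1/p] and [g(1/x) = 1/p] of
   minimal degree contradict each other, the shorter one being used to lower
   the degree of the longer one. *)
Lemma vring_total x : x != 0 -> V x \/ V x^-1.
Proof.
move=> x0; have [|nx] := pselect (V x); first by left.
have [|nx'] := pselect (V x^-1); first by right.
have [f Vf fx] := vring_adjoin nx; have [g Vg gx] := vring_adjoin nx'.
exfalso; have [N] : exists N, (size f + size g <= N)%N by exists (size f + size g)%N.
elim: N x x0 f g {nx nx'} Vf Vg fx gx => [|N IH] x x0 f g Vf Vg fx gx le_N.
  have /eqP f0 : f == 0 by rewrite -size_poly_eq0; lia.
  by move: fx; rewrite f0 horner0 => /esym/eqP; rewrite invr_eq0 (negPf p0).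
wlog le_gf : x x0 f g Vf Vg fx gx le_N / (size g <= size f)%N.
  move=> h; have [le|/ltnW le] := leqP (size g) (size f); first exact: (h x x0 f g).
  apply: (h x^-1 _ g f) => //; rewrite ?invr_eq0 ?invrK //.
  by rewrite addnC.
case fE : (size f) => [|n].
  move/eqP: fE; rewrite size_poly_eq0 => /eqP f0.
  by move: fx; rewrite f0 horner0 => /esym/eqP; rewrite invr_eq0 (negPf p0).
(* Multiply g(1/x) = 1/p by p x ^ n. As 1 - p g_0 is a unit, x ^ n becomes a combination of lower
   powers, and substituting it shortens f. *)
have [c Vc cE] : exists2 c : 'I_n -> algC, forall i, V (c i) &
    x ^+ n = \sum_(i < n) c i * x ^+ i.
  pose u := (1 - p%:R * g`_0)^-1.
  have Vu : V u by apply: vring_inv1.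
  exists (fun i => p%:R * u * g`_(n - i)).
    by move=> i; apply: VM => //; apply: VM.
  have u0 : 1 - p%:R * g`_0 != 0.
    apply/eqP => /subr0_eq h; apply: nV.
    by rewrite (_ : _^-1 = g`_0) //; apply: (mulfI p0); rewrite mulfV.
  have : x ^+ n * (1 - p%:R * g`_0) = p%:R * \sum_(i < n) g`_(n - i) * x ^+ i.
    have -> : 1 - p%:R * g`_0 = p%:R * (g.[x^-1] - g`_0).
      by rewrite gx mulrBr divff.
    rewrite mulrCA; congr (_ * _).
    have le' : (size g <= n.+1)%N by rewrite -fE.
    rewrite (horner_coef_wide _ le') big_ord_recl expr0 mulr1 addrAC subrr add0r.
    rewrite (reindex_inj rev_ord_inj) /= mulr_sumr; apply: eq_bigr => i _.
    rewrite /bump leq0n add1n subnSK // mulrCA; congr (_ * _).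
    by rewrite exprVn -expfB_cond ?(negPf x0) ?leq_subr // subKn // ltnW.
  move=> h; rewrite -[LHS](mulfK u0) h -/u mulrAC mulr_sumr.
  by apply: eq_bigr => i _; rewrite mulrA.
pose f' := \poly_(i < n) (f`_i + f`_n * (if insub i is Some k then c k else 0)).
have Vf' i : V f'`_i.
  rewrite coef_poly; case: ltnP => _; last exact: subring_set0.
  by apply: VD => //; apply: VM => //; case: insub => // ; apply: subring_set0.
apply: (IH x x0 f' g) => //; last first.
  have : (size f' <= n)%N by apply: size_poly.
  by move: le_N; rewrite fE; lia.
have le' : (size f <= n.+1)%N by rewrite fE.
rewrite -fx horner_poly (horner_coef_wide _ le') big_ord_recr /= cE mulr_sumr -big_split /=.
by apply: eq_bigr => i _; rewrite valK mulrDl mulrA.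
Qed.

(** Without the first clause 0 would be a unit, because its inverse is 0 by convention. *)
Definition vunit x := [/\ x != 0, V x & V x^-1].

Lemma vunit1 : vunit 1. Proof. by rewrite /vunit invr1 oner_neq0. Qed.

Lemma vunitM x y : vunit x -> vunit y -> vunit (x * y).
Proof.
move=> [x0 Vx Vx'] [y0 Vy Vy']; split; [by rewrite mulf_neq0|exact: VM|].
by rewrite invfM; apply: VM.
Qed.

Lemma vunitV x : vunit x -> vunit x^-1.
Proof. by move=> [x0 Vx Vx']; split; rewrite ?invrK ?invr_eq0. Qed.

Lemma vunitN x : vunit x -> vunit (- x).
Proof.
by move=> [x0 Vx Vx']; split; rewrite ?invrN ?oppr_eq0 //; apply: subring_setN.
Qed.

Lemma vunitX x n : vunit x -> vunit (x ^+ n).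
Proof.
move=> ux; elim: n => [|n IH]; first by rewrite expr0; apply: vunit1.
by rewrite exprS; apply: vunitM.
Qed.

(** V is local: if s / t is in V, then 1 / t is the multiple of 1 / (s + t) by s / t + 1, and
    symmetrically. *)
Lemma vunitD s t : V s -> V t -> vunit (s + t) -> vunit s \/ vunit t.
Proof.
move=> Vs Vt [st0 _ Vst].
have [s0|s0] := eqVneq s 0; first by right; move: st0 Vst; rewrite s0 add0r.
have [t0|t0] := eqVneq t 0; first by left; move: st0 Vst; rewrite t0 addr0.
have st : s / t != 0 by rewrite mulf_neq0 // invr_eq0.
case: (vring_total st) => h; [right|left]; split=> //.
  have -> : t^-1 = (s / t + 1) * (s + t)^-1 by field; rewrite st0 t0.
  by apply: VM => //; apply: VD.
have -> : s^-1 = ((s / t)^-1 + 1) * (s + t)^-1 by field; rewrite st0 t0 s0.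
by apply: VM => //; apply: VD.
Qed.

Lemma vunit_sum (I : eqType) (s : seq I) (P : pred I) (f : I -> algC) :
    (forall i, V (f i)) -> vunit (\sum_(i <- s | P i) f i) ->
  exists2 i, P i & vunit (f i).
Proof.
move=> Vf; elim: s => [|a s IH]; first by rewrite big_nil => -[]; rewrite eqxx.
rewrite big_cons; case: ifP => // Pa /vunitD [] //; first exact: subring_set_sum.
by exists a.
Qed.

(** By Bezout some multiple of n has the form 1 + p b, a unit by [vring_inv1]. *)
Lemma vunit_coprime n : coprime p n -> vunit n%:R.
Proof.
move=> cpn; have n0 : (0 < n)%N.
  by rewrite lt0n; apply: contraTneq cpn => ->; rewrite /coprime gcdn0 gtn_eqF ?prime_gt1.
have n0' : n%:R != 0 :> algC by rewrite pnatr_eq0 -lt0n.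
split=> //; case: (egcdnP p n0) => c b e _.
move: cpn; rewrite coprime_sym /coprime => /eqP g1; rewrite g1 in e.
have eA : n%:R * c%:R = 1 - p%:R * (- b%:R) :> algC.
  by rewrite -natrM mulnC e natrD natrM; ring.
have -> : n%:R^-1 = c%:R * (1 - p%:R * (- b%:R))^-1 :> algC.
  rewrite -eA; have c0 : c%:R != 0 :> algC.
    apply/eqP => c0; move: e; have -> : c = 0%N by apply/eqP; rewrite -(pnatr_eq0 algC) c0.
    by rewrite mul0n addn1.
  by field; rewrite n0' c0.
by apply: VM => //; apply: vring_inv1; apply: subring_setN.
Qed.

Lemma vunit_nat n : (0 < n)%N -> vunit (n%:R * p%:R ^- logn p n).
Proof.
move=> n0; have [m cm {1}->] := pfactor_coprime p_prime n0.
by rewrite natrM natrX mulfK ?expf_neq0 //; apply: vunit_coprime.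
Qed.

Lemma vunit_int (n : int) : n != 0 -> vunit (n%:~R * p%:R ^- logn p `|n|).
Proof.
move=> n0; have n1 : (0 < `|n|)%N by rewrite absz_gt0.
rewrite {1}[n]intEsign rmorphM /= rmorph_sign.
by case: (n < 0); rewrite ?expr0 ?mul1r ?expr1 ?mulN1r ?mulNr; [apply: vunitN|]; apply: vunit_nat.
Qed.

Lemma vunit_rat (c : rat) : c != 0 ->
  vunit (ratr c * p%:R ^ ((logn p `|denq c|)%:Z - (logn p `|numq c|)%:Z)).
Proof.
move=> c0; have pu : (p%:R : algC) \is a GRing.unit by rewrite unitfE.
rewrite exprzDr // -invr_expz -!exprnP.
have -> : ratr c * (p%:R ^+ logn p `|denq c| * p%:R ^- logn p `|numq c|)
   = ((numq c)%:~R * p%:R ^- logn p `|numq c|) / ((denq c)%:~R * p%:R ^- logn p `|denq c|) :> algC.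
  by rewrite /ratr invfM invrK; ring.
apply: vunitM; first by apply: vunit_int; rewrite numq_eq0.
by apply/vunitV/vunit_int; rewrite denq_neq0.
Qed.

(** Divisibility in V is total, so a finite family has a member of largest absolute value. *)
Lemma vring_min (I : finType) (f : I -> algC) i1 : f i1 != 0 ->
  exists2 i0, f i0 != 0 & forall i, V (f i / f i0).
Proof.
move=> f1; suff /(_ (enum I)) [i0 f0 h] : forall s : seq I,
    exists2 i0, f i0 != 0 & forall i, i \in s -> V (f i / f i0).
  by exists i0 => // i; apply: h; rewrite mem_enum.
elim=> [|j s [i0 f0 h]]; first by exists i1.
have [Vj|nVj] := pselect (V (f j / f i0)).
  by exists i0 => // i; rewrite in_cons => /orP [/eqP ->|/h].
have fj : f j != 0.
  by apply/eqP => fj; apply: nVj; rewrite fj mul0r; apply: subring_set0.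
have fji : f j / f i0 != 0 by rewrite mulf_neq0 // invr_eq0.
case: (vring_total fji) => // Vi; exists j => // i.
rewrite in_cons => /orP [/eqP ->|/h hi]; first by rewrite divff.
have -> : f i / f j = (f i / f i0) * (f j / f i0)^-1 by field; rewrite f0 fj.
exact: VM.
Qed.

(* In an algebraic relation for [x], two monomials have the same value. *)
Lemma vring_root x : x != 0 ->
  exists m (k : int), (0 < m)%N /\ vunit (x ^+ m * p%:R ^ k).
Proof.
move=> x0; have [q [_ qm] qx] := minCpolyP x.
have := qx q; rewrite dvdpp => /rootP; rewrite horner_coef.
rewrite size_map_poly; set n := size q => sum0.
have n0 : (0 < n)%N by rewrite lt0n size_poly_eq0 monic_neq0.
pose f (i : 'I_n) : algC := ratr q`_i * x ^+ i.
have {}sum0 : \sum_i f i = 0.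
  by rewrite -[RHS]sum0; apply: eq_bigr => i _; rewrite coef_map.
have ln : (n.-1 < n)%N by rewrite prednK.
have f1 : f (Ordinal ln) != 0.
  by rewrite /f mulf_neq0 ?expf_neq0 // fmorph_eq0 -lead_coefE (monicP qm) oner_neq0.
have [i0 f0 hmin] := vring_min f1.
(* Divided by the dominant f i0, the other terms lie in V and add up to -1, so one of them is a
   unit. *)
have : vunit (- \sum_(i | i != i0) f i / f i0).
  move: sum0; rewrite (bigD1 i0) //= -mulr_suml => /eqP.
  rewrite addrC addr_eq0 => /eqP ->; rewrite mulNr divff // opprK; exact: vunit1.
move/vunitN; rewrite opprK => /vunit_sum [//|i ii0 ui].
have fi : f i != 0.
  by case: ui => + _ _; apply: contra_neq => ->; rewrite mul0r.
have q0 j : f j != 0 -> q`_j != 0.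
  by apply: contra_neq; rewrite /f => ->; rewrite rmorph0 mul0r.
(* The rational factor is a unit times a power of p, so only x ^ m and that power remain. *)
have key c m : c != 0 -> (0 < m)%N -> vunit (ratr c * x ^+ m) ->
    exists m (k : int), (0 < m)%N /\ vunit (x ^+ m * p%:R ^ k).
  move=> c0 m0 uc; exists m, (- ((logn p `|denq c|)%:Z - (logn p `|numq c|)%:Z)).
  split=> //; have := vunitM uc (vunitV (vunit_rat c0)).
  rewrite invfM invr_expz.
  suff -> : ratr c * x ^+ m * ((ratr c)^-1 * p%:R ^ (- ((logn p `|denq c|)%:Z - (logn p `|numq c|)%:Z)))
    = x ^+ m * p%:R ^ (- ((logn p `|denq c|)%:Z - (logn p `|numq c|)%:Z)) :> algC by [].
  by move: (_ ^ _) => P; field; rewrite fmorph_eq0.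
have ltE (a b : 'I_n) : (a < b)%N -> f a != 0 ->
    f b / f a = ratr (q`_b / q`_a) * x ^+ (b - a).
  move=> ab fa; rewrite expfB // fmorph_div /f; field.
  by rewrite expf_neq0 // fmorph_eq0 q0.
have [lt|gt|/val_inj e] := ltngtP i i0.
- apply: (key (q`_i0 / q`_i) (i0 - i)%N); rewrite ?subn_gt0 //.
    by rewrite mulf_neq0 ?invr_eq0 ?q0.
  by rewrite -ltE // -[_ / _]invrK invf_div; apply: vunitV.
- apply: (key (q`_i / q`_i0) (i - i0)%N); rewrite ?subn_gt0 //.
    by rewrite mulf_neq0 ?invr_eq0 ?q0.
  by rewrite -ltE.
- by rewrite e eqxx in ii0.
Qed.

Lemma vunit_p_exp (k : int) : vunit (p%:R ^ k) -> k = 0.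
Proof.
have aux (n : nat) : ~ vunit (p%:R ^ n.+1%:Z).
  move=> [_ _]; rewrite -exprnP => h; apply: nV.
  have -> : p%:R^-1 = p%:R ^+ n * p%:R ^- n.+1 :> algC.
    by rewrite exprS invfM mulrCA mulfV ?mulr1 // expf_neq0.
  by apply: VM => //; apply: VX.
case: k => [[|n] //|n]; first by move/aux.
by rewrite NegzE => /vunitV; rewrite invr_expz opprK => /aux.
Qed.

Variable R : realType.

(** If x ^ m * p ^ k is a unit, then |x| ^ m = |p| ^ (-k) = p ^ k. At x = 0 the set is empty and the
    default 0 is taken. *)
Definition vring_norm (x : algC) : R :=
  xget 0 [set t | x != 0 /\ exists m (k : int), [/\ (0 < m)%N,
    vunit (x ^+ m * p%:R ^ k) & t = p%:R `^ (k%:~R / m%:R)]].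

Lemma vring_normE x m (k : int) : (0 < m)%N -> vunit (x ^+ m * p%:R ^ k) ->
  vring_norm x = p%:R `^ (k%:~R / m%:R).
Proof.
move=> m0 um; have x0 : x != 0.
  case: um => + _ _; apply: contra_neq => ->; by rewrite expr0n gtn_eqF // mul0r.
rewrite /vring_norm; apply: xget_unique; first by split=> //; exists m, k.
move=> _ [_ [m' [k' [m'0 um' ->]]]].
suff e : k'%:~R / m'%:R = k%:~R / m%:R :> R by rewrite e.
have pu : (p%:R : algC) \is a GRing.unit by rewrite unitfE.
(* Raising the two units to the powers m' and m eliminates x from their quotient. *)
have : vunit (p%:R ^ (k * m'%:Z - k' * m%:Z)).
  have := vunitM (vunitX m' um) (vunitV (vunitX m um')).
  rewrite !exprMn -!exprM invfM (mulnC m') !exprnP !exprz_exp mulrACA.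
  rewrite divff ?expf_neq0 // mul1r exprzDr // -invr_expz //.
move/vunit_p_exp/eqP; rewrite subr_eq0 => /eqP kE.
apply/eqP; rewrite eqr_div ?pnatr_eq0 -?lt0n // eq_sym; apply/eqP.
by have := congr1 (fun z : int => z%:~R : R) kE; rewrite !rmorphM.
Qed.

Lemma vring_normP x : x != 0 -> exists m (k : int), [/\ (0 < m)%N,
  vunit (x ^+ m * p%:R ^ k) & vring_norm x = p%:R `^ (k%:~R / m%:R)].
Proof.
move=> /vring_root [m [k [m0 um]]]; exists m, k; split=> //; exact: vring_normE.
Qed.

Lemma vring_norm0 : vring_norm 0 = 0.
Proof. by rewrite /vring_norm; case: xgetP => // t _ [/eqP]. Qed.

Let pR0 : 0 < p%:R :> R. Proof. by rewrite ltr0n prime_gt0. Qed.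

Lemma vring_norm_gt0 x : x != 0 -> 0 < vring_norm x.
Proof. by move=> /vring_normP [m [k [_ _ ->]]]; apply: powR_gt0. Qed.

Lemma vring_norm_le1 x : V x -> vring_norm x <= 1.
Proof.
have [->|x0 Vx] := eqVneq x 0; first by rewrite vring_norm0 ler01.
have [m [k [m0 um ->]]] := vring_normP x0.
rewrite -[leRHS](powRr0 p%:R) ler_powR ?ler1n ?prime_gt0 // pmulr_lle0 ?invr_gt0 ?ltr0n //.
rewrite -[0]/(0%:~R) ler_int leNgt; apply/negP => k0; apply: nV.
case: k um k0 => // -[//|n] um _.
have [_ _ h] := um.
(* A positive k would exhibit 1/p as p ^ n * x ^ m times an inverse unit, all in V. *)
have -> : p%:R^-1 = p%:R ^+ n * (x ^+ m * (x ^+ m * p%:R ^ n.+1%:Z)^-1) :> algC.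
  by rewrite -exprnP exprS; field; rewrite p0 !expf_neq0.
by apply: VM; [apply: VX|apply: VM => //; apply: VX].
Qed.

Lemma vring_normM : {morph vring_norm : x y / x * y}.
Proof.
move=> x y; have [->|x0] := eqVneq x 0; first by rewrite mul0r vring_norm0 mul0r.
have [->|y0] := eqVneq y 0; first by rewrite mulr0 vring_norm0 mulr0.
have [m [k [m0 um ->]]] := vring_normP x0.
have [m' [k' [m'0 um' ->]]] := vring_normP y0.
have pu : (p%:R : algC) \is a GRing.unit by rewrite unitfE.
rewrite (@vring_normE _ (m * m')%N (k * m'%:Z + k' * m%:Z)) ?muln_gt0 ?m0 //; last first.
  have := vunitM (vunitX m' um) (vunitX m um').
  rewrite !exprMn -!exprM (mulnC m') !exprnP !exprz_exp mulrACA exprzDr //.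
rewrite -powRD; last by rewrite (gt_eqF pR0) implybT.
congr (_ `^ _); rewrite natrM rmorphD !rmorphM /=; field.
by rewrite !pnatr_eq0 -!lt0n m0 m'0.
Qed.

Lemma vring_norm_ultra x y :
  vring_norm (x + y) <= Num.max (vring_norm x) (vring_norm y).
Proof.
have [->|x0] := eqVneq x 0; first by rewrite add0r le_max lexx orbT.
have [->|y0] := eqVneq y 0; first by rewrite addr0 le_max lexx.
have aux a b : a != 0 -> V (b / a) -> vring_norm (a + b) <= vring_norm a.
  move=> a0 Vba; have -> : a + b = a * (1 + b / a) by field.
  rewrite vring_normM ler_piMr //; first exact/ltW/vring_norm_gt0.
  by apply: vring_norm_le1; apply: VD.
have yx0 : y / x != 0 by rewrite mulf_neq0 // invr_eq0.
rewrite le_max; case: (vring_total yx0) => h; first by rewrite aux.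
by rewrite orbC addrC aux // -invf_div.
Qed.

Lemma vring_norm_av : absolute_value vring_norm.
Proof.
have ge0 x : 0 <= vring_norm x.
  by have [->|/vring_norm_gt0/ltW //] := eqVneq x 0; rewrite vring_norm0.
split=> [//|x||x y].
- split=> [h|->]; last exact: vring_norm0.
  by apply: contraPeq h => /vring_norm_gt0 + e; rewrite e ltxx.
- exact: vring_normM.
- apply: (le_trans (vring_norm_ultra x y)).
  by rewrite ge_max lerDl lerDr !ge0.
Qed.

Lemma vring_norm_rat (c : rat) : vring_norm (ratr c) = padic_norm R p c.
Proof.
rewrite /padic_norm; have [->|c0] := eqVneq c 0; first by rewrite rmorph0 vring_norm0.
rewrite (@vring_normE _ 1%N _ _ (vunit_rat c0)) //.
by rewrite divr1 powR_intmul // ltW.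
Qed.

End PadicValuationRing.

Section ExtendedNorms.
Variable R : realType.

Lemma exists_padic_norm p : prime p -> exists w : algC -> R,
  [/\ absolute_value w, forall q : rat, w (ratr q) = padic_norm R p q & ultrametric w].
Proof.
move=> pp; have [V [sV nV maxV]] := exists_max_subring pp.
exists (vring_norm p V R); split.
- by apply: vring_norm_av.
- by apply: vring_norm_rat.
- by apply: vring_norm_ultra.
Qed.

(** Each [w b] is defined on all of algC, hence induces absolute values on every number field at
    once. As a boolean, b is true exactly when it is a [Some]. *)
Lemma exists_base_ext : exists w : option nat -> algC -> R, forall b, valid_base b ->
  [/\ absolute_value (w b), forall q : rat, w b (ratr q) = base_norm R b q
     & b -> ultrametric (w b)].
Proof.
have /choice [w hw] : forall b : option nat, exists w : algC -> R, valid_base b ->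
  [/\ absolute_value w, forall q : rat, w (ratr q) = base_norm R b q
     & b -> ultrametric w].
  case=> [p|]; last first.
    by exists (@arch_norm R) => _; split=> //; [exact: arch_norm_av|exact: arch_norm_rat].
  have [pp|npp] := boolP (prime p); last by exists (fun=> 0) => /=; rewrite (negPf npp).
  by have [w [w1 w2 w3]] := exists_padic_norm pp; exists w.
by exists w.
Qed.

End ExtendedNorms.

(** * Heights and conjugates *)

Section Embeddings.
Variables (R : realType) (F : fieldExtType rat) (v : F -> R) (w : algC -> R).
Hypotheses (av : absolute_value v) (aw : absolute_value w).

(* If [m] exceeded the local degree, a fixed linear combination of the [f i]
   would vanish on a [v]-dense subspace, hence everywhere. *)
Lemma local_degree_embeddings m (f : 'I_m -> {rmorphism F -> algC}) (x : F) :
    (forall i y, w (f i y) = v y) -> injective (fun i => f i x) ->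
  (m <= local_degree v)%N.
Proof.
move=> fv finj; have [g _ dg] := local_degreeP av.
rewrite leqNgt; apply/negP => ltm.
have [|c [i0 ci0] hc] := linear_dependence (fun i j => f i (g j)) (I := 'I_m).
  by rewrite card_ord.
(* The sum is unchanged when an element of the span of g is subtracted from y, so density would make
   it smaller than itself. *)
have D0 y : \sum_i c i * f i y = 0.
  apply/eqP; rewrite -(av_eq0 aw) eq_le av_ge0 // andbT leNgt; apply/negP => D0.
  set D := \sum_i _ in D0.
  pose C := \sum_i w (c i) + 1.
  have C0 : 0 < C by rewrite ltr_wpDl // sumr_ge0 // => i _; rewrite av_ge0.
  have [b hb] := dg y (w D / C) (divr_gt0 D0 C0).
  have DE : D = \sum_i c i * f i (y - \sum_j b j *: g j).
    under [RHS]eq_bigr => i _ do rewrite rmorphB mulrBr.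
    rewrite sumrB [X in _ - X](_ : _ = 0) ?subr0 //.
    under eq_bigr => i _ do rewrite rmorph_sum mulr_sumr.
    rewrite exchange_big big1 // => j _ /=.
    under eq_bigr => i _ do rewrite rmorphZ_num mulrCA.
    by rewrite -mulr_sumr hc mulr0.
  have : w D <= (\sum_i w (c i)) * (w D / C).
    rewrite {1}DE; apply: (le_trans (av_sum aw _ _ _)); rewrite mulr_suml.
    by apply: ler_sum => i _; rewrite (avM aw) ler_wpM2l ?(av_ge0 aw) // fv ltW.
  rewrite mulrCA ler_pMr // leNgt; apply/negP; rewrite negbK.
  by rewrite ltr_pdivrMr // mul1r ltrDl.
have P0 (P : {poly algC}) : \sum_i c i * P.[f i x] = 0.
  under eq_bigr => i _ do rewrite horner_coef mulr_sumr.
  rewrite exchange_big big1 // => k _.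
  under eq_bigr => i _ do rewrite mulrCA -rmorphXn.
  by rewrite -mulr_sumr D0 mulr0.
(* The values f i x are distinct, so this polynomial isolates the coefficient c i0. *)
have := P0 (\prod_(i | i != i0) ('X - (f i x)%:P)).
rewrite (bigD1 i0) //= [X in _ + X]big1 ?addr0; last first.
  by move=> i ii0; rewrite horner_prod (bigD1 i) //= hornerXsubC subrr mul0r mulr0.
apply/eqP; rewrite mulf_neq0 // horner_prod; apply/prodf_neq0 => i ii0.
by rewrite hornerXsubC subr_eq0; apply: contra_neq ii0 => /esym; apply: finj.
Qed.

End Embeddings.

Section NumberFieldGalois.
Variable N : splittingFieldType rat.

Lemma galois_rat (K : {subfield N}) : galois K {:N}.
Proof.
rewrite /galois subvf normalFieldf andbT; apply/separableP => y _.
rewrite -[separable_element _ _]negbK; apply/negP => /separablePn_pchar [p].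
by rewrite (fmorph_pchar (in_alg N)) pchar_num.
Qed.

Lemma mem_gal_rat (g : gal_of {:N}) : g \in 'Gal({:N} / 1)%g.
Proof. by rewrite gal_kHom ?sub1v // k1AHom. Qed.

Lemma card_gal_rat : #|'Gal({:N} / 1)%g| = \dim {:N}.
Proof. by rewrite -galois_dim ?galois_rat // dimv1 divn1. Qed.

Lemma card_gal_adjoin (a : N) :
  (#|'Gal({:N} / <<1; a>>)%g| * \dim <<1; a>> = #|'Gal({:N} / 1)%g|)%N.
Proof. by rewrite -galois_dim ?galois_rat // -dim_sup_field ?subvf // card_gal_rat. Qed.

(* The number of [g a], for [g] in [T], is the number of cosets of the
   stabilizer of [a] meeting [T]. *)
Lemma card_conj (a : N) (T : {set gal_of {:N}}) :
  exists m (f : 'I_m -> gal_of {:N}), [/\ forall i, f i \in T,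
    injective (fun i => f i a) & (#|T| <= m * #|'Gal({:N} / <<1; a>>)%g|)%N].
Proof.
pose H := 'Gal({:N} / <<1; a>>)%G.
pose C := ([set (H :* g)%g | g in T])%SET.
have /choice [f hf] : forall i : 'I_#|C|, exists g, g \in T /\ enum_val i = (H :* g)%g.
  by move=> i; have /imsetP [g gT ->] := enum_valP i; exists g.
exists #|C|, f; split=> [i|i k /= e|].
- by case: (hf i).
- apply: enum_val_inj; case: (hf i) => _ ->; case: (hf k) => _ ->.
  apply: rcoset_eqP; rewrite mem_rcoset gal_kHom ?subvf //.
  have fa : (f i * (f k)^-1)%g a = a by rewrite galM ?memvf // e -galM ?memvf // mulgV gal_id.
  apply/kAHomP => y /Fadjoin_polyP [q q1 ->].
  by rewrite -horner_map /= fa (@fixedPoly_gal _ _ 1%AS {:N}%AS) ?subvf ?mem_gal_rat.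
- have TC : T \subset finset.cover C.
    apply/fintype.subsetP => g gT; apply/finset.bigcupP; exists (H :* g)%g; last exact: rcoset_refl.
    by apply/imsetP; exists g.
  apply: (leq_trans (subset_leq_card TC)); have [+ _] := leq_card_cover C.
  move/leq_trans; apply; rewrite -sum_nat_const leq_eqVlt; apply/orP; left; apply/eqP.
  by apply: eq_bigr => A /imsetP [g _ ->]; rewrite card_rcoset.
Qed.

End NumberFieldGalois.

(** The value at 2 tells the infinite place from the primes, and the value at p tells p from other
    primes. Hence places above different b are different. *)
Lemma base_norm_inj (R : realType) b b' : valid_base b -> valid_base b' ->
  base_norm R b =1 base_norm R b' -> b = b'.
Proof.
have two : base_norm R None 2 = 2 by rewrite /= ger0_norm // ratr_nat.
have le1 p : prime p -> base_norm R (Some p) 2 <= 1 by apply: padic_norm_nat.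
case: b b' => [p|] [p'|] //= pp pp' e.
- congr Some; apply/eqP; rewrite eq_sym -dvdn_prime2 //; apply: contraT => np.
  have := e p%:R; rewrite /= padic_norm_p // /padic_norm pnatr_eq0 gtn_eqF ?prime_gt0 //.
  rewrite -[X in denq X]/(p%:Z%:~R) -[X in numq X]/(p%:Z%:~R) denq_int numq_int /=.
  rewrite logn1 lognE pp' prime_gt0 // (negPf np) subrr expr0z => /eqP.
  by rewrite invr_eq1 pnatr_eq1 => /eqP p1; move: pp; rewrite p1.
- by have := le1 p pp; rewrite e two lern1.
- by have := le1 p' pp'; rewrite -e two lern1.
Qed.

Section HeightConjugates.
Variables (R : realType) (w : option nat -> algC -> R).
Hypothesis w_ext : forall b, valid_base b ->
  [/\ absolute_value (w b), forall q : rat, w b (ratr q) = base_norm R b q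
     & b -> ultrametric (w b)].
Variables (N : splittingFieldType rat) (NC : {rmorphism N -> algC}).

(** Every place of N above b is induced by some [w b \o NC \o g], so this is the part above b of the
    height of a raised to the order of the group. *)
Definition conj_height b (a : N) : R :=
  \prod_(g in 'Gal({:N} / 1)%g) Num.max 1 (w b (NC (g a))).

(** Group the g by the absolute value u that they induce on F = Q(a). By [local_degree_embeddings]
    the proportion inducing u is at most the local degree over the dimension of F, the exponent of u
    in the height. *)
Lemma conj_height_ge (a : N) (S : seq (option nat)) : uniq S ->
    (forall b, b \in S -> valid_base b) ->
  \prod_(b <- S) conj_height b a <= weil_height R (NC a) ^+ #|'Gal({:N} / 1)%g|.
Proof.
move=> uS vS; have [F [FC [x [xa xgen ->]]]] := weil_heightE R (NC a).
(* F is generated by x, whose image is NC a, so F embeds in N compatibly with algC; composition with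
   the Galois group gives the embeddings f g. *)
have /choice [j jP] : forall y : F, exists z : N, NC z = FC y.
  move=> y; have : y \in <<1; x>>%VS by rewrite xgen memvf.
  case/Fadjoin_polyP => _ /polyOver1P [q ->] ->; exists (map_poly (in_alg N) q).[a].
  rewrite -!horner_map xa -!map_poly_comp; congr _.[_].
  by apply: eq_map_poly => c /=; rewrite !rmorphZ_num !rmorph1.
have ja : zmod_morphism j.
  by move=> y z; apply: (fmorph_inj NC); rewrite !(jP, rmorphB).
have jm : monoid_morphism j.
  split=> [|y z]; apply: (fmorph_inj NC); rewrite ?jP ?rmorph1 //.
  by rewrite !rmorphM /= !jP.
pose jaM := GRing.isZmodMorphism.Build F N j ja.
pose jmM := GRing.isMonoidMorphism.Build F N j jm.
pose J : {rmorphism F -> N} := HB.pack j jaM jmM.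
have jx : j x = a by apply: (fmorph_inj NC); rewrite jP.
pose f (g : gal_of {:N}) : {rmorphism F -> algC} := NC \o g \o J.
have fx g : f g x = NC (g a) by rewrite /= jx.
pose v b g := w b \o f g.
have vP b g : valid_base b -> av_over (base_norm R b) (v b g).
  move=> vb; have [aw wq _] := w_ext vb; split; first exact: av_comp.
  by move=> q; rewrite -wq /v /=; congr (w b _); rewrite -[LHS]/(f g q%:A) (rmorphZ_num (f g)) rmorph1 mulr1.
have leF : (\dim {:F} <= \dim <<1; a>>)%N.
  rewrite -xgen !dim_Fadjoin !dimv1 !muln1 -ltnS -!size_minPoly.
  have /polyOver1P [q qE] := minPolyOver 1%AS a.
  have qx : root (map_poly (in_alg F) q) x.
    rewrite -(fmorph_root J) (jx : J x = a) -map_poly_comp.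
    rewrite (_ : map_poly _ q = minPoly 1 a) ?root_minPoly // qE.
    by apply: eq_map_poly => c /=; rewrite -(rmorph1 J) -[RHS](fmorph_numZ J).
  have q1 : map_poly (in_alg F) q \is a polyOver 1%VS by apply/polyOver1P; exists q.
  have := minPoly_dvdp q1 qx; move/dvdp_leq; rewrite size_map_poly.
  rewrite qE size_map_poly; apply; rewrite map_poly_eq0.
  by rewrite -(map_poly_eq0 (in_alg N)) -qE monic_neq0 // monic_minPoly.
pose G := 'Gal({:N} / 1)%g.
pose T b u := ([set g in G | v b g == u])%SET.
(* At most [local_degree u] conjugates of a come from [T b u], and each is attained on one coset of
   the stabilizer of a. *)
have cardT b u : valid_base b -> absolute_value u ->
    (#|T b u| * \dim {:F} <= local_degree u * #|G|)%N.
  move=> vb au; have [m [f' [f'T f'inj le]]] := card_conj a (T b u).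
  have lem : (m <= local_degree u)%N.
    have [aw _ _] := w_ext vb.
    apply: (@local_degree_embeddings R F u (w b) au aw m (fun i => f (f' i)) x).
      by move=> i y; have := f'T i; rewrite inE => /andP [_ /eqP <-].
    by move=> i k; rewrite !fx => /fmorph_inj; apply: f'inj.
  apply: (leq_trans (leq_mul le leF)).
  by rewrite -mulnA card_gal_adjoin leq_mul2r lem orbT.
pose V b := undup [seq v b g | g <- enum G].
have Vover b u : valid_base b -> u \in V b -> av_over (base_norm R b) u.
  by move=> vb; rewrite mem_undup => /mapP [g _ ->]; apply: vP.
have step b : valid_base b ->
    conj_height b a <= \prod_(u <- V b) local_height u x ^+ #|G|.
  move=> vb; have -> : conj_height b a = \prod_(u <- V b) Num.max 1 (u x) ^+ #|T b u|.
    transitivity (\prod_(g in G) \prod_(u <- V b) if v b g == u then Num.max 1 (u x) else 1).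
      apply: eq_bigr => g gG; rewrite -big_mkcond /= -big_filter.
      rewrite (_ : seq.filter _ _ = [:: v b g]); first by rewrite big_seq1 /v /= jx.
      have vV : v b g \in V b by rewrite mem_undup; apply: map_f; rewrite mem_enum.
      rewrite -(filter_pred1_uniq (undup_uniq _) vV).
      by apply: eq_filter => u; rewrite /= eq_sym.
    rewrite exchange_big; apply: eq_bigr => u _.
    rewrite -prodr_const [RHS](eq_bigl (fun g => (g \in G) && (v b g == u))).
      by rewrite [RHS]big_mkcondr.
    by move=> g; rewrite inE.
  rewrite big_seq [leRHS]big_seq; apply: ler_prod => u /(Vover _ _ vb) [au _].
  have M1 : 1 <= Num.max 1 (u x) by rewrite le_max lexx.
  have M0 : 0 <= Num.max 1 (u x) by rewrite (le_trans ler01).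
  rewrite exprn_ge0 //= /local_height -[leLHS]powR_mulrn // -[leRHS]powR_mulrn ?powR_ge0 //.
  rewrite -powRrM ler_powR // mulrAC ler_pdivlMr ?ltr0n ?adim_gt0 //.
  by rewrite -!natrM ler_nat cardT.
pose s := flatten [seq V b | b <- S].
(* The lists for different b are disjoint, since u determines its restriction to Q and hence b. *)
have us : uniq s.
  rewrite /s; elim: S uS vS {s} => [|b S IH] //= /andP [bS uS] vS.
  rewrite cat_uniq undup_uniq IH //=; last by move=> b' b'S; rewrite vS // in_cons b'S orbT.
  rewrite andbT; apply/hasPn => u /flatten_mapP [b' b'S ub']; apply/negP => ub.
  have vb : valid_base b by rewrite vS // mem_head.
  have vb' : valid_base b' by rewrite vS // in_cons b'S orbT.
  have [_ h] := Vover _ _ vb ub; have [_ h'] := Vover _ _ vb' ub'.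
  have e : b = b' by apply: (@base_norm_inj R _ _ vb vb') => q; rewrite -h -h'.
  by rewrite e b'S in bS.
have sp u : u \in s -> places u.
  case/flatten_mapP => b bS ub; apply/placesP; exists b; first exact: vS.
  exact: Vover (vS b bS) ub.
apply: (@le_trans _ _ (\prod_(u <- s) local_height u x ^+ #|G|)).
  rewrite /s big_flatten big_map big_seq [leRHS]big_seq; apply: ler_prod => b bS.
  rewrite step ?vS // andbT prodr_ge0 // => g _.
  by rewrite le_max ler01.
have P0 : 0 <= \prod_(u <- s) local_height u x.
  by apply: prodr_ge0 => u _; apply: powR_ge0.
by rewrite prodrXl lerXn2r ?nnegrE ?field_height_ge // (le_trans P0) ?field_height_ge.
Qed.

End HeightConjugates.

Lemma prod_logn n (S : seq nat) : (0 < n)%N -> uniq S ->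
  {subset primes n <= S} -> (\prod_(q <- S) q ^ logn q n)%N = n.
Proof.
move=> n0 uS sub; rewrite (bigID (mem (primes n))) /= [X in (_ * X)%N]big1 ?muln1; last first.
  move=> q; rewrite mem_primes n0 /= => nq; rewrite lognE n0 /=.
  by move: nq; case: prime => //= /negPf ->.
rewrite -big_filter [RHS](prod_prime_decomp n0) prime_decompE big_map /=.
apply: perm_big; apply: uniq_perm; rewrite ?filter_uniq ?primes_uniq //.
by move=> q; rewrite mem_filter /= andb_idr //; apply: sub.
Qed.

(** * Northcott's theorem for number fields *)

Section ProductFormula.
Variable R : realType.

(** Product formula on Q, cut down to a finite S outside of which all factors are 1. *)
Lemma prod_base_norm (z : rat) (S : seq nat) : z != 0 -> uniq S ->
    (forall q, q \in S -> prime q) ->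
    {subset primes `|numq z| <= S} -> {subset primes `|denq z| <= S} ->
  \prod_(b <- None :: [seq Some q | q <- S]) base_norm R b z = 1.
Proof.
move=> z0 uS pS nS dS; rewrite big_cons big_map /=.
have n0 : (0 < `|numq z|)%N by rewrite absz_gt0 numq_eq0.
have d0 : (0 < `|denq z|)%N by rewrite absz_gt0 denq_neq0.
have -> : \prod_(q <- S) padic_norm R q z = (`|denq z|%N)%:R / (`|numq z|%N)%:R.
  rewrite -{1}(prod_logn d0 uS dS) -{1}(prod_logn n0 uS nS) !natr_prod -prodf_div.
  apply: eq_big_seq => q /pS pq; rewrite /padic_norm (negPf z0).
  rewrite exprzDr ?unitfE ?pnatr_eq0 ?gtn_eqF ?prime_gt0 // -invr_expz.
  by rewrite -!exprnP !natrX.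
rewrite -[z in `|z|]divq_num_den normrM normfV -!intr_norm fmorph_div /= !ratr_int.
have a0 : (`|numq z|%N)%:R != 0 :> R by rewrite pnatr_eq0 -lt0n.
have b0 : (`|denq z|%N)%:R != 0 :> R by rewrite pnatr_eq0 -lt0n.
by rewrite -!abszE -!pmulrn; field; rewrite a0 b0.
Qed.

Lemma prod_padic_den (z : rat) : z != 0 ->
  \prod_(q <- primes `|denq z|) padic_norm R q z = (`|denq z|%N)%:R.
Proof.
move=> z0; have d0 : (0 < `|denq z|)%N by rewrite absz_gt0 denq_neq0.
rewrite -{2}(prod_logn d0 (primes_uniq _) (fun x h => h)) natr_prod.
apply: eq_big_seq => q; rewrite mem_primes => /and3P [pq _ qd].
rewrite /padic_norm (negPf z0) (logn_coprime (m := `|numq z|)) ?subr0 -?exprnP ?natrX //.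
by apply: coprime_dvdl qd _; rewrite coprime_sym coprime_num_den.
Qed.

End ProductFormula.

Section Northcott.
Variables (R : realType) (w : option nat -> algC -> R).
Hypothesis w_ext : forall b, valid_base b ->
  [/\ absolute_value (w b), forall q : rat, w b (ratr q) = base_norm R b q
     & b -> ultrametric (w b)].

(** Constant of the triangle inequality stated with a maximum; finite and infinite places can then
    share their estimates. *)
Definition base_const (b : option nat) : R := if b is Some _ then 1 else 2.

Lemma base_const_gt0 b : 0 < base_const b.
Proof. by case: b. Qed.

Lemma base_sub b x y : valid_base b ->
  w b (x - y) <= base_const b * Num.max (w b x) (w b y).
Proof.
move=> /w_ext [aw _]; case: b aw => [p|] aw uw; rewrite /base_const.
  by rewrite mul1r -(avN aw y); apply: uw.
apply: (le_trans (avB aw x y)); rewrite mulr_natl mulr2n.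
by rewrite lerD // le_max lexx ?orbT.
Qed.

(** A factor X - y makes each coefficient a difference of two terms, at the cost of [base_const b]
    and of the maximum of 1 and |y|. *)
Lemma base_coef_prod b (I : Type) (s : seq I) (y : I -> algC) i : valid_base b ->
  w b (\prod_(k <- s) ('X - (y k)%:P))`_i
  <= base_const b ^+ size s * \prod_(k <- s) Num.max 1 (w b (y k)).
Proof.
move=> vb; have [aw _ _] := w_ext vb; have c0 := base_const_gt0 b.
elim: s i => [|k s IH] i.
  by rewrite !big_nil expr0 mul1r coef1; case: eqP; rewrite ?av1 ?av0.
rewrite !big_cons mulrBl coefB coefXM coefCM.
set P := \prod_(k <- s) _; set B := base_const b ^+ size s * \prod_(k <- s) Num.max 1 (w b (y k)).
have B0 : 0 <= B by rewrite (le_trans _ (IH 0%N)) ?(av_ge0 aw).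
rewrite [leRHS](_ : _ = base_const b * (Num.max 1 (w b (y k)) * B)); last first.
  by rewrite /B /= exprS; ring.
apply: (le_trans (base_sub _ _ vb)); rewrite ler_pM2l // ge_max; apply/andP; split.
  apply: (@le_trans _ _ B); last by rewrite ler_peMl // le_max lexx.
  by case: eqP => _; rewrite ?(av0 aw) //; apply: IH.
by rewrite (avM aw) ler_pM ?(av_ge0 aw) ?le_max ?lexx ?orbT //; apply: IH.
Qed.

Variables (N : splittingFieldType rat) (NC : {rmorphism N -> algC}).
Local Notation G := ('Gal({:N} / 1)%g).
Local Notation conj_height := (conj_height w NC).

Lemma conj_height_ge1 b a : 1 <= conj_height b a.
Proof.
apply: (big_ind (fun x => 1 <= x)) => // [x y|g _]; first exact: mulr_ege1.
by rewrite le_max lexx.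
Qed.

Lemma weil_height_ge1 alpha : 1 <= weil_height R alpha.
Proof.
have [F [FC [a [_ _ ->]]]] := weil_heightE R alpha.
by have := @field_height_ge R F a [::] isT; rewrite big_nil; apply.
Qed.

Lemma gal_charpoly_rat (a : N) : exists q : {poly rat},
  \prod_(g in G) ('X - (g a)%:P) = map_poly (in_alg N) q.
Proof.
apply/polyOver1P; apply/polyOverP => i.
suff : (\prod_(g in G) ('X - (g a)%:P))`_i \in fixedField G.
  by have /galois_fixedField -> := galois_rat (1%AS : {subfield N}).
apply/fixedFieldP; first exact: memvf.
move=> h hG; rewrite -coef_map; congr (polyseq _)`_i; rewrite rmorph_prod /=.
rewrite [RHS](reindex_inj (mulIg h)) /=.
rewrite [RHS](eq_bigl (fun g => g \in G)) => [|g]; last by rewrite groupMr.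
by apply: eq_bigr => g _; rewrite map_polyXsubC galM ?memvf.
Qed.

Lemma charpoly_coef_base (a : N) (q : {poly rat}) b i :
    \prod_(g in G) ('X - (g a)%:P) = map_poly (in_alg N) q -> valid_base b ->
  base_norm R b q`_i <= base_const b ^+ #|G| * conj_height b a.
Proof.
move=> qE vb; have [_ wq _] := w_ext vb.
have -> : base_norm R b q`_i = w b (\prod_(y <- [seq NC ((g : gal_of {:N}) a) | g <- enum G]) ('X - y%:P))`_i.
  rewrite -wq; congr (w b _).
  have := congr1 (fun P => (map_poly NC P)`_i) qE.
  rewrite [X in _ = X -> _]coef_map [in X in _ = X -> _]coef_map /= rmorphZ_num rmorph1 mulr1 => <-.
  rewrite rmorph_prod /= big_map big_enum /=; congr (polyseq _)`_i.
  by apply: eq_bigr => g _; rewrite map_polyXsubC.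
apply: (le_trans (base_coef_prod _ id _ vb)).
by rewrite big_map big_enum size_map -cardE.
Qed.

Lemma finite_rat_height (M : nat) :
  finite_set [set c : rat | (`|numq c| <= M)%N /\ (`|denq c| <= M)%N].
Proof.
pose f (x : 'I_M.+1 * 'I_M.+1 * bool) : rat :=
  (-1) ^+ x.2 * (x.1.1 : nat)%:R / (x.1.2 : nat)%:R.
apply: (@sub_finite_set _ _ (range f)); last first.
  apply: finite_image; apply: sub_finite_set (finite_finpred predT) => //.
move=> c /= [nc dc]; exists (inord `|numq c|, inord `|denq c|, numq c < 0) => //.
rewrite /f /= !inordK ?ltnS // -[RHS]divq_num_den.
rewrite -[in RHS](absz_denq c) [in RHS](intEsign (numq c)).
by rewrite rmorphM rmorph_sign.
Qed.

Lemma finite_rat_poly (n : nat) (A : set rat) : finite_set A ->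
  finite_set [set q : {poly rat} | (size q <= n)%N /\ forall i, A q`_i].
Proof.
move=> /finite_seqP [s ->].
pose f (h : {ffun 'I_n -> seq_sub s}) : {poly rat} :=
  \poly_(i < n) (if insub i is Some k then val (h k) else 0).
apply: (@sub_finite_set _ _ (range f)); last first.
  apply: finite_image; apply: sub_finite_set (finite_finpred predT) => //.
move=> q [sq qs]; exists [ffun i : 'I_n => SeqSub (qs i)] => //.
apply/polyP => i; rewrite coef_poly; case: ltnP => [lt|le]; last first.
  by rewrite nth_default // (leq_trans sq).
by rewrite insubT /= ffunE.
Qed.

Lemma finite_roots (K : fieldType) (P : {poly K}) : P != 0 ->
  finite_set [set x | root P x].
Proof.
move=> P0; apply: contrapT => /(infinite_set_fset (size P)) [B BP].
apply/negP; rewrite -ltnNge; apply: max_poly_roots => //; last exact: finmap.fset_uniq.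
by apply/allP => x xB; apply: BP.
Qed.

(** Every a is a root of its characteristic polynomial over Q, of fixed degree and with coefficients
    of bounded numerator and denominator. *)
Lemma northcott_number_field (X : R) :
  finite_set [set a : N | weil_height R (NC a) <= X].
Proof.
(* Y bounds every product of conjugate heights over distinct b; the factor 2 ^+ #|G| in M comes from
   the infinite place. *)
pose Y := Num.max 1 X ^+ #|G|.
pose M := Num.truncn (2 ^+ #|G| * Y).
have Y1 : 1 <= Y by rewrite exprn_ege1 // le_max lexx.
have Ybound a (S : seq (option nat)) : weil_height R (NC a) <= X -> uniq S ->
    (forall b, b \in S -> valid_base b) -> \prod_(b <- S) conj_height b a <= Y.
  move=> aX uS vS; apply: (le_trans (conj_height_ge w_ext NC a uS vS)).
  rewrite lerXn2r ?nnegrE ?le_max ?ler01 ?aX ?orbT //.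
  exact: le_trans (weil_height_ge1 _).
pose A := [set c : rat | (`|numq c| <= M)%N /\ (`|denq c| <= M)%N].
pose Q := [set q : {poly rat} | (size q <= #|G|.+1)%N /\ forall i, A q`_i].
have finQ : finite_set Q by apply: finite_rat_poly; apply: finite_rat_height.
apply: (@sub_finite_set _ _ (\bigcup_(q in Q) [set a : N |
    map_poly (in_alg N) q != 0 /\ root (map_poly (in_alg N) q) a])); last first.
  apply: bigcup_finite => // q _.
  have [->|q0] := eqVneq (map_poly (in_alg N) q) 0.
    by rewrite (_ : [set _ | _] = set0) //; apply/seteqP; split=> // a [].
  apply: sub_finite_set (finite_roots q0) => a [].
  by [].
move=> a /= aX; have [q qE] := gal_charpoly_rat a; exists q; last first.
  split=> /=; rewrite -qE; first by rewrite monic_neq0 // monic_prod_XsubC.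
  rewrite (bigD1 1%g) ?group1 //= gal_id rootM root_XsubC eqxx //.
have sq : size q = #|G|.+1.
  rewrite -(size_map_poly (in_alg N)) -qE.
  by rewrite -big_enum /= size_prod_XsubC -cardE.
split; first by rewrite sq.
have G2 : 1 <= 2 ^+ #|G| :> R by rewrite exprn_ege1 // ler1n.
(* This covers zero coefficients, whose denominator is 1. *)
have M1 : (0 < M)%N by rewrite /M truncn_gt0 mulr_ege1.
move=> i; have [->|c0] := eqVneq q`_i 0; first by [].
set c := q`_i in c0 *; pose D := primes `|denq c|.
have pD p : p \in D -> prime p by rewrite mem_primes => /andP [].
have uD : uniq [seq Some p | p <- D].
  by rewrite map_inj_uniq ?primes_uniq // => x y [].
have vD b : b \in [seq Some p | p <- D] -> valid_base b.
  by move=> /mapP [p /pD pp ->].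
have denE : (`|denq c|%N)%:R = \prod_(b <- [seq Some p | p <- D]) base_norm R b c.
  by rewrite big_map /= prod_padic_den.
have denle : (`|denq c|%N)%:R <= \prod_(b <- [seq Some p | p <- D]) conj_height b a.
  rewrite denE big_seq [leRHS]big_seq; apply: ler_prod => b bD.
  have [aw wq _] := w_ext (vD b bD); rewrite -wq (av_ge0 aw) /= wq.
  have := charpoly_coef_base i qE (vD b bD); rewrite -/c.
  by case/mapP: bD => p _ ->; rewrite /= expr1n mul1r.
have d2 : (`|denq c|%N)%:R <= Y by apply: (le_trans denle); apply: Ybound.
(* The numerator is the size at infinity times the denominator. Both are bounded within a single
   product of conjugate heights, so Y enters only once. *)
have n2 : (`|numq c|%N)%:R <= 2 ^+ #|G| * Y.
  have -> : (`|numq c|%N)%:R = base_norm R None c * (`|denq c|%N)%:R.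
    have d0 : (0 < `|denq c|)%N by rewrite absz_gt0 denq_neq0.
    rewrite /= -[c in `|c|]divq_num_den normrM normfV -!intr_norm fmorph_div /= !ratr_int.
    rewrite -!abszE -!pmulrn divfK // pnatr_eq0 -lt0n //.
  apply: (@le_trans _ _ (2 ^+ #|G| * conj_height None a * \prod_(b <- [seq Some p | p <- D]) conj_height b a)).
    rewrite ler_pM ?ler0n //=; first by rewrite ler0q.
    exact: (charpoly_coef_base i qE (isT : valid_base None)).
  rewrite -mulrA ler_wpM2l ?exprn_ge0 //.
  have := Ybound a (None :: [seq Some p | p <- D]) aX; rewrite big_cons; apply.
    by rewrite /= uD andbT; apply/mapP => -[].
  by move=> b; rewrite in_cons => /orP [/eqP -> //|]; apply: vD.
have Y0 : 0 <= Y by rewrite (le_trans _ Y1).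
have P0 : 0 <= 2 ^+ #|G| * Y by rewrite mulr_ge0 // (le_trans _ G2).
split; rewrite /M truncn_ge_nat //.
by apply: (le_trans d2); rewrite ler_peMl.
Qed.

End Northcott.

(** * Ramification *)

Lemma lagrange_interpolation (K : fieldType) n (b : 'I_n -> K) (P : {poly K}) :
    injective b -> (size P <= n)%N ->
  P = \sum_i (P.[b i] / \prod_(j in predC1 i) (b i - b j)) *:
        \prod_(j in predC1 i) ('X - (b j)%:P).
Proof.
move=> binj sP; apply/eqP; rewrite -subr_eq0; apply/eqP.
apply: (@roots_geq_poly_eq0 _ _ [seq b i | i <- enum 'I_n]); last first.
- rewrite size_map size_enum_ord (leq_trans (size_polyD _ _)) // geq_max sP size_polyN.
  apply: (leq_trans (size_sum _ _ _)); apply/bigmax_leqP => i _.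
  apply: (leq_trans (size_scale_leq _ _)).
  by rewrite -big_enum /= size_prod_XsubC -cardE cardC1 card_ord prednK // (leq_ltn_trans _ (ltn_ord i)).
- by rewrite map_inj_uniq ?enum_uniq.
apply/allP => _ /mapP [k _ ->]; apply/rootP; rewrite hornerD hornerN horner_sum.
rewrite (bigD1 k) //= [X in _ - (_ + X)]big1 ?addr0; last first.
  move=> i ik; rewrite hornerZ; apply/eqP; rewrite mulf_eq0; apply/orP; right.
  rewrite horner_prod (bigD1 k) /=; last by rewrite inE eq_sym.
  by rewrite hornerXsubC subrr mul0r.
rewrite hornerZ horner_prod.
under [X in _ - _ / _ * X]eq_bigr => j _ do rewrite hornerXsubC.
rewrite divfK ?subrr //; apply/prodf_neq0 => j; rewrite inE => jk.
by rewrite subr_eq0; apply: contra_neq jk => /binj.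
Qed.

Lemma ultrametric_sum_lt (R : realType) (F : fieldType) (v : F -> R) (I : Type)
    (s : seq I) (P : pred I) (f : I -> F) (B : R) :
    absolute_value v -> ultrametric v -> 0 < B -> (forall i, P i -> v (f i) < B) ->
  v (\sum_(i <- s | P i) f i) < B.
Proof.
move=> av uv B0 h; apply: (big_ind (fun x => v x < B)) => //; first by rewrite av0.
by move=> x y hx hy; apply: (le_lt_trans (uv x y)); rewrite gt_max hx hy.
Qed.

Lemma exprz_reduce (R : realType) (a t : R) : 1 < a -> 0 < t ->
  exists k : int, a^-1 <= t * a ^ k < 1.
Proof.
move=> a1 t0; have a0 : 0 < a by apply: lt_trans a1.
have l0 : 0 < ln a by rewrite ln_gt0.
pose k := - Num.floor (ln t / ln a) - 1; exists k.
have ak : 0 < a ^ k by rewrite exprz_gt0.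
have k1 : k%:~R * ln a = - (Num.floor (ln t / ln a))%:~R * ln a - ln a.
  by rewrite /k rmorphB rmorphN /= mulrBl mul1r.
have f1 : (Num.floor (ln t / ln a))%:~R * ln a <= ln t.
  by rewrite -ler_pdivlMr // floor_le.
have f2 : ln t < (Num.floor (ln t / ln a))%:~R * ln a + ln a.
  by rewrite -[X in _ + X]mul1r -mulrDl -ltr_pdivrMr // -intrD1 floorD1_gt.
rewrite -ler_ln ?posrE ?invr_gt0 ?mulr_gt0 // -ltr_ln ?posrE ?mulr_gt0 //.
rewrite lnV ?posrE // ln1 lnM ?posrE // ln_exprz //.
move: k1 f1 f2; rewrite mulNr.
move: (ln a) (ln t) ((Num.floor _)%:~R * ln a) (k%:~R * ln a).
by move=> A B C D; clear; lra.
Qed.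

(** Terms a * r ^+ k with a in an unramified field have valuations congruent to k modulo d, in units
    of 1/d; equal valuations thus force equal k. *)
Lemma int_residue (d k l : nat) (m n : int) : (k < d)%N -> (l < d)%N ->
  k%:Z - d%:Z * m = l%:Z - d%:Z * n -> k = l.
Proof.
move=> kd ld /(congr1 (fun x => (x %% d)%Z)).
rewrite -!mulrN !(mulrC d%:Z) !(addrC _ (_ * d%:Z)) !modzMDl !modz_small //.
by case.
Qed.

Section Ramification.
Variables (R : realType) (w : option nat -> algC -> R).
Hypothesis w_ext : forall b, valid_base b ->
  [/\ absolute_value (w b), forall q : rat, w b (ratr q) = base_norm R b q
     & b -> ultrametric (w b)].
Variables (N : splittingFieldType rat) (NC : {rmorphism N -> algC}).
Local Notation G := ('Gal({:N} / 1)%g).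
Variable p : nat.
Hypothesis p_prime : prime p.

Let vb : valid_base (Some p). Proof. exact: p_prime. Qed.
Let W (h : gal_of {:N}) (y : N) : R := w (Some p) (NC (h y)).
Let aw : absolute_value (w (Some p)). Proof. by case: (w_ext vb). Qed.
Let uw : ultrametric (w (Some p)). Proof. by case: (w_ext vb) => _ _; apply. Qed.
Let aW h : absolute_value (W h). Proof. exact: (av_comp aw ((NC \o h) : {rmorphism N -> algC})). Qed.
Let uW h : ultrametric (W h).
Proof. by move=> x y; rewrite /W !rmorphD; apply: uw. Qed.
Let WM (h g : gal_of {:N}) y : W h (g y) = W (g * h)%g y.
Proof. by rewrite /W galM ?memvf. Qed.
Let Wrat h (c : rat) : W h c%:A = base_norm R (Some p) c.
Proof.
have [_ <- _] := w_ext vb; congr (w _ _).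
by rewrite linearZ /= rmorph1 rmorphZ_num rmorph1 mulr1.
Qed.
Let p1 : 1 < p%:R :> R. Proof. by rewrite ltr1n prime_gt1. Qed.
Let p0 : 0 < p%:R :> R. Proof. by rewrite ltr0n prime_gt0. Qed.
Let Wp h : W h p%:R = p%:R^-1.
Proof. by rewrite -scaler_nat Wrat /= padic_norm_p. Qed.

(* [p] is unramified in [M]: all places of [M] above [p] are induced by the
   maps [w (Some p) \o NC \o h]. *)
Definition unramified (M : {subfield N}) := forall (h : gal_of {:N}) (y : N),
  y \in M -> y != 0 -> exists k : int, w (Some p) (NC (h y)) = p%:R ^ k.

Lemma unramified1 : unramified 1%AS.
Proof.
move=> h y /vlineP [c ->]; rewrite scaler_eq0 oner_eq0 orbF => c0.
have := Wrat h c; rewrite /W => ->; rewrite /= /padic_norm (negPf c0).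
by eexists.
Qed.

Lemma unramified_sub (M M' : {subfield N}) :
  (M <= M')%VS -> unramified M' -> unramified M.
Proof. by move=> /subvP s u h y yM; apply: u; apply: s. Qed.

Lemma unramified_small (M : {subfield N}) h y : unramified M -> y \in M ->
  W h y < 1 -> W h y <= p%:R^-1.
Proof.
move=> uM yM; have [->|y0] := eqVneq y 0.
  by rewrite (av0 (aW h)) invr_ge0 ltW.
have [k] := uM h y yM y0; rewrite -/(W h y) => ->.
case: k => k; first by rewrite -exprnP => /lt_geF; rewrite exprn_ege1 // ltW.
move=> _; rewrite NegzE -exprnN lef_pV2 ?posrE ?exprn_gt0 //.
by rewrite ler_eXnr // ltW.
Qed.

(* By Lagrange interpolation, the coefficients of [y] in the basis of powers
   of [beta] have absolute value less than 1, hence at most [1 / p]. *)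
Lemma small_adjoin (M : {subfield N}) (beta : N) : unramified M ->
    (forall h : gal_of {:N}, w (Some p) (NC (h beta)) <= 1) ->
    (forall h g : gal_of {:N}, h beta != g beta -> w (Some p) (NC (h beta - g beta)) = 1) ->
  forall y, y \in << M; beta >>%VS -> (forall h, W h y < 1) ->
  forall h, W h y <= p%:R^-1.
Proof.
move=> uM b1 bdiff y yM y1 h.
(* The automorphisms s i take beta to the distinct roots of its minimal polynomial over M. *)
have /galois_factors/(_ beta (memvf _)) [|r [rG ur rE]] := galois_rat M.
  exact: subvf.
set P := Fadjoin_poly M beta y.
have PM : P \is a polyOver M by apply: Fadjoin_polyOver.
have Py : P.[beta] = y by apply: Fadjoin_poly_eq.
have sP : (size P <= size r)%N.
  apply: leq_trans (size_Fadjoin_poly _ _ _) _.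
  by rewrite -ltnS -size_minPoly rE size_prod_XsubC size_map.
pose s (i : 'I_(size r)) := nth 1%g r i.
have sM i : s i \in 'Gal({:N} / M)%g.
  by apply: (fintype.subsetP rG); apply: mem_nth.
have binj : injective (fun i => s i beta).
  move=> i j e; apply: val_inj; apply: (uniqP 0 ur); rewrite ?inE ?size_map ?ltn_ord //.
  by rewrite !(nth_map 1%g 0) ?ltn_ord.
have Ps i : P.[s i beta] = s i y.
  by rewrite -[in RHS]Py -horner_map /= (fixedPoly_gal (subvf M) (sM i) PM).
have PE := lagrange_interpolation binj sP.
have cM k : P`_k \in M by apply: (polyOverP PM).
(* Differences of nodes have absolute value 1. The values at the nodes are the conjugates s i y,
   whose size at h is that of y at s i * h; so smallness at all places enters. *)
have c1 k : W h P`_k < 1.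
  rewrite [X in polyseq X]PE coef_sum; apply: ultrametric_sum_lt => // i _.
  rewrite coefZ Ps (avM (aW h)) (avM (aW h)) (avV (aW h)) (av_prod (aW h)).
  rewrite big1 ?invr1 ?mulr1; last first.
    move=> j; rewrite inE => ji; rewrite /W rmorphB /= -!galM ?memvf // bdiff //.
    rewrite !galM ?memvf // (inj_eq (fmorph_inj h)).
    by apply: contra_neq ji => /binj.
  rewrite WM mulrC; apply: le_lt_trans (y1 (s i * h)%g).
  rewrite ler_piMl ?av_ge0 //.
  set Q := \prod_(j in _) _.
  have -> : W h Q`_k = w (Some p) (\prod_(j <- enum (predC1 i)) ('X - (NC (h (s j beta)))%:P))`_k.
    rewrite /W -!coef_map /Q; congr (w _ (polyseq _)`_k).
    rewrite big_enum !rmorph_prod; apply: eq_bigr => j _.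
    by rewrite /= !map_polyXsubC.
  apply: (le_trans (base_coef_prod w_ext _ _ _ vb)); rewrite expr1n mul1r big1 // => j _.
  by apply/max_idPl; rewrite -galM ?memvf.
rewrite -Py horner_coef; apply: ultrametric_sum => // k _.
rewrite (avM (aW h)) (avX (aW h)) -[leRHS]mulr1.
rewrite ler_pM ?exprn_ge0 ?(av_ge0 (aW h)) ?exprn_ile1 ?(av_ge0 (aW h)) //.
  exact: (unramified_small uM (cM k) (c1 k)).
exact: b1.
Qed.

(* Weak approximation multiplies an element of absolute value strictly between
   [1 / p] and 1 at one place into an element that is small at all of them. *)
Lemma unramified_adjoin (M : {subfield N}) (beta : N) : unramified M ->
    (forall h : gal_of {:N}, w (Some p) (NC (h beta)) <= 1) ->
    (forall h g : gal_of {:N}, h beta != g beta -> w (Some p) (NC (h beta - g beta)) = 1) ->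
  unramified << M; beta >>%AS.
Proof.
move=> uM b1 bdiff h0 y yM y0; apply: contrapT => nk.
have small := small_adjoin uM b1 bdiff.
set M' := << M; beta >>%AS in yM small *.
have t0 : 0 < W h0 y by rewrite av_gt0.
have [k /andP [k1 k2]] := exprz_reduce p1 t0.
(* Since W h0 y is no power of p, this scaling puts it strictly between 1/p and 1. *)
pose y' := y * (p%:R ^ (- k)).
have y'M : y' \in M'.
  apply: memvM => //; case: (- k) => n; first by rewrite -exprnP rpredX // rpred_nat.
  by rewrite NegzE -exprnN rpredV rpredX // rpred_nat.
have Wy' : W h0 y' = W h0 y * p%:R ^ k.
  by rewrite (avM (aW h0)) (avXz _ _ (aW h0)) Wp exprz_inv opprK.
have y'1 : W h0 y' < 1 by rewrite Wy'.
have y'p : p%:R^-1 < W h0 y'.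
  rewrite lt_def Wy' k1 andbT; apply/eqP => e; apply: nk; exists (-1 - k).
  rewrite -/(W h0 y); apply: (@mulIf _ (p%:R ^ k)).
    by rewrite expfz_neq0 // gt_eqF.
  by rewrite e -exprzDr ?unitfE ?gt_eqF // subrK exprN1.
pose V h (z : subvs_of M') := W h (vsval z).
have VP h : av_over (base_norm R (Some p)) (V h).
  split; first exact: (av_comp (aW h) vsval).
  move=> q; rewrite -(Wrat h) /V; congr (W h _); rewrite linearZ; congr (_ *: _).
  exact: (rmorph1 (vsval : {rmorphism subvs_of M' -> N})).
(* Several h may restrict to the same absolute value on M'; where V h agrees with V h0, y' is
   already small. *)
pose s := [seq V h | h <- enum {: gal_of {:N}} & `[< V h0 <> V h >]].
have [B B0 hB] := seq_upper_bound (enum {: gal_of {:N}}) (fun h => W h y').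
(* The bound 1 forces z to have size exactly 1 at h0; the bound B^-1 makes z * y' smaller than 1
   elsewhere. *)
pose e := Num.min 1 B^-1.
have e0 : 0 < e by rewrite lt_min ltr01 invr_gt0.
have [c hc] := base_norm_gt1 R vb.
have [v vs|z [z1 z2]] := approx_idempotent hc (s := s) (VP h0) _ e0.
  case/mapP: vs => h; rewrite mem_filter => /andP [/asboolP hh _] ->; split=> //.
have zW : W h0 (vsval z) = 1.
  have lt1 : W h0 (vsval z - 1) < 1.
    have -> : W h0 (vsval z - 1) = V h0 (z - 1).
      rewrite /V; congr (W h0 _); rewrite (rmorphB (vsval : {rmorphism subvs_of M' -> N})).
      by rewrite (rmorph1 (vsval : {rmorphism subvs_of M' -> N})).
    by apply: (lt_le_trans z1); rewrite ge_min lexx.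
  apply/eqP; rewrite eq_le; apply/andP; split.
    rewrite -(subrK 1 (vsval z)); apply: (le_trans (uW h0 _ _)).
    by rewrite ge_max (ltW lt1) (av1 (aW h0)) lexx.
  have := uW h0 (1 - vsval z) (vsval z); rewrite subrK (av1 (aW h0)) le_max.
  by rewrite (av_distC (aW h0)) leNgt lt1.
have zy h : W h (vsval z * y') < 1.
  rewrite (avM (aW h)); have [hh|hh] := pselect (V h0 = V h).
    have e1 (u : subvs_of M') : W h (vsval u) = W h0 (vsval u).
      exact: esym (congr1 (fun f => f u) hh).
    have -> : W h y' = W h0 y' by have := e1 (Subvs y'M).
    by rewrite e1 zW mul1r.
  have zs : V h z < e.
    by apply: z2; apply: map_f; rewrite mem_filter mem_enum andbT; apply/asboolP.
  have yB : W h y' <= B by apply: hB; rewrite mem_enum.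
  apply: (@le_lt_trans _ _ (V h z * B)); first by rewrite ler_wpM2l ?(av_ge0 (aW h)).
  rewrite -ltr_pdivlMr // div1r; apply: (lt_le_trans zs).
  by rewrite ge_min lexx orbT.
have := small _ (memvM (subvsP z) y'M) zy h0.
by rewrite (avM (aW h0)) zW mul1r leNgt y'p.
Qed.

Section TotallyRamified.
Variables (M : {subfield N}) (r : N) (d : nat) (pi : R).
Hypotheses (uM : unramified M) (d0 : (0 < d)%N) (rd : r ^+ d = p%:R).
Hypotheses (pi0 : 0 <= pi) (pid : pi ^+ d = p%:R^-1).

Let pi_gt0 : 0 < pi.
Proof.
rewrite lt_def pi0 andbT; apply/eqP => e; move: pid.
by rewrite e expr0n gtn_eqF // => /esym/eqP; rewrite invr_eq0 gt_eqF.
Qed.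

Let pi1 : pi < 1.
Proof.
by rewrite -(@expr_lt1 _ d) // pid invf_lt1.
Qed.

Let Wr h : W h r = pi.
Proof.
apply/eqP; rewrite -(@eqrXn2 _ d) ?av_ge0 //.
by rewrite -(avX (aW h)) rd Wp pid.
Qed.

Let Wmono h a k : a \in M -> a != 0 ->
  exists2 e : int, W h (a * r ^+ k) = pi ^ e & exists m : int, e = k%:Z - d%:Z * m.
Proof.
move=> aM a0; have [m hm] := uM h aM a0.
exists (k%:Z - d%:Z * m); last by exists m.
rewrite (avM (aW h)) (avX (aW h)) Wr /W hm.
have -> : p%:R = pi ^- d :> R by rewrite pid invrK.
by rewrite exprnN exprz_exp exprnP -exprzDr ?unitfE ?gt_eqF // mulNr addrC.
Qed.

Let pi_expz_lt (e e' : int) : (pi ^ e < pi ^ e') = (e' < e).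
Proof.
have pi'1 : 1 < pi^-1 by rewrite invf_gt1.
have E x : pi ^ x = pi^-1 ^ (- x) by rewrite exprz_inv opprK.
by rewrite !E ltr_eXz2l // ltrN2.
Qed.

Let pi_expz_le (e e' : int) : (pi ^ e <= pi ^ e') = (e' <= e).
Proof. by rewrite !leNgt pi_expz_lt. Qed.

(* The terms [a k * r ^ k] of [y] have pairwise distinct valuations, and so do
   those of [tau y], which have the same valuations. *)
Lemma ramified_dist y tau h : y \in << M; r >>%VS -> tau \in 'Gal({:N} / M)%g ->
  W h (y - tau y) <= pi * (Num.max 1 (W h y) * Num.max 1 (W h (tau y))).
Proof.
move=> yM tauM.
have [a [aM yE]] : exists a : 'I_d -> N, (forall k, a k \in M) /\
    y = \sum_k a k * r ^+ k.
  exists (fun k => (Fadjoin_poly M r y)`_k); split.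
    by move=> k; apply: (polyOverP (Fadjoin_polyOver _ _ _)).
  rewrite -{1}(Fadjoin_poly_eq yM) -horner_coef_wide //.
  apply: leq_trans (size_Fadjoin_poly _ _ _) _; rewrite -ltnS -size_minPoly.
  have XM : 'X^d - (p%:R)%:P \is a polyOver M.
    by rewrite rpredB ?rpredX ?polyOverX // polyOverC rpred_nat.
  have Xr : root ('X^d - (p%:R)%:P) r by rewrite rootE !hornerE rd subrr.
  have := minPoly_dvdp XM Xr => /dvdp_leq.
  by rewrite size_XnsubC // => -> //; rewrite -size_poly_eq0 size_XnsubC.
have taua k : tau (a k) = a k by apply: fixed_gal (subvf M) tauM (aM k).
have taurd : tau r ^+ d = p%:R by rewrite -rmorphXn rd rmorph_nat.
have pi_neq1 : pi != 1 by rewrite lt_eqF.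
pose t (k : 'I_d) := a k * r ^+ k.
have Wtau k : W h (tau (t k)) = W h (t k).
  have -> : tau (t k) = a k * tau r ^+ k by rewrite /t rmorphM /= taua rmorphXn.
  rewrite /t !(avM (aW h)) !(avX (aW h)) Wr.
  by rewrite WM Wr.
have RHS1 : pi <= pi * (Num.max 1 (W h y) * Num.max 1 (W h (tau y))).
  by rewrite ler_peMr // mulr_ege1 // le_max lexx.
have [k1 ak1|all0] := pickP (fun k => a k != 0); last first.
  apply: le_trans RHS1; suff -> : y = 0 by rewrite rmorph0 subrr (av0 (aW h)).
  by rewrite yE big1 // => k _; move/negbFE/eqP: (all0 k) => ->; rewrite mul0r.
have [k0 ak0 kmax] : exists2 k0, a k0 != 0 & forall k, a k != 0 -> W h (t k) <= W h (t k0).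
  case: (@arg_maxP _ R _ k1 (fun k => a k != 0) (fun k => W h (t k)) ak1) => k0 h1 h2.
  by exists k0.
have [e0 te0 [m0 e0E]] := Wmono h k0 (aM k0) ak0.
have klt k : k != k0 -> W h (t k) < W h (t k0).
  move=> kk0; have [az|an] := eqVneq (a k) 0.
    by rewrite /t az mul0r (av0 (aW h)) te0 exprz_gt0.
  rewrite lt_neqAle kmax // andbT; have [e te [m eE]] := Wmono h k (aM k) an.
  apply: contraNneq kk0; rewrite {1}/t te te0 => /(ieexprIz pi_gt0 pi_neq1) ee.
  apply/eqP/val_inj; rewrite eE e0E in ee.
  exact: int_residue (ltn_ord k) (ltn_ord k0) ee.
have Wsum f : (forall k, W h (f k) = W h (t k)) -> W h (\sum_k f k) = pi ^ e0.
  move=> fE; have fk0 : W h (f k0) = pi ^ e0 by rewrite fE.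
  rewrite (bigD1 k0) //=; set z := \sum_(i < d | _) _.
  have zlt : W h z < W h (f k0).
    rewrite /z; apply: ultrametric_sum_lt => // [|k kk0]; first by rewrite fk0 exprz_gt0.
    by rewrite !fE klt.
  rewrite -fk0; apply/eqP; rewrite eq_le; apply/andP; split.
    by apply: (le_trans (uW h _ _)); rewrite ge_max lexx ltW.
  have := uW h (f k0 + z) (- z); rewrite addrK le_max (avN (aW h)).
  by case/orP => //; rewrite leNgt zlt.
have Wy : W h y = pi ^ e0 by rewrite yE Wsum.
have tauyE : tau y = \sum_k tau (t k) by rewrite yE rmorph_sum.
have Wty : W h (tau y) = pi ^ e0 by rewrite tauyE Wsum.
(* If |y| <= 1, all terms have size at most 1. The term k = 0 lies in M and cancels in y - tau y;
   the others have nonzero exponent, hence size at most pi. *)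
have [T1|T1] := leP (pi ^ e0) 1.
  apply: le_trans RHS1; rewrite tauyE {1}yE -sumrB.
  apply: ultrametric_sum => // k _.
  have [az|an] := eqVneq (a k) 0.
    by rewrite /t az mul0r rmorph0 subr0 (av0 (aW h)).
  have [kz|kn] := eqVneq (k : nat) 0%N.
    by rewrite /t kz expr0 mulr1 taua subrr (av0 (aW h)).
  apply: (@le_trans _ _ (W h (t k))).
    apply: (le_trans (uW h _ _)); rewrite (avN (aW h)) Wtau /t ge_max lexx //.
  have [e te [m eE]] := Wmono h k (aM k) an; rewrite /t te -[leRHS]expr1z pi_expz_le.
  have e_ge0 : 0 <= e.
    rewrite -pi_expz_le expr0z; apply: le_trans T1; rewrite -te -te0; exact: kmax.
  have kd := ltn_ord k; have : e != 0.
    apply: contraNneq kn => ez; apply/eqP; apply: (int_residue (m := m) (n := 0) kd d0).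
    by rewrite -eE ez mulr0 subr0.
  by rewrite -gtz0_ge1 lt_def e_ge0 andbT.
(* Now e0 <= -1, so pi ^ e0 <= pi ^ (1 + 2 * e0), which is pi |y| |tau y|. *)
rewrite Wy Wty max_r ?(ltW T1) //.
apply: (@le_trans _ _ (pi ^ e0)).
  by apply: (le_trans (uW h _ _)); rewrite (avN (aW h)) Wy Wty ge_max lexx.
rewrite mulrA ler_peMl ?exprz_ge0 // -[X in X * _]expr1z -exprzDr ?unitfE ?gt_eqF //.
rewrite -(expr0z pi) pi_expz_le; move: T1.
by rewrite -(expr0z pi) pi_expz_lt addrC lezD1.
Qed.

End TotallyRamified.

End Ramification.

(** * Lower bound for heights at a ramified step *)

Section HeightLowerBound.
Variables (R : realType) (w : option nat -> algC -> R).
Hypothesis w_ext : forall b, valid_base b ->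
  [/\ absolute_value (w b), forall q : rat, w b (ratr q) = base_norm R b q
     & b -> ultrametric (w b)].
Variables (N : splittingFieldType rat) (NC : {rmorphism N -> algC}).
Local Notation G := ('Gal({:N} / 1)%g).

(* The product formula for the norm of [y - tau y], whose valuations above [p]
   are all at least [1 / d]. *)
Lemma height_ge_ramified (p d : nat) (M : {subfield N}) (r y : N) (rho : R) :
    prime p -> unramified w NC p M -> (0 < d)%N -> r ^+ d = p%:R ->
    0 <= rho -> rho ^+ d = p%:R -> y \in << M; r >>%VS -> y \notin M ->
  rho <= 2 * weil_height R (NC y) ^+ 2.
Proof.
move=> pp uM d0 rd rho0 rhod yM yNM.
have rho_gt0 : 0 < rho.
  rewrite lt_def rho0 andbT; apply/eqP => e; move: rhod.
  by rewrite e expr0n gtn_eqF // => /esym/eqP; rewrite pnatr_eq0 gtn_eqF ?prime_gt0.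
have [tau tauM tauy] : exists2 tau, tau \in 'Gal({:N} / M)%g & tau y != y.
  apply: contrapT => h; move/negP: yNM; apply.
  have /galois_fixedField <- := galois_rat M.
  apply/fixedFieldP; first exact: memvf.
  by move=> g gM; apply: contrapT => /eqP gy; apply: h; exists g.
(* The norm of y - tau y is a nonzero rational z, to which the product formula on Q applies. *)
have := mem_galNorm (galois_rat 1%AS) (memvf (y - tau y)).
case/vlineP => z zE.
have z0 : z != 0.
  have : galNorm 1 {:N} (y - tau y) != 0 by rewrite galNorm_eq0 subr_eq0 eq_sym.
  by rewrite zE; apply: contra_neq => ->; rewrite scale0r.
pose C b := conj_height w NC b y.
have C1 b : 1 <= C b by apply: conj_height_ge1.
(* y and tau y have the same conjugates; this is the origin of the square. *)
have Cge b : \prod_(h in G) (Num.max 1 (w b (NC (h y))) * Num.max 1 (w b (NC (h (tau y))))) = C b ^+ 2.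
  rewrite big_split expr2; congr (_ * _).
  rewrite /C /conj_height [RHS](reindex_inj (mulgI tau)) /=.
  rewrite [RHS](eq_bigl (fun h => h \in G)) => [|h]; last by rewrite !mem_gal_rat.
  by apply: eq_bigr => h _; rewrite galM ?memvf.
(* A gain of rho^-1 at p against a loss of 2 at infinity: the product over the places is 2 / rho. *)
pose kappa b : R := if b is Some q then (if q == p then rho^-1 else 1) else 2.
have normb b : valid_base b -> base_norm R b z <= kappa b ^+ #|G| * C b ^+ 2.
  move=> vb; have [aw wq _] := w_ext vb.
  have -> : base_norm R b z = \prod_(h in G) w b (NC (h (y - tau y))).
    rewrite -wq -(av_prod aw) -rmorph_prod; congr (w b _).
    by rewrite -/(galNorm 1 {:N} (y - tau y)) zE rmorphZ_num rmorph1 mulr1.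
  rewrite -Cge -prodr_const -big_split; apply: ler_prod => h _ /=.
  rewrite (av_ge0 aw) /= /kappa.
  have le_const k : k = base_const R b ->
      w b (NC (h (y - tau y))) <= k * (Num.max 1 (w b (NC (h y))) * Num.max 1 (w b (NC (h (tau y))))).
    move=> ->; rewrite !rmorphB /=; apply: (le_trans (base_sub w_ext _ _ vb)).
    rewrite ler_pM2l ?base_const_gt0 //; set u := w b _; set v := w b _.
    have u1 : 1 <= Num.max 1 u by rewrite le_max lexx.
    have v1 : 1 <= Num.max 1 v by rewrite le_max lexx.
    rewrite ge_max; apply/andP; split.
      apply: (@le_trans _ _ (Num.max 1 u)); first by rewrite le_max lexx orbT.
      by rewrite ler_peMr // (le_trans ler01).
    apply: (@le_trans _ _ (Num.max 1 v)); first by rewrite le_max lexx orbT.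
    by rewrite ler_peMl // (le_trans ler01).
  case: b vb aw wq le_const => [q|] vb aw wq le_const; last exact: le_const.
  have [qp|qp] := eqVneq q p; last exact: le_const.
  rewrite qp; apply: (ramified_dist w_ext pp uM d0 rd) => //.
    by rewrite invr_ge0.
  by rewrite exprVn rhod.
(* p is included explicitly so that the factor rho^-1 occurs in the product. *)
pose S := undup (p :: primes `|numq z| ++ primes `|denq z|).
have pS q : q \in S -> prime q.
  rewrite mem_undup in_cons mem_cat !mem_primes.
  by case/orP => [/eqP ->|/orP [/and3P []|/and3P []]].
have uS : uniq S by apply: undup_uniq.
have pinS : p \in S by rewrite mem_undup mem_head.
have sub1 : {subset primes `|numq z| <= S}.
  by move=> q qn; rewrite mem_undup in_cons mem_cat qn orbT.
have sub2 : {subset primes `|denq z| <= S}.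
  by move=> q qn; rewrite mem_undup in_cons mem_cat qn !orbT.
clearbody S; have pf := prod_base_norm R z0 uS pS sub1 sub2.
set B := None :: _ in pf.
have vB b : b \in B -> valid_base b.
  by rewrite in_cons => /orP [/eqP -> //|/mapP [q /pS pq ->]].
have uB : uniq B.
  rewrite /B /= map_inj_uniq ?uS ?andbT; last by move=> ? ? [].
  by apply/mapP => -[].
have prodk : \prod_(b <- B) kappa b = 2 * rho^-1.
  rewrite /B big_cons big_map /=; congr (_ * _).
  rewrite (bigD1_seq p) //=.
  by rewrite eqxx big1 ?mulr1 // => q /negPf ->.
set H := weil_height R (NC y).
have H1 : 1 <= H by apply: weil_height_ge1.
have H0 : 0 <= H by rewrite (le_trans ler01).
have k0 b : 0 <= kappa b.
  by rewrite /kappa; case: b => [q|] //; case: eqP; rewrite ?invr_ge0.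
have : 1 <= (2 * rho^-1 * H ^+ 2) ^+ #|G|.
  rewrite -[leLHS]pf exprMn -prodk -prodrXl -exprM mulnC exprM.
  apply: (@le_trans _ _ (\prod_(b <- B) (kappa b ^+ #|G| * C b ^+ 2))).
    rewrite big_seq [leRHS]big_seq; apply: ler_prod => b /vB vb.
    by rewrite normb // andbT; have [aw <- _] := w_ext vb; rewrite av_ge0.
  rewrite big_split /= ler_wpM2l //.
    by apply: prodr_ge0 => b _; rewrite exprn_ge0.
  rewrite prodrXl lerXn2r ?nnegrE ?exprn_ge0 //.
    by apply: prodr_ge0 => b _; rewrite (le_trans _ (C1 b)).
  exact: conj_height_ge.
have H20 : 0 <= 2 * rho^-1 * H ^+ 2 by rewrite !mulr_ge0 ?exprn_ge0 ?invr_ge0.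
rewrite expr_ge1 ?cardG_gt0 // mulrAC ler_pdivlMr // mul1r //.
Qed.

End HeightLowerBound.

(** * Finitely generated subfields *)

(** The elements of s need not generate a normal field; N is generated by all roots of a polynomial
    vanishing on s. *)
Lemma exists_splitting_field (s : seq algC) :
  exists (N : splittingFieldType rat) (NC : {rmorphism N -> algC}) (s' : seq N),
    map NC s' = s.
Proof.
have /choice [m mP] : forall x : algC, exists q : {poly rat},
    q != 0 /\ root (map_poly ratr q) x.
  move=> x; have [q [_ qm] qx] := minCpolyP x; exists q.
  by rewrite monic_neq0 // qx.
pose q := \prod_(x <- s) m x.
have q0 : q != 0.
  apply: (big_ind (fun x => x != 0)) => [|x y|x _]; [exact: oner_neq0|exact: mulf_neq0|].
  by case: (mP x).
have [rs rsE] := closed_field_poly_normal (map_poly ratr q : {poly algC}).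
have [L [LC [rr rrE rrgen]]] := num_field_exists rs.
have qL : map_poly LC (map_poly (in_alg L) q) = map_poly ratr q.
  by rewrite -map_poly_comp; apply: eq_map_poly => c /=; rewrite rmorphZ_num rmorph1 mulr1.
have split : SplittingField.axiom L.
  exists (map_poly (in_alg L) q); first by apply/polyOver1P; exists q.
  exists rr => //; rewrite -(eqp_map LC) qL rsE -rrE big_map.
  have -> : map_poly LC (\prod_(z <- rr) ('X - z%:P)) = \prod_(z <- rr) ('X - (LC z)%:P).
    by rewrite rmorph_prod; apply: eq_bigr => z _; rewrite /= map_polyXsubC.
  by apply: eqp_scale; rewrite lead_coef_eq0 map_poly_eq0.
pose N : splittingFieldType rat := HB.pack L (FieldExt_isSplittingField.Build rat L split).
have /choice [f fP] : forall x, exists y : L, x \in s -> LC y = x.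
  move=> x; have [xs|_] := boolP (x \in s); last by exists 0.
  have : x \in rs.
    have lq0 : lead_coef (map_poly ratr q : {poly algC}) != 0.
      by rewrite lead_coef_eq0 map_poly_eq0.
    rewrite -root_prod_XsubC -(rootZ _ _ lq0) -rsE /q (big_rem x) //= rmorphM rootM.
    by case: (mP x) => _ ->.
  by rewrite -rrE => /mapP [y _ ->]; exists y.
exists N, LC, (map f s); rewrite -map_comp -[RHS]map_id.
by apply/eq_in_map => x xs /=; apply: fP.
Qed.

Lemma divring_subring (E : set algC) : divring_closed (mem E) -> subring_set E.
Proof.
move=> [E1 EB Ediv]; have toE x : (x \in mem E) = (x \in E) by [].
have B x y : E x -> E y -> E (x - y).
  by move=> Ex Ey; apply/set_mem/EB; apply/mem_set.
split=> //; first exact/set_mem.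
move=> x y Ex Ey; rewrite -[y]invrK -[y^-1]mul1r.
apply/set_mem/Ediv; first exact/mem_set.
by apply/Ediv => //; apply/mem_set.
Qed.

Lemma divring_rat (E : set algC) (c : rat) : divring_closed (mem E) -> E (ratr c).
Proof.
move=> dE; have sE := divring_subring dE; case: dE => _ _ Ediv.
by rewrite /ratr; apply/set_mem/Ediv; apply/mem_set; apply: subring_set_int.
Qed.

Lemma subfield_generated_closed S : divring_closed (mem (subfield_generated S)).
Proof.
split.
- by apply/mem_set => E [[E1 _ _] _]; apply/set_mem.
- move=> x y /set_mem gx /set_mem gy; apply/mem_set => E EP.
  by case: (EP) => -[_ EB _] _; apply/set_mem/EB; apply/mem_set; [apply: gx|apply: gy].
- move=> x y /set_mem gx /set_mem gy; apply/mem_set => E EP.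
  by case: (EP) => -[_ _ Ed] _; apply/set_mem/Ed; apply/mem_set; [apply: gx|apply: gy].
Qed.

Lemma subfield_generated_sub S : S `<=` subfield_generated S.
Proof. by move=> x Sx E [_]; apply. Qed.

Lemma subfield_generated_min S E :
  divring_closed (mem E) -> S `<=` E -> subfield_generated S `<=` E.
Proof. by move=> dE SE x; apply. Qed.

(** Carries subfields of algC, defined as intersections, to subfields of N, where the ramification
    results apply. *)
Lemma subfield_generated_image (N : splittingFieldType rat)
    (NC : {rmorphism N -> algC}) (s : seq N) :
  subfield_generated [set` map NC s] = NC @` [set y | y \in << 1 & s >>%AS].
Proof.
apply/seteqP; split.
  apply: subfield_generated_min.
    split; first by apply/mem_set; exists 1; rewrite ?rmorph1 //=; apply: mem1v.
      move=> _ _ /set_mem [x xM <-] /set_mem [y yM <-]; apply/mem_set.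
      by exists (x - y); rewrite ?rmorphB //=; apply: memvB.
    move=> _ _ /set_mem [x xM <-] /set_mem [y yM <-]; apply/mem_set.
    exists (x / y); first by rewrite /= rpred_div.
    by rewrite rmorphM fmorphV.
  move=> _ /mapP [x xs ->]; exists x => //=; exact: seqv_sub_adjoin.
have dE := subfield_generated_closed [set` map NC s].
have sE := divring_subring dE.
set E := subfield_generated _ in dE sE *.
have gE x : x \in s -> E (NC x).
  by move=> xs; apply: subfield_generated_sub; apply: map_f.
move: E dE sE gE => E dE sE.
elim/last_ind: s => [|s x IH] gE _ [y /= yM <-].
  move: yM; rewrite Fadjoin_nil => /vlineP [c ->].
  by rewrite rmorphZ_num rmorph1 mulr1; apply: divring_rat.
move: yM; rewrite adjoin_rcons => /Fadjoin_polyP [P PM ->].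
rewrite horner_coef rmorph_sum; apply: subring_set_sum => // i _.
case: (sE) => _ _ EM; rewrite rmorphM; apply: EM.
  apply: IH; last by exists P`_i => //; apply: (polyOverP PM).
  by move=> z zs; apply: gE; rewrite mem_rcons in_cons zs orbT.
rewrite rmorphXn; apply: subring_setX => //; apply: gE.
by rewrite mem_rcons mem_head.
Qed.

(** * Integrality and unit discriminants away from finitely many primes *)

Section GoodPrimes.
Variable R : realType.

Definition padic_ext p (v : algC -> R) :=
  absolute_value v /\ forall q : rat, v (ratr q) = padic_norm R p q.

(** B does not depend on the extension v: it bounds the primes dividing a denominator of a monic
    rational polynomial with root x. *)
Lemma padic_ext_integral (x : algC) : exists B : nat, forall p v,
  prime p -> (B < p)%N -> padic_ext p v -> v x <= 1.
Proof.
have [N [NC [s']]] := exists_splitting_field [:: x].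
case: s' => [|y [|? ?]] //= [yx]; have [q qm qy] := rat_poly_root y.
pose B := (\prod_(i < size q) `|denq q`_i|)%N.
have B0 : (0 < B)%N by rewrite prodn_gt0 // => i; rewrite absz_gt0 denq_neq0.
exists B => p v pp Bp [av vq].
have ov : @av_over R N (base_norm R (Some p)) (v \o NC).
  split; first exact: av_comp.
  by move=> c /=; rewrite rmorphZ_num rmorph1 mulr1 vq.
rewrite -yx; apply: (over_nonarch_le1 pp ov qm qy) => i.
have [li|li] := ltnP i (size q); last by rewrite nth_default // coprimen1.
rewrite prime_coprime //; apply/negP => /dvdn_leq; rewrite absz_gt0 denq_neq0.
move=> /(_ isT); rewrite leqNgt => /negP; apply; apply: leq_ltn_trans Bp.
apply: dvdn_leq => //.
by rewrite /B (bigD1 (Ordinal li)) //= dvdn_mulr.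
Qed.

Lemma padic_ext_seq (s : seq algC) : exists B : nat, forall p v,
  prime p -> (B < p)%N -> padic_ext p v ->
  forall x, x \in s -> v x <= 1 /\ (x != 0 -> v x = 1).
Proof.
elim: s => [|x s [B hB]]; first by exists 0%N.
have [B1 h1] := padic_ext_integral x; have [B2 h2] := padic_ext_integral x^-1.
exists (maxn B (maxn B1 B2)) => p v pp; rewrite !gtn_max => /and3P [b b1 b2] ev y.
rewrite in_cons => /orP [/eqP ->|]; last exact: (hB p v pp b ev).
have v1 := h1 p v pp b1 ev; split=> // x0; apply/eqP; rewrite eq_le v1 /=.
have [av _] := ev; have := h2 p v pp b2 ev.
by rewrite (avV av) invf_le1 // av_gt0.
Qed.

(** The finitely many roots of the minimal polynomial and their nonzero differences are units
    outside finitely many primes, a zero root aside. *)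
Lemma padic_ext_conj (beta : algC) : exists B : nat, forall p v,
  prime p -> (B < p)%N -> padic_ext p v ->
  forall x y, root (minCpoly beta) x -> root (minCpoly beta) y ->
  v x <= 1 /\ (x != y -> v (x - y) = 1).
Proof.
have [rs rsE] := closed_field_poly_normal (minCpoly beta).
have [B hB] := padic_ext_seq (rs ++ [seq x - y | x <- rs, y <- rs]).
have rrs x : root (minCpoly beta) x -> x \in rs.
  by rewrite rsE (monicP (minCpoly_monic _)) scale1r root_prod_XsubC.
exists B => p v pp Bp ev x y /rrs xr /rrs yr.
have h := hB p v pp Bp ev; split; first by case: (h x); rewrite // mem_cat xr.
rewrite -subr_eq0; case: (h (x - y)) => // ; rewrite mem_cat; apply/orP; right.
by apply/allpairsP; exists (x, y).
Qed.

End GoodPrimes.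

Section GoodGenerators.
Variables (R : realType) (w : option nat -> algC -> R).
Hypothesis w_ext : forall b, valid_base b ->
  [/\ absolute_value (w b), forall q : rat, w b (ratr q) = base_norm R b q
     & b -> ultrametric (w b)].
Variables (N : splittingFieldType rat) (NC : {rmorphism N -> algC}) (p : nat).
Hypothesis p_prime : prime p.

Let aw : absolute_value (w (Some p)). Proof. by case: (w_ext (p_prime : valid_base (Some p))). Qed.

(** These are the hypotheses of [unramified_adjoin]: beta is integral at p and its conjugates stay
    distinct modulo p. *)
Definition unramified_gen (beta : N) :=
  (forall h : gal_of {:N}, w (Some p) (NC (h beta)) <= 1) /\
  (forall h g : gal_of {:N}, h beta != g beta ->
     w (Some p) (NC (h beta - g beta)) = 1).

Lemma unramified_seq (s : seq N) : (forall beta, beta \in s -> unramified_gen beta) ->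
  unramified w NC p << 1 & s >>%AS.
Proof.
elim/last_ind: s => [|s x IH] hs.
  apply: unramified_sub (unramified1 w_ext NC p_prime); by rewrite /= Fadjoin_nil.
have us : unramified w NC p << 1 & s >>%AS.
  by apply: IH => y ys; apply: hs; rewrite mem_rcons in_cons ys orbT.
have [g1 g2] : unramified_gen x by apply: hs; rewrite mem_rcons mem_head.
have ua := @unramified_adjoin R w w_ext N NC p p_prime _ x us g1 g2.
apply: unramified_sub ua.
by rewrite /= adjoin_rcons.
Qed.

(* If [u <> v] are roots of [X ^ d - c] then [\sum_i u ^ (d - 1 - i) * v ^ i = 0],
   while this sum is congruent to the unit [d * u ^ (d - 1)] modulo [u - v]. *)
Lemma unramified_gen_radical (beta : N) (d c : nat) : (0 < d)%N ->
  beta ^+ d = c%:R -> coprime p d -> coprime p c -> unramified_gen beta.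
Proof.
move=> d0 bd cd cc; have [_ wq uw] := w_ext (p_prime : valid_base (Some p)).
have {}uw := uw isT.
have wnat n : coprime p n -> w (Some p) n%:R = 1.
  move=> cn; have n0 : (0 < n)%N.
    by rewrite lt0n; apply: contraTneq cn => ->; rewrite /coprime gcdn0 gtn_eqF ?prime_gt1.
  rewrite -(ratr_nat _ n) wq /= /padic_norm pnatr_eq0 gtn_eqF //.
  rewrite -[n%:R]/(n%:Z%:~R) denq_int numq_int /= logn1.
  by rewrite logn_coprime // subrr expr0z.
have hd (h : gal_of {:N}) : NC (h beta) ^+ d = c%:R by rewrite -!rmorphXn bd !rmorph_nat.
have w1 x : x ^+ d = c%:R -> w (Some p) x = 1.
  by move=> xd; apply/eqP; rewrite -(@pexpr_eq1 _ _ d) ?av_ge0 // -avX // xd wnat.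
split=> [h|h g hg]; first by rewrite w1.
rewrite rmorphB /=; set u := NC (h beta); set v := NC (g beta).
have wu : w (Some p) u = 1 by rewrite w1 // hd.
have wv : w (Some p) v = 1 by rewrite w1 // hd.
have uv : u - v != 0 by rewrite subr_eq0 (inj_eq (fmorph_inj NC)).
apply/eqP; rewrite eq_le; apply/andP; split.
  by apply: (le_trans (uw _ _)); rewrite (avN aw) wu wv max_l.
rewrite leNgt; apply/negP => lt1.
have s0 : \sum_(i < d) u ^+ (d.-1 - i) * v ^+ i = 0.
  apply/eqP; have : (u - v) * \sum_(i < d) u ^+ (d.-1 - i) * v ^+ i = 0.
    by rewrite -subrXX !hd subrr.
  by move/eqP; rewrite mulf_eq0 (negPf uv).
have : w (Some p) (d%:R * u ^+ d.-1) < 1.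
  have -> : d%:R * u ^+ d.-1 = \sum_(i < d) u ^+ (d.-1 - i) * (u ^+ i - v ^+ i).
    under [RHS]eq_bigr => i _ do rewrite mulrBr -exprD subnK -1?ltnS ?prednK //.
    by rewrite sumrB s0 subr0 sumr_const card_ord mulr_natl.
  apply: ultrametric_sum_lt => // i _; rewrite subrXX !(avM aw) (avX aw) wu expr1n mul1r.
  apply: le_lt_trans lt1; rewrite ler_piMr ?av_ge0 //.
  apply: ultrametric_sum => // j _.
  by rewrite (avM aw) !(avX aw) wu wv !expr1n mulr1.
by rewrite (avM aw) (avX aw) wu expr1n mulr1 wnat // ltxx.
Qed.

Lemma unramified_gen_conj (beta : N) :
    (forall x y, root (minCpoly (NC beta)) x -> root (minCpoly (NC beta)) y ->
      w (Some p) x <= 1 /\ (x != y -> w (Some p) (x - y) = 1)) ->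
  unramified_gen beta.
Proof.
move=> hyp; have rooth (h : gal_of {:N}) : root (minCpoly (NC beta)) (NC (h beta)).
  have [q [qE _] dq] := minCpolyP (NC beta).
  have : root (map_poly ratr q) (NC beta) by rewrite dq.
  have e : map_poly ratr q = map_poly NC (map_poly h (map_poly (in_alg N) q)).
    rewrite -!map_poly_comp; apply: eq_map_poly => a /=.
    by rewrite linearZ /= rmorph1 rmorphZ_num rmorph1 mulr1.
  have e' : map_poly ratr q = map_poly NC (map_poly (in_alg N) q).
    rewrite -!map_poly_comp; apply: eq_map_poly => a /=.
    by rewrite rmorphZ_num rmorph1 mulr1.
  by rewrite {1}e' fmorph_root => h0; rewrite qE e !fmorph_root.
split=> [h|h g hg]; first by case: (hyp _ _ (rooth h) (rooth h)).
rewrite rmorphB; case: (hyp _ _ (rooth h) (rooth g)) => _; apply.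
by rewrite (inj_eq (fmorph_inj NC)).
Qed.

End GoodGenerators.

(** * Towers of radical extensions *)

Section RadicalTower.
Variables (R : realType) (K : fieldExtType rat) (iota : {rmorphism K -> algC}).
Variables (p d : nat -> nat) (r : nat -> algC).
Hypotheses (p_prime : forall i, prime (p i)).
Hypotheses (p_incr : forall i j, (i < j)%N -> (p i < p j)%N).
Hypotheses (d_gt0 : forall i, (0 < d i)%N).
Hypotheses (r_root : forall i, r i ^+ d i = (p i)%:R).

Let L := subfield_generated (range iota `|` range r).

(** r i = r j would give p_i ^ d_j = p_j ^ d_i, against unique factorization. *)
Lemma root_prime_inj : injective r.
Proof.
have lt_neq i j : (i < j)%N -> r i = r j -> False.
  move=> ij rij; have := r_root i; rewrite rij => rj.
  have : r j ^+ (d i * d j) = r j ^+ (d j * d i) by rewrite mulnC.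
  rewrite !exprM rj r_root -!natrX => /eqP; rewrite eqr_nat => /eqP e.
  have : (p j %| p i ^ d j)%N by rewrite e dvdn_exp // dvdnn.
  rewrite Euclid_dvdX // d_gt0 andbT dvdn_prime2 // => /eqP pe.
  by have := p_incr ij; rewrite pe ltnn.
by move=> i j rij; case: (ltngtP i j) => // /lt_neq; [case|case; rewrite rij].
Qed.

Lemma prime_seq_ge i : (i <= p i)%N.
Proof. by elim: i => // i IH; apply: leq_ltn_trans (p_incr (ltnSn i)). Qed.

(** An inequality between natural numbers, through which bounds pass between algC and R. *)
Lemma norm_root_le i (T : nat) : (`|r i| <= T%:R) = (p i <= T ^ d i)%N.
Proof.
rewrite -(ler_pXn2r (d_gt0 i)) ?nnegrE //.
by rewrite -normrX r_root normr_nat -natrX ler_nat.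
Qed.

Lemma weil_height_root_le i (T : nat) : (0 < T)%N -> `|r i| <= T%:R ->
  weil_height R (r i) <= T%:R.
Proof.
move=> T0; rewrite norm_root_le => pT.
have [F [FC [a [aE _ ->]]]] := weil_heightE R (r i).
have ad : a ^+ d i = (p i)%:R by apply: (fmorph_inj FC); rewrite rmorphXn aE r_root rmorph_nat.
have vd u v : @av_over R F u v -> v a ^+ d i = u (p i)%:R.
  by move=> [av <-]; rewrite -(avX av) ad scaler_nat.
apply: field_height_le => [|v ov|q v pq ov]; first by rewrite ler1n.
  have [av _] := ov; have vE := vd _ _ ov.
  have va := av_ge0 av a; rewrite -(ler_pXn2r (d_gt0 i)) ?nnegrE // vE /=.
  by rewrite normr_nat ratr_nat -natrX ler_nat.
have [av _] := ov.
rewrite -(@expr_le1 _ (d i)) ?av_ge0 // (vd _ _ ov) /=.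
exact: padic_norm_nat.
Qed.

Lemma northcott_root_cvg : northcott R L -> `|r i| @[i --> \oo] --> +oo.
Proof.
move=> nL P [M [Mreal hM]].
apply: contrapT => nP.
have [T MT] : exists T : nat, M <= T%:R.
  exists (Num.truncn M).+1; apply/ltW; exact: real_truncnS_gt.
have T0 : (0 < T.+1)%N by [].
have inf n : exists2 i, (n <= i)%N & `|r i| <= T.+1%:R.
  apply: contrapT => h; apply: nP; exists n => // i /= ni; apply: hM.
  rewrite real_ltNge ?normr_real //; apply/negP => le; apply: h; exists i => //.
  by apply: (le_trans le); apply: (le_trans MT); rewrite ler_nat.
have T1 : 0 < T.+1%:R :> R by rewrite ltr0n.
have fin := finite_preimage (in2W root_prime_inj) (nL _ T1).
have /finite_seqP [s sE] := fin.
have [i si ri] := inf (\max_(j <- s) j).+1%N.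
have : i \in s.
  suff : [set` s] i by [].
  rewrite -sE; split; last exact: weil_height_root_le.
  by apply: subfield_generated_sub; right; exists i.
move=> /(@leq_bigmax_seq _ s xpredT id) /(_ isT).
by rewrite leqNgt si.
Qed.

(** A Q-basis of K replaces K, so that every stage of the tower has a finite list of generators. *)
Let s0 : seq algC := map iota (vbasis {:K}).
Let s n := s0 ++ mkseq r n.
Let Ln n := subfield_generated [set` s n].

Lemma tower_mono m n : (m <= n)%N -> Ln m `<=` Ln n.
Proof.
move=> mn; apply: subfield_generated_min; first exact: subfield_generated_closed.
move=> x /=; rewrite mem_cat => h; apply: subfield_generated_sub; rewrite /= mem_cat.
case/orP: h => [-> //|/mapP [i]]; rewrite mem_iota add0n => /= im ->.
by apply/orP; right; apply: map_f; rewrite mem_iota add0n (leq_trans im).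
Qed.

Lemma tower_union : L `<=` \bigcup_n Ln n.
Proof.
have two x y : (\bigcup_n Ln n) x -> (\bigcup_n Ln n) y -> exists n, Ln n x /\ Ln n y.
  move=> [m _ xm] [n _ yn]; exists (maxn m n).
  by split; [apply: tower_mono xm|apply: tower_mono yn]; rewrite leq_max leqnn ?orbT.
apply: subfield_generated_min.
  split.
  - apply/mem_set; exists 0%N => //.
    by have [/set_mem] := subfield_generated_closed [set` s 0].
  - move=> x y /set_mem xU /set_mem yU; have [n [xn yn]] := two _ _ xU yU.
    apply/mem_set; exists n => //; have [_ h _] := subfield_generated_closed [set` s n].
    by apply/set_mem/h; apply/mem_set.
  - move=> x y /set_mem xU /set_mem yU; have [n [xn yn]] := two _ _ xU yU.
    apply/mem_set; exists n => //; have [_ _ h] := subfield_generated_closed [set` s n].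
    by apply/set_mem/h; apply/mem_set.
move=> _ [[x _ <-]|[i _ <-]].
  exists 0%N => //; rewrite (coord_vbasis (memvf x)) rmorph_sum.
  have dE := subfield_generated_closed [set` s 0].
  have sE := divring_subring dE.
  apply: subring_set_sum => // i _; rewrite rmorphZ_num.
  case: (sE) => _ _ EM; apply: EM; first exact: divring_rat.
  apply: subfield_generated_sub => /=; rewrite mem_cat; apply/orP; left.
  by apply: map_f; apply: mem_nth; rewrite size_tuple.
exists i.+1 => //; apply: subfield_generated_sub; rewrite /= mem_cat; apply/orP; right.
by apply: map_f; rewrite mem_iota add0n /=.
Qed.

Lemma tower_step_height (w : option nat -> algC -> R) (X : R) :
    (forall b, valid_base b ->
      [/\ absolute_value (w b), forall q : rat, w b (ratr q) = base_norm R b q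
        & b -> ultrametric (w b)]) ->
    `|r i| @[i --> \oo] --> +oo ->
  exists i0, forall n, (i0 <= n)%N -> forall alpha, Ln n.+1 alpha ->
    weil_height R alpha <= X -> Ln n alpha.
Proof.
move=> w_ext rinf.
(* T exceeds 2 X ^ 2 in order to contradict the height bound; T >= 2 serves for d j < 2 ^ d j <= T ^
   d j < p j. *)
pose T := (maxn 2 (Num.truncn (2 * X ^+ 2)).+1)%N.
have [N1 hN1] : exists N1, forall i, (N1 <= i)%N -> (T ^ d i < p i)%N.
  have [|N1 _ h] := rinf [set x | T%:R < x].
    by exists T%:R; split; [exact: realn|].
  exists N1 => i /h /= Tr.
  by rewrite ltnNge -norm_root_le -real_ltNge ?normr_real // realn.
have [B hB] : exists B : nat, forall q v, prime q -> (B < q)%N -> padic_ext q v ->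
    forall beta x y, beta \in s0 -> root (minCpoly beta) x -> root (minCpoly beta) y ->
    v x <= 1 /\ (x != y -> (v : algC -> R) (x - y) = 1).
  elim: (s0) => [|beta t [B hB]]; first by exists 0%N.
  have [B' hB'] := padic_ext_conj R beta.
  exists (maxn B B') => q v pq; rewrite gtn_max => /andP [b b'] ev gamma x y.
  rewrite in_cons => /orP [/eqP ->|g]; first exact: (hB' q v).
  exact: (hB q v pq b ev gamma).
(* N1 makes r n large; the other terms put the bound B and all d j with j < N1 below n, hence below
   p n. *)
exists (maxn N1 (maxn B (\max_(j < N1) d j)).+1) => n.
rewrite geq_max gtn_max => /and3P [nN1 nB nd] alpha Lalpha Halpha.
have [N [NC [s' s'E]]] := exists_splitting_field (s n.+1).
have sS : s n.+1 = rcons (s n) (r n) by rewrite /s /mkseq -addn1 iotaD map_cat /= add0n catA cats1.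
case/lastP: s' s'E => [|s' z]; first by rewrite sS; case: (s n).
rewrite sS map_rcons => /rcons_inj [s'E zE].
have dltp j : (j <= n)%N -> (d j < p n)%N.
  move=> jn; have [jN|Nj] := ltnP j N1.
    apply: leq_trans (prime_seq_ge n); apply: leq_ltn_trans nd.
    exact: (leq_bigmax (Ordinal jN)).
  have pjn : (p j <= p n)%N.
    by move: jn; rewrite leq_eqVlt => /orP [/eqP -> //|/p_incr/ltnW].
  apply: leq_trans pjn; apply: leq_ltn_trans (hN1 j Nj).
  apply: leq_trans (ltnW (ltn_expl _ (isT : 1 < 2)%N)) _.
  by rewrite leq_exp2r // leq_max leqnn.
have copr c : (0 < c < p n)%N -> coprime (p n) c.
  case/andP => c0 cp; rewrite prime_coprime //; apply/negP => /(dvdn_leq c0).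
  by rewrite leqNgt cp.
have [aw wq _] := w_ext (Some (p n)) (p_prime n).
have uM : unramified w NC (p n) << 1 & s' >>%AS.
  apply: (unramified_seq w_ext (p_prime n)) => beta bs.
  have : NC beta \in s n by rewrite -s'E; apply: map_f.
  rewrite mem_cat => /orP [b0|/mapP [j]].
    apply: unramified_gen_conj => x y rx ry.
    apply: (hB (p n) _ _ _ _ (NC beta)) => //.
    exact: leq_trans nB (prime_seq_ge n).
  rewrite mem_iota add0n => /= jn bj.
  apply: (@unramified_gen_radical _ _ w_ext _ _ _ (p_prime n) _ (d j) (p j)) => //.
  - by apply: (fmorph_inj NC); rewrite rmorphXn /= bj r_root rmorph_nat.
  - by apply: copr; rewrite d_gt0 dltp // ltnW.
  - by apply: copr; rewrite prime_gt0 // p_incr.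
have := Lalpha; rewrite /Ln sS -s'E -zE -map_rcons subfield_generated_image.
move=> [y /= yM yE]; rewrite subfield_generated_image; exists y => //=.
apply: contraT => yNM.
have zd : z ^+ d n = (p n)%:R.
  by apply: (fmorph_inj NC); rewrite rmorphXn /= zE r_root rmorph_nat.
have [an nq _] := w_ext None isT.
(* The modulus of r n, now as an element of R. *)
pose rho := w None (r n).
have rhod : rho ^+ d n = (p n)%:R.
  by rewrite /rho -(avX an) r_root -ratr_nat nq /= normr_nat ratr_nat.
have := height_ge_ramified w_ext (p_prime n) uM (d_gt0 n) zd (av_ge0 an (r n)) rhod _ yNM.
rewrite -adjoin_rcons => /(_ yM).
rewrite yE leNgt => /negP; case.
have H0 : 0 <= weil_height R alpha by rewrite (le_trans ler01) // weil_height_ge1.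
have TX : 2 * X ^+ 2 < T%:R.
  apply: lt_le_trans (truncnS_gt _) _; rewrite ler_nat; exact: leq_maxr.
apply: (@le_lt_trans _ _ (2 * X ^+ 2)).
  by rewrite ler_pM2l // lerXn2r // nnegrE // (le_trans H0).
have rho0 : 0 <= rho by apply: av_ge0.
apply: (lt_trans TX); rewrite -(ltr_pXn2r (d_gt0 n)) ?nnegrE //.
by rewrite rhod -natrX ltr_nat hN1.
Qed.

End RadicalTower.

Theorem corollary2 (R : realType) (K : fieldExtType rat)
    (iota : {rmorphism K -> algC}) (p d : nat -> nat) (r : nat -> algC)
    (p_prime : forall i, prime (p i))
    (p_incr : forall i j, (i < j)%N -> (p i < p j)%N)
    (d_gt0 : forall i, (0 < d i)%N)
    (r_root : forall i, r i ^+ d i = (p i)%:R) :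
  northcott R (subfield_generated (range iota `|` range r)) <->
  `|r i| @[i --> \oo] --> +oo.
Proof.
split; first exact: northcott_root_cvg.
move=> rinf X X0; have [w w_ext] := exists_base_ext R.
have [i0 hi0] := tower_step_height iota p_prime p_incr d_gt0 r_root X w_ext rinf.
pose s n := map iota (vbasis {:K}) ++ mkseq r n.
have [N [NC [s' s'E]]] := exists_splitting_field (s i0).
have fin := northcott_number_field w_ext NC X.
apply: sub_finite_set (finite_image NC fin) => alpha [/(@tower_union _ iota r)].
move=> [n _ Lalpha] Halpha.
(* alpha appears at stage n, hence at stage i0 + n, from where it descends to i0 one stage at a
   time. *)
have desc k : subfield_generated [set` s (i0 + k)%N] alpha -> subfield_generated [set` s i0] alpha.
  elim: k => [|k IH]; first by rewrite addn0.
  by rewrite addnS => h; apply: IH; apply: hi0 => //; rewrite leq_addr.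
have : subfield_generated [set` s i0] alpha.
  by apply: (desc n); apply: tower_mono Lalpha; apply: leq_addl.
rewrite -s'E subfield_generated_image => -[y _ yE].
by exists y; rewrite //= yE.
Qed.
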